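(* Let $\mathcal{E}:\mathcal{A}\to\mathrm{Mat}_\ell(\mathbb{F}_f\{\{Z\}\}[\tau])$ be a $t$-module over $\mathbb{F}_f\{\{Z\}\}$, and let $\lambda\in\mathsf{A}_+$ be irreducible with $\lambda(\theta)\neq f$ such that: (a) $\mathcal{M}_{\mathcal{E}}(H)$ is free of rank $r$ over $H[t]$, (b) $\mathcal{N}_{\mathcal{E}}(H)$ is free of rank $r$ over $H[t]$, and (c) for every $m\geqslant1$, $\mathcal{E}[\lambda^m]$ and $\mathcal{E}^*[\lambda^m]$ have full dimension, where $H=\overline{\mathbb{F}_f}\{\{Z\}\}$. Then \[ \bigl[\mathcal{E}(\mathbb{F}_f\{\{Z\}\})\bigr]_{\mathcal{A}}=\gamma\cdot\mathrm{Char}(\tau^d,T_\lambda(\mathcal{E}),1), \] where $\gamma\in\mathbb{F}_q\{\{Z\}\}^\times$ is the unique element making the right-hand side monic in $t$.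
   Context: Let $q$ be a prime power, $A=\mathbb{F}_q[\theta]$, $\mathsf{A}=\mathbb{F}_q[t]$, $A_+,\mathsf{A}_+$ the monic elements. Fix an irreducible $f\in A_+$ of degree $d$, $\mathbb{F}_f=A/fA$, and let $\bar\theta\in\mathbb{F}_f$ be the image of $\theta$. Let $Z=\{z_1,\dots,z_n\}$ ($n\ge0$) be variables and for a field $F$ let $F\{\{Z\}\}$ denote (one fixed choice throughout) either the rational function field $F(Z)$ or the field of formal Laurent series $F((Z))$. Let $\mathcal{A}=\mathbb{F}_q\{\{Z\}\}[t]$ and let $\iota:\mathcal{A}\to\mathbb{F}_f\{\{Z\}\}$ be the $\mathbb{F}_q\{\{Z\}\}$-algebra map with $t\mapsto\bar\theta$. Let $\tau$ act on $H=\overline{\mathbb{F}_f}\{\{Z\}\}$ by raising coefficients to the $q$-th power (fixing each $z_i$); it is an automorphism with fixed field $\mathbb{F}_q\{\{Z\}\}$; put $\sigma=\tau^{-1}$, $x^{(i)}=\tau^i(x)$ entrywise. $H[\tau]$ ($\tau c=c^{(1)}\tau$) and $H[\sigma]$ ($\sigma c=c^{(-1)}\sigma$) are twisted polynomial rings; matrices over them act on column vectors by $(\sum B_i\tau^i)(\mathbf{x})=\sum B_i\mathbf{x}^{(i)}$, $(\sum C_i\sigma^i)(\mathbf{x})=\sum C_i\mathbf{x}^{(-i)}$. The anti-isomorphism $*:H[\tau]\to H[\sigma]$ is $(\sum b_i\tau^i)^*=\sum b_i^{(-i)}\sigma^i$, and for a matrix $B=(\beta_{ij})$, $B^*=(\beta_{ij}^*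 )^{\mathsf T}$. A $t$-module over $\mathbb{F}_f\{\{Z\}\}$ is an $\mathbb{F}_q\{\{Z\}\}$-algebra homomorphism $\mathcal{E}:\mathcal{A}\to\mathrm{Mat}_\ell(\mathbb{F}_f\{\{Z\}\}[\tau])$ such that the constant term $\partial\mathcal{E}_t$ satisfies $\partial\mathcal{E}_t-\bar\theta\mathrm{I}_\ell$ nilpotent; its adjoint is $\mathcal{E}^*_a=(\mathcal{E}_a)^*$. These make $H^\ell$ into $\mathcal{A}$-modules; $\mathcal{E}(\mathbb{F}_f\{\{Z\}\})$ is $\mathbb{F}_f\{\{Z\}\}^\ell$ with the action of $\mathcal{E}$, a finite-dimensional $\mathbb{F}_q\{\{Z\}\}$-space, hence a finitely generated torsion $\mathcal{A}$-module; for such $M\cong\bigoplus\mathcal{A}/(h_i)$ with $h_i$ monic in $t$, $[M]_{\mathcal{A}}=\prod h_i$. For $a\in\mathcal{A}$, $\mathcal{E}[a]=\{\mathbf{x}\in H^\ell:\mathcal{E}_a(\mathbf{x})=0\}$, $\mathcal{E}^*[a]=\{\mathbf{x}\in H^\ell:\mathcal{E}^*_a(\mathbf{x})=0\}$. The $t$-motive is $\mathcal{M}_{\mathcal{E}}(H)=\mathrm{Mat}_{1\times\ell}(H[\tau])$ with left $H[t]$-action $a\cdot m=m\mathcal{E}_a$ ($a\in\mathcal{A}$) and left multiplication by $H$; the dual $t$-motive is $\mathcal{N}_{\mathcal{E}}(H)=\mathrm{Mat}_{1\times\ell}(H[\sigma])$ with $a\cdot n=n\mathcal{E}^*_a$.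 Full dimension: for $\eta\in\mathrm{Mat}_\ell(H[\tau])$ with invertible constant term there are $U,V\in\mathrm{GL}_\ell(H[\tau])$ with $U\eta V=\mathrm{diag}(d_1,\dots,d_\ell)$, all $d_i\neq0$, and $\sum_i\deg_\tau d_i=\dim_H\mathrm{Mat}_{1\times\ell}(H[\tau])/\mathrm{Mat}_{1\times\ell}(H[\tau])\eta$ is independent of choices. The kernel $\{\mathbf{x}\in H^\ell:\eta(\mathbf{x})=0\}$ (resp. $\{\mathbf{x}:\eta^*(\mathbf{x})=0\}$) has full dimension if its $\mathbb{F}_q\{\{Z\}\}$-dimension equals $\sum_i\deg_\tau d_i$. For $\lambda$ as in the claim, $T_\lambda(\mathcal{E})=\varprojlim_m\mathcal{E}[\lambda^m]$ (transition maps $\mathcal{E}_\lambda$) is a module over $\mathcal{A}_\lambda=\varprojlim\mathcal{A}/\lambda^m\mathcal{A}$, free of rank $r$ under (a)--(c); $\tau^d$ acts on it (coefficientwise), and $\mathrm{Char}(\tau^d,T_\lambda(\mathcal{E}),X)$ is its characteristic polynomial. *)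

(* Defs.v *)
From HB Require Import structures.
From mathcomp Require Import all_boot all_order all_algebra all_solvable all_field.
From mathcomp Require Import mpoly.
From mathcomp Require Import boolp classical_sets.

Set Implicit Arguments.
Unset Strict Implicit.
Unset Printing Implicit Defensive.

Import Order.TTheory GRing.Theory.
Local Open Scope ring_scope.

(* F[[z_1, ..., z_n]], as coefficient functions on monomials. *)
Definition mpowser (n : nat) (R : Type) := 'X_{1..n} -> R.

Section PowerSeriesZmod.
Variables (n : nat) (R : nzRingType).
HB.instance Definition _ := gen_eqMixin (mpowser n R).
HB.instance Definition _ := gen_choiceMixin (mpowser n R).
Implicit Types f g h : mpowser n R.

Definition mps_zero : mpowser n R := fun=> 0.
Definition mps_opp f : mpowser n R := fun m => - f m.
Definition mps_add f g : mpowser n R := fun m => f m + g m.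

Fact mps_addA : associative mps_add.
Proof. by move=> f g h; apply/funext => m; apply: addrA. Qed.
Fact mps_addC : commutative mps_add.
Proof. by move=> f g; apply/funext => m; apply: addrC. Qed.
Fact mps_add0 : left_id mps_zero mps_add.
Proof. by move=> f; apply/funext => m; apply: add0r. Qed.
Fact mps_addN : left_inverse mps_zero mps_opp mps_add.
Proof. by move=> f; apply/funext => m; apply: addNr. Qed.
HB.instance Definition _ :=
  GRing.isZmodule.Build (mpowser n R) mps_addA mps_addC mps_add0 mps_addN.

Lemma mps0E m : (0 : mpowser n R) m = 0. Proof. by []. Qed.
Lemma mpsDE f g m : (f + g) m = f m + g m. Proof. by []. Qed.
Lemma mpsNE f m : (- f) m = - f m. Proof. by []. Qed.
End PowerSeriesZmod.

Section PowerSeriesRing.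
Variables (n : nat) (R : comNzRingType).
Implicit Types f g h : mpowser n R.

Definition mps_const (c : R) : mpowser n R := fun m => if m == 0%MM then c else 0.

(* Cauchy product: the sum over all pairs of monomials with product m. *)
Definition mps_mul f g : mpowser n R := fun m =>
  \sum_(k : 'X_{1..n < (mdeg m).+1, (mdeg m).+1} | m == (k.1 + k.2)%MM)
    f k.1 * g k.2.

Let trunc N f : {mpoly R[n]} := \sum_(k : 'X_{1..n < N}) f k *: 'X_[k].

Let coef_trunc N f m : (mdeg m < N)%N -> (trunc N f)@_m = f m.
Proof. by move=> lt; rewrite (mcoeff_mpoly (fun m => f m)). Qed.

Let mps_mulE N f g m : (mdeg m < N)%N ->
  mps_mul f g m = (trunc N f * trunc N g)@_m.
Proof.
move=> lt; rewrite mcoeffM; apply: eq_bigr => -[k1 k2] /= _.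
by rewrite !coef_trunc //; apply: leq_trans (bmdeg _) lt.
Qed.

Let mulE_ext N (p q p' q' : {mpoly R[n]}) m : (mdeg m < N)%N ->
  (forall k, (mdeg k < N)%N -> p@_k = p'@_k) ->
  (forall k, (mdeg k < N)%N -> q@_k = q'@_k) -> (p * q)@_m = (p' * q')@_m.
Proof.
move=> lt ep eq; rewrite !mcoeffM; apply: eq_bigr => -[k1 k2] /= _.
by rewrite ep ?eq //; apply: leq_trans (bmdeg _) lt.
Qed.

Fact mps_mulA : associative mps_mul.
Proof.
move=> f g h; apply/funext => m; have lt := ltnSn (mdeg m).
rewrite !(mps_mulE _ _ lt).
transitivity ((trunc (mdeg m).+1 f * (trunc (mdeg m).+1 g * trunc (mdeg m).+1 h))@_m).
  apply: (mulE_ext lt) => // k ltk; rewrite coef_trunc //; exact: mps_mulE.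
rewrite mulrA; apply: (mulE_ext lt) => // k ltk; rewrite coef_trunc //.
by rewrite -mps_mulE.
Qed.

Fact mps_mulC : commutative mps_mul.
Proof.
move=> f g; apply/funext => m; have lt := ltnSn (mdeg m).
by rewrite !(mps_mulE _ _ lt) mulrC.
Qed.

Fact mps_mul1 : left_id (mps_const 1) mps_mul.
Proof.
move=> f; apply/funext => m; have lt := ltnSn (mdeg m).
rewrite (mps_mulE _ _ lt) -[RHS](coef_trunc _ lt) -[in RHS](mul1r (trunc _ _)).
apply: (mulE_ext lt) => // k ltk; rewrite coef_trunc // mcoeff1 /mps_const.
by case: (k == _).
Qed.

Fact mps_mulDl : left_distributive mps_mul +%R.
Proof.
move=> f g h; apply/funext => m; have lt := ltnSn (mdeg m).
rewrite mpsDE !(mps_mulE _ _ lt) -mcoeffD -mulrDl.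
by apply: (mulE_ext lt) => // k ltk; rewrite mcoeffD !coef_trunc.
Qed.

Fact mps_oner_neq0 : mps_const 1 != 0.
Proof.
apply/eqP => /(congr1 (@^~ 0%MM)); rewrite /mps_const eqxx mps0E => /eqP.
by rewrite oner_eq0.
Qed.

HB.instance Definition _ := GRing.Zmodule_isComNzRing.Build (mpowser n R)
  mps_mulA mps_mulC mps_mul1 mps_mulDl mps_oner_neq0.

Lemma mps1E m : (1 : mpowser n R) m = (m == 0%MM)%:R.
Proof. by rewrite -[1 in LHS]/(mps_const 1) /mps_const; case: (m == _). Qed.

Lemma mpsME f g m : (f * g) m =
  \sum_(k : 'X_{1..n < (mdeg m).+1, (mdeg m).+1} | m == (k.1 + k.2)%MM)
    f k.1 * g k.2.
Proof. by []. Qed.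

Definition mps_unit : pred (mpowser n R) := fun f => `[< exists g, g * f = 1 >].
Definition mps_inv f : mpowser n R := xget f [set g | g * f = 1].

Fact mps_mulV : {in mps_unit, left_inverse 1 mps_inv *%R}.
Proof.
move=> f /asboolP[g gf1]; rewrite /mps_inv.
by case: xgetP => [h -> //|/(_ g)]; case.
Qed.
Fact mps_unitPl f g : g * f = 1 -> mps_unit f.
Proof. by move=> gf1; apply/asboolP; exists g. Qed.
Fact mps_inv_out : {in [predC mps_unit], mps_inv =1 id}.
Proof.
move=> f /asboolPn nf; rewrite /mps_inv.
by case: xgetP => // h _ hf1; case: nf; exists h.
Qed.
HB.instance Definition _ := GRing.ComNzRing_hasMulInverse.Build (mpowser n R)
  mps_mulV mps_unitPl mps_inv_out.
End PowerSeriesRing.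

Section PowerSeriesDomain.
Variables (n : nat) (R : idomainType).
Implicit Types f g h : mpowser n R.

Lemma mps_lead f : f != 0 ->
  exists2 m, f m != 0 & forall k, (k < m)%O -> f k = 0.
Proof.
move=> fn0; apply: contrapT => H; case/eqP: fn0.
apply/funext; apply: ltmwf => m IH; apply/eqP/negPn/negP => fm.
by apply: H; exists m.
Qed.

Fact mps_integral : GRing.integral_domain_axiom (mpowser n R).
Proof.
move=> f g fg0; apply: contrapT => /negP; rewrite negb_or => /andP[].
move=> /mps_lead[a fa fl] /mps_lead[b gb gl].
have lta : (mdeg a < (mdeg (a + b)%MM).+1)%N by rewrite mdegD ltnS leq_addr.
have ltb : (mdeg b < (mdeg (a + b)%MM).+1)%N by rewrite mdegD ltnS leq_addl.
move/(congr1 (@^~ (a + b)%MM)): fg0; rewrite mps0E mpsME.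
rewrite (bigD1 (BMultinom lta, BMultinom ltb)) //=.
rewrite big1 => [/eqP|[k1 k2] /= /andP[/eqP ek nk]].
  by rewrite addr0 mulf_eq0 (negPf fa) (negPf gb).
have [lt1|lt1|e1] := ltgtP (bmnm k1) a; first by rewrite fl ?mul0r.
  have [lt2|lt2|e2] := ltgtP (bmnm k2) b; first by rewrite gl ?mulr0.
    by have := ltm_add lt1 lt2; rewrite -ek ltxx.
  have := lt1; rewrite -(ltmc_add2l _ _ b) => lt2. move: (bmnm k1) (bmnm k2) ek e2 lt2 => u v -> ->; by rewrite ltxx.
have e2 : bmnm k2 = b by move: ek; rewrite e1 => /addmI.
by case/eqP: nk; congr pair; apply: val_inj.
Qed.
HB.instance Definition _ :=
  GRing.ComUnitRing_isIntegral.Build (mpowser n R) mps_integral.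
End PowerSeriesDomain.

Definition map_mps (n : nat) (R S : nzRingType) (phi : R -> S) (f : mpowser n R) :
  mpowser n S := fun m => phi (f m).

Section MapPowerSeries.
Variables (n : nat) (R S : comNzRingType) (phi : {rmorphism R -> S}).
Fact map_mps_is_zmod_morphism : zmod_morphism (@map_mps n _ _ phi).
Proof. by move=> f g; apply/funext => m; exact: rmorphB. Qed.
Fact map_mps_is_monoid_morphism : monoid_morphism (@map_mps n _ _ phi).
Proof.
split=> [|f g]; apply/funext => m; first by rewrite /map_mps !mps1E rmorph_nat.
rewrite /map_mps !mpsME rmorph_sum; apply: eq_bigr => k _; exact: rmorphM.
Qed.
HB.instance Definition _ := GRing.isZmodMorphism.Build (mpowser n R) (mpowser n S)
  (@map_mps n _ _ phi) map_mps_is_zmod_morphism.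
HB.instance Definition _ := GRing.isMonoidMorphism.Build (mpowser n R) (mpowser n S)
  (@map_mps n _ _ phi) map_mps_is_monoid_morphism.
End MapPowerSeries.

Local Notation "x %:F" := (@FracField.tofrac _ x).

(* The extension of g to fraction fields; meaningful for injective morphisms,
   where it does not depend on the chosen fraction (see frac_mapE). *)
Definition frac_map (R S : idomainType) (g : R -> S) (x : {fraction R}) :
  {fraction S} := (g \n_(repr x))%:F / (g \d_(repr x))%:F.

Lemma frac_numden (R : idomainType) (x : {fraction R}) :
  x = (\n_(repr x))%:F / (\d_(repr x))%:F.
Proof.
have d0 : (\d_(repr x))%:F != 0 by rewrite tofrac_eq0 denom_ratioP.
apply: (mulIf d0); rewrite divfK //.
rewrite -{1}[x]reprK; unlock FracField.tofrac.
rewrite -[LHS]FracField.pi_mul /FracField.mulf.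
apply/eqmodP => /=; rewrite FracField.equivfE.
rewrite !numden_Ratio ?mulf_neq0 ?oner_eq0 ?denom_ratioP //.
by rewrite !mulr1 mulrC.
Qed.

Section FracMap.
Variables (R S : idomainType) (g : {rmorphism R -> S}).
Hypothesis ginj : injective g.

Let g0 a : a != 0 -> (g a)%:F != 0.
Proof. by move=> a0; rewrite tofrac_eq0 raddf_eq0. Qed.

Lemma frac_mapE a b : b != 0 -> frac_map g (a%:F / b%:F) = (g a)%:F / (g b)%:F.
Proof.
move=> b0; rewrite /frac_map; set x := a%:F / b%:F.
have b0F : b%:F != 0 by rewrite tofrac_eq0.
have d0 := denom_ratioP (repr x); have d0F : (\d_(repr x))%:F != 0 by rewrite tofrac_eq0.
have: x = a%:F / b%:F by [].
rewrite {1}(frac_numden x) => /eqP; rewrite eqr_div // -!tofracM tofrac_eq => /eqP e.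
by apply/eqP; rewrite eqr_div ?g0 // -!tofracM -!rmorphM e.
Qed.

Fact frac_map_is_zmod_morphism : zmod_morphism (frac_map g).
Proof.
move=> x y; rewrite [in LHS](frac_numden x) [in LHS](frac_numden y).
have dx := denom_ratioP (repr x); have dy := denom_ratioP (repr y).
rewrite -mulNr addf_div ?tofrac_eq0 // -tofracN -!tofracM -tofracD.
rewrite frac_mapE ?mulf_neq0 // /frac_map -mulNr addf_div ?g0 //.
by rewrite rmorphD !rmorphM !rmorphN tofracD !tofracM tofracN.
Qed.
Fact frac_map_is_monoid_morphism : monoid_morphism (frac_map g).
Proof.
split=> [|x y].
  have -> : 1 = 1%:F / 1%:F :> {fraction R} by rewrite tofrac1 divr1.
  by rewrite frac_mapE ?oner_eq0 // !rmorph1 divr1.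
rewrite [in LHS](frac_numden x) [in LHS](frac_numden y).
have dx := denom_ratioP (repr x); have dy := denom_ratioP (repr y).
by rewrite mulf_div -!tofracM frac_mapE ?mulf_neq0 // /frac_map mulf_div !rmorphM.
Qed.
End FracMap.

Lemma frac_map_comp (R S T : idomainType) (g : {rmorphism R -> S})
    (h : {rmorphism S -> T}) (k : R -> T) : injective g -> injective h ->
  h \o g =1 k -> frac_map h \o frac_map g =1 frac_map k.
Proof.
move=> gi hi e x /=; rewrite [frac_map g x]/frac_map frac_mapE //.
  by rewrite /frac_map -!e.
by rewrite raddf_eq0 // denom_ratioP.
Qed.

Lemma frac_map_id (R : idomainType) (g : R -> R) : g =1 id -> frac_map g =1 id.
Proof. by move=> e x; rewrite /frac_map !e -frac_numden. Qed.

(* F{{Z}}: either F(Z), or F((Z)) read as the fraction field of F[[Z]], which for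
   one variable is the usual field of Laurent series. coefF_map applies a field
   morphism to the coefficients and fixes the variables. *)
Inductive coef_field := RationalFunctions | LaurentSeries.

Definition coefF (kind : coef_field) (n : nat) (F : fieldType) : fieldType :=
  match kind with
  | RationalFunctions => {fraction {mpoly F[n]}}
  | LaurentSeries => {fraction (mpowser n F)}
  end.

Definition coefF_const (kind : coef_field) (n : nat) (F : fieldType) (c : F) :
    coefF kind n F :=
  match kind return coefF kind n F with
  | RationalFunctions => (c%:MP_[n])%:F
  | LaurentSeries => (@mps_const n F c)%:F
  end.

Definition coefF_map (kind : coef_field) (n : nat) (F F' : fieldType)
    (phi : F -> F') : coefF kind n F -> coefF kind n F' :=
  match kind return coefF kind n F -> coefF kind n F' with
  | RationalFunctions => frac_map (@map_mpoly n F F' phi)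
  | LaurentSeries => frac_map (@map_mps n F F' phi)
  end.

Section CoefField.
Variables (kind : coef_field) (n : nat).
Local Notation coefF := (coefF kind n).
Local Notation coefF_const := (@coefF_const kind n).
Local Notation coefF_map := (@coefF_map kind n _ _).

Section CoefFMap.
Variables (F F' : fieldType) (phi : {rmorphism F -> F'}).

Let map_mpoly_inj : injective (@map_mpoly n F F' phi).
Proof.
move=> p q e; apply/mpolyP => m; apply: (fmorph_inj phi).
by rewrite -!mcoeff_map_mpoly e.
Qed.

Let map_mps_inj : injective (@map_mps n F F' phi).
Proof.
move=> p q e; apply/funext => m; apply: (fmorph_inj phi).
exact: (congr1 (fun h : mpowser n F' => h m) e).
Qed.

Fact coefF_map_is_zmod_morphism : zmod_morphism (coefF_map phi).
Proof.
case: kind.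
  exact: frac_map_is_zmod_morphism map_mpoly_inj.
exact: frac_map_is_zmod_morphism map_mps_inj.
Qed.
Fact coefF_map_is_monoid_morphism : monoid_morphism (coefF_map phi).
Proof.
case: kind.
  exact: frac_map_is_monoid_morphism map_mpoly_inj.
exact: frac_map_is_monoid_morphism map_mps_inj.
Qed.
HB.instance Definition _ := GRing.isZmodMorphism.Build (coefF F) (coefF F')
  (coefF_map phi) coefF_map_is_zmod_morphism.
HB.instance Definition _ := GRing.isMonoidMorphism.Build (coefF F) (coefF F')
  (coefF_map phi) coefF_map_is_monoid_morphism.

Fact coefF_const_is_zmod_morphism : zmod_morphism (@coefF_const F).
Proof.
case: kind => a b; rewrite /= -tofracB; congr _%:F.
  by rewrite rmorphB.
by apply/funext => m; rewrite mpsDE mpsNE /mps_const; case: (_ == _); rewrite ?subr0.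
Qed.
Fact coefF_const_is_monoid_morphism : monoid_morphism (@coefF_const F).
Proof.
case: kind; split=> [|a b].
- exact: tofrac1.
- by rewrite /= !rmorphM.
- exact: tofrac1.
rewrite /= -tofracM; congr _%:F; apply/funext => m.
rewrite /mps_const mpsME; have [->|m0] := eqVneq.
  have lt0 : (mdeg (0 : 'X_{1..n})%MM < (mdeg (0 : 'X_{1..n})%MM).+1)%N by [].
  rewrite (bigD1 (BMultinom lt0, BMultinom lt0)) /= ?addm0 //.
  rewrite !eqxx big1 ?addr0 // => -[k1 k2] /= /andP[/eqP /esym/eqP].
  rewrite mnmD_eq0 => /andP[/eqP e1 /eqP e2] /eqP[].
  by congr pair; apply: val_inj.
rewrite big1 // => -[k1 k2] /= /eqP e; have [e1|_] := eqVneq (bmnm k1); last by rewrite mul0r.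
have [e2|_] := eqVneq (bmnm k2); last by rewrite mulr0.
by move: m0; rewrite e e1 e2 addm0 eqxx.
Qed.
HB.instance Definition _ := GRing.isZmodMorphism.Build F (coefF F)
  (@coefF_const F) coefF_const_is_zmod_morphism.
HB.instance Definition _ := GRing.isMonoidMorphism.Build F (coefF F)
  (@coefF_const F) coefF_const_is_monoid_morphism.
End CoefFMap.

Lemma coefF_map_comp (F F' F'' : fieldType) (phi : {rmorphism F -> F'})
    (psi : {rmorphism F' -> F''}) (chi : {rmorphism F -> F''}) :
  psi \o phi =1 chi -> forall x, coefF_map psi (coefF_map phi x) = coefF_map chi x.
Proof.
move=> e; case: kind => x.
  apply: frac_map_comp => [p q|p q|p].
  - by move=> E; apply/mpolyP => m; apply: (fmorph_inj phi); rewrite -!mcoeff_map_mpoly E.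
  - by move=> E; apply/mpolyP => m; apply: (fmorph_inj psi); rewrite -!mcoeff_map_mpoly E.
  by apply/mpolyP => m; rewrite /= !mcoeff_map_mpoly; apply: e.
apply: frac_map_comp => [p q E|p q E|p]; apply/funext => m.
- exact: (fmorph_inj phi (congr1 (fun h : mpowser n F' => h m) E)).
- exact: (fmorph_inj psi (congr1 (fun h : mpowser n F'' => h m) E)).
exact: e.
Qed.

Lemma coefF_map_id (F : fieldType) (phi : {rmorphism F -> F}) :
  phi =1 id -> forall x, coefF_map phi x = x.
Proof.
move=> e; case: kind => x; apply: frac_map_id => p.
  by apply/mpolyP => m; rewrite mcoeff_map_mpoly; apply: e.
by apply/funext => m; apply: e.
Qed.

Lemma coefF_map_ext (F F' : fieldType) (phi psi : {rmorphism F -> F'}) :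
  phi =1 psi -> coefF_map phi =1 coefF_map psi.
Proof.
move=> e x; have <- := coefF_map_comp (phi := phi) (psi := idfun) (chi := psi) e x.
by rewrite coefF_map_id.
Qed.
End CoefField.

(* Twisted polynomials sum_i b_i s^i with coefficients on the left, stored as
   the coefficient sequence of sum_i b_i 'X^i. *)
Definition tpoly (K : fieldType) (s : {rmorphism K -> K}) := {poly K}.
HB.instance Definition _ (K : fieldType) (s : {rmorphism K -> K}) :=
  GRing.Zmodule.on (tpoly s).

Section SemilinearAction.
Variables (K : fieldType) (s : {rmorphism K -> K}) (V : lmodType K).
Implicit Types (p q : {poly K}) (v : V).

Definition sact (T : V -> V) p v : V := \sum_(i < size p) p`_i *: iter i T v.

Lemma sact_wide T N p v : (size p <= N)%N ->
  sact T p v = \sum_(i < N) p`_i *: iter i T v.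
Proof.
move=> le; rewrite /sact (big_ord_widen N (fun i => p`_i *: iter i T v)) //.
rewrite big_mkcond; apply: eq_bigr => i _; case: ltnP => // /leq_sizeP -> //.
by rewrite scale0r.
Qed.

Lemma sactDl T p q v : sact T (p + q) v = sact T p v + sact T q v.
Proof.
have le1 := leq_maxl (size p) (size q); have le2 := leq_maxr (size p) (size q).
rewrite (sact_wide _ _ (size_polyD p q)) (sact_wide _ _ le1) (sact_wide _ _ le2).
by rewrite -big_split; apply: eq_bigr => i _; rewrite coefD scalerDl.
Qed.

Lemma sact0l T v : sact T 0 v = 0.
Proof. by rewrite /sact size_poly0 big_ord0. Qed.

Lemma sactZl T c p v : sact T (c *: p) v = c *: sact T p v.
Proof.
rewrite (sact_wide _ _ (size_scale_leq c p)) scaler_sumr.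
by apply: eq_bigr => i _; rewrite coefZ scalerA.
Qed.

Lemma sact_suml T I (r : seq I) (F : I -> {poly K}) v :
  sact T (\sum_(i <- r) F i) v = \sum_(i <- r) sact T (F i) v.
Proof.
by elim/big_rec2: _ => [|i y1 y2 _ <-]; rewrite ?sact0l // sactDl.
Qed.

Lemma sactCl T c v : sact T c%:P v = c *: v.
Proof. by rewrite (sact_wide _ _ (size_polyC_leq1 c)) big_ord1 coefC. Qed.

Variable T : V -> V.
Hypotheses (TD : {morph T : u v / u + v}) (TZ : forall c v, T (c *: v) = s c *: T v).

Let T0 : T 0 = 0. Proof. by apply: (addrI (T 0)); rewrite -TD !addr0. Qed.
Let iterTD i : {morph iter i T : u v / u + v}.
Proof. by elim: i => [|i IH] u v //=; rewrite IH TD. Qed.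

Lemma sactDr p : {morph sact T p : u v / u + v}.
Proof.
move=> u v; rewrite /sact -big_split; apply: eq_bigr => i _.
by rewrite iterTD scalerDr.
Qed.

(* Left multiplication by s, by the rule s c = s(c) s. *)
Definition tshift q : {poly K} := map_poly s q * 'X.

Lemma sact_tshift q v : sact T (tshift q) v = T (sact T q v).
Proof.
have TS I (r : seq I) F : T (\sum_(i <- r) F i) = \sum_(i <- r) T (F i).
  by apply: big_morph.
rewrite (sact_wide _ _ (size_polyMleq _ _)) size_polyX addn2 /= size_map_poly.
rewrite big_ord_recl coefMX eqxx scale0r add0r /sact TS.
by apply: eq_bigr => i _; rewrite coefMX /= coef_map TZ.
Qed.

Lemma sact_comp p q v :
  sact T (\sum_(i < size p) p`_i *: iter i tshift q) v = sact T p (sact T q v).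
Proof.
rewrite sact_suml; apply: eq_bigr => i _; rewrite sactZl; congr (_ *: _).
by elim: (i : nat) => //= j <-; rewrite sact_tshift.
Qed.
End SemilinearAction.

Section TwistedPoly.
Variables (K : fieldType) (s : {rmorphism K -> K}).
Implicit Types p q r : tpoly s.

Definition tpoly_mul p q : tpoly s := sact (tshift s) p (q : {poly K}).

Lemma tshiftD : {morph tshift s : p q / p + q}.
Proof. by move=> p q; rewrite /tshift rmorphD mulrDl. Qed.
Lemma tshiftZ c (q : {poly K}) : tshift s (c *: q) = s c *: tshift s q.
Proof. by rewrite /tshift map_polyZ scalerAl. Qed.
Lemma tshift_iter1 i : iter i (tshift s) 1 = 'X^i.
Proof. by elim: i => //= i ->; rewrite /tshift map_polyXn exprSr. Qed.

Fact tpoly_mulA : associative tpoly_mul.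
Proof. by move=> p q r; rewrite [RHS](sact_comp tshiftD tshiftZ). Qed.
Fact tpoly_mul1l : left_id (1%:P : tpoly s) tpoly_mul.
Proof. by move=> p; rewrite [LHS]sactCl scale1r. Qed.
Fact tpoly_mul1r : right_id (1%:P : tpoly s) tpoly_mul.
Proof.
move=> p; rewrite -[RHS]coefK poly_def.
by apply: eq_bigr => i _; rewrite tshift_iter1.
Qed.
Fact tpoly_mulDl : left_distributive tpoly_mul +%R.
Proof. by move=> p q r; exact: sactDl. Qed.
Fact tpoly_mulDr : right_distributive tpoly_mul +%R.
Proof. by move=> p q r; exact: (sactDr tshiftD). Qed.
Fact tpoly_oner_neq0 : (1%:P : tpoly s) != 0.
Proof. exact: oner_neq0. Qed.

HB.instance Definition _ := GRing.Zmodule_isNzRing.Build (tpoly s)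
  tpoly_mulA tpoly_mul1l tpoly_mul1r tpoly_mulDl tpoly_mulDr tpoly_oner_neq0.

Definition tpolyC (c : K) : tpoly s := c%:P.
Definition tpolyX : tpoly s := 'X.
Definition tcoef (p : tpoly s) i : K := (p : {poly K})`_i.

Fact tpolyC_is_zmod_morphism : zmod_morphism tpolyC.
Proof. by move=> a b; rewrite /tpolyC rmorphB. Qed.
Fact tpolyC_is_monoid_morphism : monoid_morphism tpolyC.
Proof. by split=> // a b; rewrite [RHS]sactCl /tpolyC -mul_polyC rmorphM. Qed.
HB.instance Definition _ := GRing.isZmodMorphism.Build K (tpoly s) tpolyC
  tpolyC_is_zmod_morphism.
HB.instance Definition _ := GRing.isMonoidMorphism.Build K (tpoly s) tpolyC
  tpolyC_is_monoid_morphism.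

Lemma mul_tpolyC c p : tpolyC c * p = (c *: (p : {poly K})).
Proof. exact: sactCl. Qed.
Lemma mul_tpolyX p : tpolyX * p = tshift s p.
Proof.
transitivity (sact (tshift s) 'X (p : {poly K})); first by [].
by rewrite /sact size_polyX !big_ord_recl big_ord0 !coefX scale0r scale1r add0r addr0.
Qed.
Lemma tpolyX_exp i : tpolyX ^+ i = 'X^i :> {poly K}.
Proof. by elim: i => // i IH; rewrite exprS mul_tpolyX IH /tshift map_polyXn exprSr. Qed.
Lemma mul_tpolyXC c : tpolyX * tpolyC c = tpolyC (s c) * tpolyX.
Proof. by rewrite mul_tpolyX mul_tpolyC /tshift map_polyC mul_polyC. Qed.
Lemma tpoly_def p : p = \sum_(i < size (p : {poly K})) tpolyC (tcoef p i) * tpolyX ^+ i.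
Proof.
rewrite -{1}[p]coefK poly_def; apply: eq_bigr => i _.
by rewrite mul_tpolyC tpolyX_exp.
Qed.

Definition teval (p : tpoly s) (x : K) : K :=
  \sum_(i < size (p : {poly K})) tcoef p i * iter i s x.

Let tevalE p x : teval p x = sact (V := K^o) s p x. Proof. by []. Qed.
Let sD : {morph (s : K^o -> K^o) : u v / u + v}. Proof. exact: rmorphD. Qed.
Let sZ c (v : K^o) : s (c *: v) = s c *: (s v : K^o). Proof. exact: rmorphM. Qed.

Lemma tevalDl p q x : teval (p + q) x = teval p x + teval q x.
Proof. exact: (sactDl (V := K^o)). Qed.
Lemma tevalDr p x y : teval p (x + y) = teval p x + teval p y.
Proof. exact: (sactDr (V := K^o) sD). Qed.
Lemma tevalM p q x : teval (p * q) x = teval p (teval q x).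
Proof. exact: (sact_comp (V := K^o) sD sZ). Qed.
Lemma teval1 x : teval 1 x = x.
Proof. by rewrite [LHS](sactCl (V := K^o)) scale1r. Qed.
Lemma teval0l x : teval 0 x = 0.
Proof. exact: (sact0l (V := K^o)). Qed.
Lemma teval0r p : teval p 0 = 0.
Proof. by apply: (addrI (teval p 0)); rewrite -tevalDr !addr0. Qed.
Lemma teval_suml I (r : seq I) (F : I -> tpoly s) x :
  teval (\sum_(i <- r) F i) x = \sum_(i <- r) teval (F i) x.
Proof. exact: (sact_suml (V := K^o)). Qed.
Lemma teval_sumr I (r : seq I) (F : I -> K) p :
  teval p (\sum_(i <- r) F i) = \sum_(i <- r) teval p (F i).
Proof. apply: big_morph; [exact: tevalDr | exact: teval0r]. Qed.
Lemma teval_map (rho : {rmorphism K -> K}) p x :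
    (forall y, rho (s y) = s (rho y)) -> (forall i, rho (tcoef p i) = tcoef p i) ->
  rho (teval p x) = teval p (rho x).
Proof.
move=> rs rp; rewrite /teval rmorph_sum; apply: eq_bigr => i _.
rewrite rmorphM rp; congr (_ * _).
by elim: (i : nat) => //= j <-.
Qed.

Definition tact m n (B : 'M[tpoly s]_(m, n)) (x : 'cV[K]_n) : 'cV[K]_m :=
  \col_i \sum_j teval (B i j) (x j 0).

Lemma tactDl m n (B C : 'M_(m, n)) x : tact (B + C) x = tact B x + tact C x.
Proof.
apply/colP => i; rewrite !mxE -big_split; apply: eq_bigr => j _.
by rewrite mxE tevalDl.
Qed.
Lemma tactDr m n (B : 'M_(m, n)) x y : tact B (x + y) = tact B x + tact B y.
Proof.
apply/colP => i; rewrite !mxE -big_split; apply: eq_bigr => j _.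
by rewrite mxE tevalDr.
Qed.
Lemma tactM m n k (B : 'M_(m, n)) (C : 'M_(n, k)) x :
  tact (B *m C) x = tact B (tact C x).
Proof.
apply/colP => i; rewrite !mxE.
under eq_bigr do rewrite mxE teval_suml.
rewrite exchange_big; apply: eq_bigr => j _; rewrite mxE teval_sumr.
by apply: eq_bigr => l _; rewrite tevalM.
Qed.
Lemma tact1 n (x : 'cV_n) : tact 1%:M x = x.
Proof.
apply/colP => i; rewrite mxE (bigD1 i) //= mxE eqxx teval1 big1 ?addr0 // => j ji.
by rewrite mxE eq_sym (negPf ji) teval0l.
Qed.
Lemma tact_map (rho : {rmorphism K -> K}) m n (B : 'M_(m, n)) x :
    (forall y, rho (s y) = s (rho y)) ->
    (forall i j k, rho (tcoef (B i j) k) = tcoef (B i j) k) ->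
  map_mx rho (tact B x) = tact B (map_mx rho x).
Proof.
move=> rs rB; apply/colP => i; rewrite !mxE rmorph_sum; apply: eq_bigr => j _.
by rewrite mxE teval_map.
Qed.
End TwistedPoly.

Section TwistedPolyMap.
Variables (K L : fieldType) (s : {rmorphism K -> K}) (u : {rmorphism L -> L}).
Variable phi : {rmorphism K -> L}.
Hypothesis phi_s : forall x, phi (s x) = u (phi x).

Definition tmap of (forall x, phi (s x) = u (phi x)) :=
  fun p : tpoly s => (map_poly phi p : tpoly u).

Let map_tshift q : map_poly phi (tshift s q) = tshift u (map_poly phi q).
Proof.
rewrite /tshift rmorphM /= map_polyX; congr (_ * _).
by apply/polyP => i; rewrite !coef_map /= phi_s.
Qed.

Fact tmap_is_zmod_morphism : zmod_morphism (tmap phi_s).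
Proof. move=> p q; exact: (rmorphB (map_poly phi)). Qed.
Fact tmap_is_monoid_morphism : monoid_morphism (tmap phi_s).
Proof.
split=> [|p q]; first exact: (rmorph1 (map_poly phi)).
transitivity (map_poly phi (sact (tshift s) p (q : {poly K}))); first by [].
transitivity (sact (tshift u) (map_poly phi p) (map_poly phi q)); last by [].
rewrite /sact rmorph_sum size_map_poly; apply: eq_bigr => i _.
rewrite /= map_polyZ coef_map; congr (_ *: _).
by elim: (i : nat) => //= j <-; rewrite map_tshift.
Qed.
HB.instance Definition _ := GRing.isZmodMorphism.Build (tpoly s) (tpoly u)
  (tmap phi_s) tmap_is_zmod_morphism.
HB.instance Definition _ := GRing.isMonoidMorphism.Build (tpoly s) (tpoly u)
  (tmap phi_s) tmap_is_monoid_morphism.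
End TwistedPolyMap.

Section TwistedAdjoint.
Variables (K : fieldType) (s u : {rmorphism K -> K}).

(* The anti-isomorphism sum_i b_i s^i |-> sum_i u^i(b_i) u^i, where u = s^-1. *)
Definition tstar (p : tpoly s) : tpoly u :=
  \poly_(i < size (p : {poly K})) iter i u (tcoef p i).

Definition mx_tstar m n (B : 'M[tpoly s]_(m, n)) : 'M[tpoly u]_(n, m) :=
  \matrix_(i, j) tstar (B j i).

Hypothesis su : cancel s u.

Local Notation Xs := (tpolyX s). Local Notation Xu := (tpolyX u).
Local Notation Cs := (tpolyC s). Local Notation Cu := (tpolyC u).

Lemma tcoef_star p i : tcoef (tstar p) i = iter i u (tcoef p i).
Proof.
rewrite [LHS]coef_poly; case: ltnP => // le.
rewrite /tcoef nth_default //; elim: (i) => //= j <-; by rewrite rmorph0.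
Qed.

Lemma iter_rmorphD i x y : iter i u (x + y) = iter i u x + iter i u y.
Proof. by elim: i => //= i ->; rewrite rmorphD. Qed.
Lemma iter_rmorphM i x y : iter i u (x * y) = iter i u x * iter i u y.
Proof. by elim: i => //= i ->; rewrite rmorphM. Qed.

Lemma tstarD p q : tstar (p + q) = tstar p + tstar q.
Proof.
apply/polyP => i; rewrite [RHS]coefD -![_`_i]/(tcoef _ i) !tcoef_star.
by rewrite -iter_rmorphD; congr iter; apply: coefD.
Qed.
Lemma tstar0 : tstar 0 = 0.
Proof. by apply: (addrI (tstar 0)); rewrite -tstarD !addr0. Qed.
Lemma tstarN p : tstar (- p) = - tstar p.
Proof. by apply: (addrI (tstar p)); rewrite -tstarD !subrr tstar0. Qed.
Lemma tstar_sum I (r : seq I) (F : I -> tpoly s) :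
  tstar (\sum_(i <- r) F i) = \sum_(i <- r) tstar (F i).
Proof. by apply: big_morph; [exact: tstarD | exact: tstar0]. Qed.

Lemma tpolyX_expC i c : Xu ^+ i * Cu c = Cu (iter i u c) * Xu ^+ i.
Proof.
elim: i => [|i IH]; first by rewrite expr0 mul1r mulr1.
by rewrite exprS -mulrA IH mulrA mul_tpolyXC -mulrA.
Qed.
Lemma tcoefCX (v : {rmorphism K -> K}) c i k :
  tcoef (tpolyC v c * tpolyX v ^+ i) k = if k == i then c else 0.
Proof.
rewrite mul_tpolyC tpolyX_exp /tcoef coefZ coefXn.
by case: (k == i); rewrite ?mulr1 ?mulr0.
Qed.
Lemma tstarCX c i : tstar (Cs c * Xs ^+ i) = Xu ^+ i * Cu c.
Proof.
rewrite tpolyX_expC; apply/polyP => k; rewrite -![_`_k]/(tcoef _ k).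
rewrite tcoef_star !tcoefCX; case: eqP => [->//|_].
by elim: k => //= k ->; rewrite rmorph0.
Qed.
Lemma tstar_def p : tstar p = \sum_(i < size (p : {poly K})) Xu ^+ i * Cu (tcoef p i).
Proof. by rewrite [in LHS](tpoly_def p) tstar_sum; apply: eq_bigr => i _; rewrite tstarCX. Qed.

Lemma tstar_mulC c p : tstar (Cs c * p) = tstar p * Cu c.
Proof.
rewrite {1}(tpoly_def p) mulr_sumr tstar_sum (tstar_def p) mulr_suml.
by apply: eq_bigr => i _; rewrite mulrA -rmorphM tstarCX mulrC rmorphM mulrA.
Qed.
Lemma tstar_mulX p : tstar (Xs * p) = tstar p * Xu.
Proof.
rewrite {1}(tpoly_def p) mulr_sumr tstar_sum (tstar_def p) mulr_suml.
apply: eq_bigr => i _; rewrite mulrA mul_tpolyXC -mulrA -exprS tstarCX exprSr.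
by rewrite -!mulrA mul_tpolyXC su.
Qed.
Lemma tstarM p q : tstar (p * q) = tstar q * tstar p.
Proof.
rewrite {1}(tpoly_def p) mulr_suml tstar_sum (tstar_def p) mulr_sumr.
apply: eq_bigr => i _; rewrite -mulrA tstar_mulC mulrA; congr (_ * _).
elim: (i : nat) => [|j IH]; first by rewrite !expr0 mul1r mulr1.
by rewrite exprS -mulrA tstar_mulX IH -mulrA -exprSr.
Qed.
Lemma tstar1 : tstar 1 = 1.
Proof. by have := tstarCX 1 0; rewrite !expr0 !rmorph1 !mulr1. Qed.

Lemma mx_tstarM m n k (B : 'M_(m, n)) (C : 'M_(n, k)) :
  mx_tstar (B *m C) = mx_tstar C *m mx_tstar B.
Proof.
apply/matrixP => i j; rewrite !mxE tstar_sum; apply: eq_bigr => l _.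
by rewrite tstarM !mxE.
Qed.
Lemma mx_tstar1 n : mx_tstar (1%:M : 'M_n) = 1%:M.
Proof.
apply/matrixP => i j; rewrite !mxE eq_sym; case: (i == j); first exact: tstar1.
exact: tstar0.
Qed.
Lemma mx_tstarB m n (B C : 'M_(m, n)) : mx_tstar (B - C) = mx_tstar B - mx_tstar C.
Proof. by apply/matrixP => i j; rewrite !mxE tstarD tstarN. Qed.
End TwistedAdjoint.

Definition is_basis (R : nzRingType) (M : lmodType R) n (e : 'I_n -> M) : Prop :=
  forall x, exists! c : 'rV[R]_n, x = \sum_i c 0 i *: e i.

Definition free_of_rank (R : nzRingType) (M : lmodType R) (r : nat) : Prop :=
  exists e : 'I_r -> M, is_basis e.

(* phi is taken on a free module of some finite rank. *)
Definition is_char_poly (R : comNzRingType) (M : lmodType R)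
    (phi : {linear M -> M}) (P : {poly R}) : Prop :=
  exists n (e : 'I_n -> M) (A : 'M[R]_n),
    [/\ is_basis e, forall j, phi (e j) = \sum_i A i j *: e i & P = char_poly A].

(* The value 0 is taken only when M has no finite basis. *)
Definition Char (R : comNzRingType) (M : lmodType R) (phi : {linear M -> M}) :
  {poly R} := xget 0 [set P | is_char_poly phi P].

(* M is isomorphic to the sum of the K[t]/(h_i), with P the product of the h_i.
   {poly %/ h} is the quotient by (h) only if h is monic and nonconstant; a factor
   h_i = 1 would contribute a zero summand, so excluding it loses nothing. *)
Definition is_order (K : fieldType) (M : lmodType {poly K}) (P : {poly K}) : Prop :=
  exists n (h : 'I_n -> {poly K}) (phi : (forall i, {poly %/ h i}) -> M),
    [/\ forall i, (h i \is monic) && (1 < size (h i))%N,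
        bijective phi,
        forall u v, phi (fun i => u i + v i) = phi u + phi v,
        forall a u, phi (fun i => in_qpoly (h i) a * u i) = a *: phi u
      & P = \prod_i h i].

Definition module_order (K : fieldType) (M : lmodType {poly K}) : {poly K} :=
  xget 0 [set P | is_order M P].

Definition has_dim_over (k K : fieldType) (iota : k -> K) (l : nat)
    (W : set 'cV[K]_l) (N : nat) : Prop :=
  exists e : 'I_N -> 'cV[K]_l, (forall i, W (e i)) /\
    forall x, W x -> exists! c : 'rV[k]_N, x = \sum_i iota (c 0 i) *: e i.

Definition mx_invertible (R : nzRingType) n (U : 'M[R]_n) : Prop :=
  exists V, U *m V = 1%:M /\ V *m U = 1%:M.

(* W has the k-dimension sum_i deg d_i read off a diagonal form of eta. W is the
   kernel of eta or that of its adjoint; the d_i always come from eta. *)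
Definition full_dimension (k K : fieldType) (iota : k -> K)
    (s : {rmorphism K -> K}) (l : nat) (eta : 'M[tpoly s]_l) (W : set 'cV[K]_l) :=
  exists U V (d : 'rV[tpoly s]_l),
    [/\ mx_invertible U, mx_invertible V, U *m eta *m V = diag_mx d,
        forall i, d 0 i != 0
      & has_dim_over iota W (\sum_i (size (d 0%R i : {poly K})).-1)].

(* K^l with a acting through the matrix E_a of twisted polynomials. *)
Section ModulePoints.
Variables (K : fieldType) (s : {rmorphism K -> K}) (R : nzRingType) (l : nat).
Variable E : {rmorphism R -> 'M[tpoly s]_l}.

Definition points of {rmorphism R -> 'M[tpoly s]_l} := 'cV[K]_l.
HB.instance Definition _ := GRing.Zmodule.on (points E).

Definition points_scale a (x : points E) : points E := tact (E a) x.

Fact points_scaleA a b x : points_scale a (points_scale b x) = points_scale (a * b) x.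
Proof. by rewrite /points_scale rmorphM tactM. Qed.
Fact points_scale1 : left_id 1 points_scale.
Proof. by move=> x; rewrite /points_scale rmorph1 tact1. Qed.
Fact points_scaleDr : right_distributive points_scale +%R.
Proof. by move=> a x y; exact: tactDr. Qed.
Fact points_scaleDl x : {morph points_scale^~ x : a b / a + b}.
Proof. by move=> a b; rewrite /points_scale rmorphD tactDl. Qed.
HB.instance Definition _ := GRing.Zmodule_isLmodule.Build R (points E)
  points_scaleA points_scale1 points_scaleDr points_scaleDl.
End ModulePoints.

(* Row vectors with K acting by left multiplication and t by right
   multiplication by E_t, so that a in k[t] acts by m |-> m E_a (motive_scaleE). *)
Section Motive.
Variables (k K : fieldType) (s : {rmorphism K -> K}) (l : nat).
Variable E : {rmorphism {poly k} -> 'M[tpoly s]_l}.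

Definition motive of {rmorphism {poly k} -> 'M[tpoly s]_l} := 'rV[tpoly s]_l.
HB.instance Definition _ := GRing.Zmodule.on (motive E).

Definition motive_scale (p : {poly K}) (m : motive E) : motive E :=
  \sum_(i < size p) tpolyC s p`_i *: (m *m E 'X^i).

Lemma motive_scale_wide N (p : {poly K}) m : (size p <= N)%N ->
  motive_scale p m = \sum_(i < N) tpolyC s p`_i *: (m *m E 'X^i).
Proof.
move=> le; rewrite /motive_scale.
rewrite (big_ord_widen N (fun i => tpolyC s p`_i *: (m *m E 'X^i))) //.
rewrite big_mkcond; apply: eq_bigr => i _; case: ltnP => // /leq_sizeP -> //.
by rewrite rmorph0 scale0r.
Qed.

Fact motive_scaleDl m : {morph motive_scale^~ m : p q / p + q}.
Proof.
move=> p q; have le1 := leq_maxl (size p) (size q).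
have le2 := leq_maxr (size p) (size q).
rewrite (motive_scale_wide _ (size_polyD p q)) (motive_scale_wide _ le1).
rewrite (motive_scale_wide _ le2) -big_split; apply: eq_bigr => i _.
by rewrite coefD rmorphD scalerDl.
Qed.
Fact motive_scaleDr : right_distributive motive_scale +%R.
Proof.
move=> p m m'; rewrite /motive_scale -big_split; apply: eq_bigr => i _.
by rewrite mulmxDl scalerDr.
Qed.
Lemma motive_scaleC c m : motive_scale c%:P m = tpolyC s c *: (m : 'rV_l).
Proof.
rewrite (motive_scale_wide _ (size_polyC_leq1 c)) big_ord1 coefC expr0.
by rewrite rmorph1 mulmx1.
Qed.
Lemma motive_scaleMX (p : {poly K}) m : motive_scale (p * 'X) m = motive_scale p (m *m E 'X).
Proof.
rewrite (motive_scale_wide _ (size_polyMleq _ _)) size_polyX addn2 /=.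
rewrite big_ord_recl coefMX eqxx rmorph0 scale0r add0r /motive_scale.
apply: eq_bigr => i _; rewrite coefMX /= exprS rmorphM; congr (_ *: _).
exact: mulmxA.
Qed.
Lemma motive_scaleX p m : motive_scale p (m *m E 'X) = motive_scale p m *m E 'X.
Proof.
rewrite /motive_scale mulmx_suml; apply: eq_bigr => i _.
rewrite -scalemxAl -!mulmxA; congr (_ *: (_ *m _)).
by rewrite [LHS](esym (rmorphM E _ _)) [RHS](esym (rmorphM E _ _)) mulrC.
Qed.
Lemma motive_scaleCM c (p : {poly K}) m : motive_scale (c%:P * p) m = tpolyC s c *: (motive_scale p m : 'rV_l).
Proof.
rewrite mul_polyC (motive_scale_wide _ (size_scale_leq c p)) /motive_scale scaler_sumr.
by apply: eq_bigr => i _; rewrite coefZ rmorphM scalerA.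
Qed.
Fact motive_scale1 : left_id 1 motive_scale.
Proof. by move=> m; rewrite motive_scaleC rmorph1 scale1r. Qed.
Fact motive_scaleA p q m : motive_scale p (motive_scale q m) = motive_scale (p * q) m.
Proof.
elim/poly_ind: p => [|p c IH] in m *.
  by rewrite mul0r /motive_scale size_poly0 !big_ord0.
rewrite mulrDl !motive_scaleDl; congr (_ + _).
  by rewrite motive_scaleMX -motive_scaleX IH mulrAC motive_scaleMX.
by rewrite motive_scaleC motive_scaleCM.
Qed.
HB.instance Definition _ := GRing.Zmodule_isLmodule.Build {poly K} (motive E)
  motive_scaleA motive_scale1 motive_scaleDr motive_scaleDl.

Lemma motive_scaleE (iota : {rmorphism k -> K}) a (m : motive E) :
    (forall c, E c%:P = (tpolyC s (iota c))%:M) -> (forall c, s (iota c) = iota c) ->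
  map_poly iota a *: m = m *m E a.
Proof.
move=> EC sC.
have central c (b : tpoly s) : b * tpolyC s (iota c) = tpolyC s (iota c) * b.
  rewrite (tpoly_def b) mulr_suml mulr_sumr; apply: eq_bigr => i _.
  have Xc : tpolyX s ^+ i * tpolyC s (iota c) = tpolyC s (iota c) * tpolyX s ^+ i.
    elim: (i : nat) => [|j IH]; first by rewrite expr0 mulr1 mul1r.
    by rewrite exprS -mulrA IH !mulrA mul_tpolyXC sC.
  by rewrite -mulrA Xc !mulrA -!rmorphM mulrC.
elim/poly_ind: a => [|a c IH] in m *; first by rewrite !rmorph0 scale0r mulmx0.
rewrite !rmorphD !rmorphM /= map_polyX map_polyC scalerDl [RHS]mulmxDr; congr (_ + _).
  by rewrite [LHS]motive_scaleMX [LHS]IH -mulmxA; congr (_ *m _); rewrite -rmorphM mulrC rmorphM.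
rewrite [LHS]motive_scaleC EC; apply/rowP => i; rewrite !mxE.
rewrite (bigD1 i) //= mxE eqxx mulr1n central big1 ?addr0 // => j' ji.
by rewrite mxE (negPf ji) mulr0n mulr0.
Qed.
End Motive.

Section Adic.
Variables (K : fieldType) (p : {poly K}).

Definition nonconst_monic : bool := (p \is monic) && (1 < size p)%N.

(* The p-adic completion of K[t]: entry m lives in K[t]/(p^(m+1)), so the index
   is shifted to avoid the zero ring at exponent 0. *)
Definition adic_compatible (a : forall m, {poly %/ p ^+ m.+1}) : Prop :=
  forall m, in_qpoly (p ^+ m.+1) (a m.+1 : {poly K}) = a m.

Record adic (hp : nonconst_monic) := Adic {
  adic_seq :> forall m, {poly %/ p ^+ m.+1};
  adic_seqP : adic_compatible adic_seq }.

Variable hp : nonconst_monic.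
Local Notation Ap := (adic hp).

HB.instance Definition _ := gen_eqMixin Ap.
HB.instance Definition _ := gen_choiceMixin Ap.

Lemma adicP (a b : Ap) : (forall m, a m = b m) -> a = b.
Proof.
case: a b => [a ac] [b bc] /= e.
have {}e : a = b by apply: functional_extensionality_dep.
by case: b / e bc => bc; congr Adic; apply: Prop_irrelevance.
Qed.

Lemma mk_monic_exp m : mk_monic (p ^+ m.+1) = p ^+ m.+1.
Proof.
have /andP[mp sp] := hp; rewrite /mk_monic monic_exp // andbT.
suff -> : (1 < size (p ^+ m.+1)%R)%N by [].
rewrite -subn_gt0 subn1 size_exp muln_gt0 andbT.
by rewrite -subn1 subn_gt0.
Qed.

Lemma in_qpoly_exp m N a : (m <= N)%N ->
  in_qpoly (p ^+ m.+1) (in_qpoly (p ^+ N.+1) a : {poly K}) = in_qpoly (p ^+ m.+1) a.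
Proof.
move=> le; apply: val_inj; rewrite /= !mk_monic_exp.
have /andP[mp _] := hp.
have mE i : p ^+ i \is monic by apply: monic_exp.
rewrite [in RHS](Pdiv.RingMonic.rdivp_eq (mE N.+1) a).
set c := Pdiv.CommonRing.rdivp _ _; set r := Pdiv.CommonRing.rmodp _ (p ^+ N.+1).
have -> : p ^+ N.+1 = p ^+ (N - m) * p ^+ m.+1 by rewrite -exprD addnS subnK.
by rewrite mulrA Pdiv.RingMonic.rmodpD // Pdiv.RingMonic.rmodp_mull // add0r.
Qed.

Definition to_adic (a : {poly K}) : Ap :=
  @Adic hp (fun m => in_qpoly (p ^+ m.+1) a) (fun m => in_qpoly_exp a (leqnSn m)).

Fact adic_opp_compat (a : Ap) : adic_compatible (fun m => - a m).
Proof. by move=> m; rewrite -[in RHS]adic_seqP -rmorphN. Qed.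
Fact adic_add_compat (a b : Ap) : adic_compatible (fun m => a m + b m).
Proof. by move=> m; rewrite -[in RHS](adic_seqP a) -[in RHS](adic_seqP b) -rmorphD. Qed.
Fact adic_mul_compat (a b : Ap) : adic_compatible (fun m => a m * b m).
Proof.
move=> m; rewrite -[in RHS](adic_seqP a) -[in RHS](adic_seqP b) -rmorphM.
exact: in_qpoly_exp (leqnSn m).
Qed.

Definition adic_opp a : Ap := Adic hp (adic_opp_compat a).
Definition adic_add a b : Ap := Adic hp (adic_add_compat a b).
Definition adic_mul a b : Ap := Adic hp (adic_mul_compat a b).

Fact adic_addA : associative adic_add.
Proof. by move=> a b c; apply: adicP => m; apply: addrA. Qed.
Fact adic_addC : commutative adic_add.
Proof. by move=> a b; apply: adicP => m; apply: addrC. Qed.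
Fact adic_add0 : left_id (to_adic 0) adic_add.
Proof. by move=> a; apply: adicP => m; rewrite /= rmorph0 add0r. Qed.
Fact adic_addN : left_inverse (to_adic 0) adic_opp adic_add.
Proof. by move=> a; apply: adicP => m; rewrite /= rmorph0 addNr. Qed.
HB.instance Definition _ :=
  GRing.isZmodule.Build Ap adic_addA adic_addC adic_add0 adic_addN.

Fact adic_mulA : associative adic_mul.
Proof. by move=> a b c; apply: adicP => m; apply: mulrA. Qed.
Fact adic_mulC : commutative adic_mul.
Proof. by move=> a b; apply: adicP => m; apply: mulrC. Qed.
Fact adic_mul1 : left_id (to_adic 1) adic_mul.
Proof. by move=> a; apply: adicP => m; rewrite /= rmorph1 mul1r. Qed.
Fact adic_mulDl : left_distributive adic_mul +%R.
Proof. by move=> a b c; apply: adicP => m; apply: mulrDl. Qed.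
Fact adic_oner_neq0 : to_adic 1 != 0.
Proof.
apply/eqP => /(congr1 (fun a : Ap => a 0%N)) /=; rewrite rmorph1 rmorph0 => /eqP.
by rewrite oner_eq0.
Qed.
HB.instance Definition _ := GRing.Zmodule_isComNzRing.Build Ap
  adic_mulA adic_mulC adic_mul1 adic_mulDl adic_oner_neq0.

Fact to_adic_is_zmod_morphism : zmod_morphism to_adic.
Proof. by move=> a b; apply: adicP => m; exact: rmorphB. Qed.
Fact to_adic_is_monoid_morphism : monoid_morphism to_adic.
Proof. by split=> // a b; apply: adicP => m; exact: rmorphM. Qed.
HB.instance Definition _ := GRing.isZmodMorphism.Build {poly K} Ap to_adic
  to_adic_is_zmod_morphism.
HB.instance Definition _ := GRing.isMonoidMorphism.Build {poly K} Ap to_adic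
  to_adic_is_monoid_morphism.
End Adic.

Section Tate.
Variables (K : fieldType) (p : {poly K}) (M : lmodType {poly K}).

(* The limit of the p^(m+1)-torsion submodules M[p^(m+1)] under multiplication
   by p, indexed from 0 as for adic. *)
Definition tate_compatible (x : nat -> M) : Prop :=
  forall m, p ^+ m.+1 *: x m = 0 /\ p *: x m.+1 = x m.

Record tate (hp : nonconst_monic p) := Tate {
  tate_seq :> nat -> M;
  tate_seqP : tate_compatible tate_seq }.
Variable hp : nonconst_monic p.
Local Notation Tp := (tate hp).

HB.instance Definition _ := gen_eqMixin Tp.
HB.instance Definition _ := gen_choiceMixin Tp.

Lemma tateP (x y : Tp) : (forall m, x m = y m) -> x = y.
Proof.
case: x y => [x xc] [y yc] /= e.
have {}e : x = y by apply/funext.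
by case: y / e yc => yc; congr Tate; apply: Prop_irrelevance.
Qed.

Lemma tate_torsion (x : Tp) m : p ^+ m.+1 *: x m = 0.
Proof. by case: (tate_seqP x m). Qed.
Lemma tate_step (x : Tp) m : p *: x m.+1 = x m.
Proof. by case: (tate_seqP x m). Qed.

Lemma in_qpoly_scale a (x : Tp) m :
  (in_qpoly (p ^+ m.+1) a : {poly K}) *: x m = a *: x m.
Proof.
have /andP[mp _] := hp.
rewrite /= mk_monic_exp //.
rewrite [in RHS](Pdiv.RingMonic.rdivp_eq (monic_exp m.+1 mp) a).
by rewrite scalerDl -scalerA tate_torsion scaler0 add0r.
Qed.

Fact tate_zero_compat : tate_compatible (fun=> 0).
Proof. by move=> m; rewrite !scaler0. Qed.
Fact tate_opp_compat (x : Tp) : tate_compatible (fun m => - x m).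
Proof. by move=> m; rewrite !scalerN tate_torsion tate_step oppr0. Qed.
Fact tate_add_compat (x y : Tp) : tate_compatible (fun m => x m + y m).
Proof. by move=> m; rewrite !scalerDr !tate_torsion !tate_step addr0. Qed.
Fact tate_scale_compat (a : adic hp) (x : Tp) :
  tate_compatible (fun m => (a m : {poly K}) *: x m).
Proof.
move=> m; split; first by rewrite scalerA mulrC -scalerA tate_torsion scaler0.
rewrite -(adic_seqP a m) in_qpoly_scale.
by rewrite scalerA mulrC -scalerA tate_step.
Qed.

Definition tate_zero : Tp := Tate hp tate_zero_compat.
Definition tate_opp x : Tp := Tate hp (tate_opp_compat x).
Definition tate_add x y : Tp := Tate hp (tate_add_compat x y).
Definition tate_scale a x : Tp := Tate hp (tate_scale_compat a x).

Fact tate_addA : associative tate_add.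
Proof. by move=> a b c; apply: tateP => m; apply: addrA. Qed.
Fact tate_addC : commutative tate_add.
Proof. by move=> a b; apply: tateP => m; apply: addrC. Qed.
Fact tate_add0 : left_id tate_zero tate_add.
Proof. by move=> a; apply: tateP => m; rewrite /= add0r. Qed.
Fact tate_addN : left_inverse tate_zero tate_opp tate_add.
Proof. by move=> a; apply: tateP => m; rewrite /= addNr. Qed.
HB.instance Definition _ :=
  GRing.isZmodule.Build Tp tate_addA tate_addC tate_add0 tate_addN.

Fact tate_scaleA a b x : tate_scale a (tate_scale b x) = tate_scale (a * b) x.
Proof.
apply: tateP => m; rewrite [LHS]scalerA.
exact: esym (in_qpoly_scale _ x m).
Qed.
Fact tate_scale1 : left_id 1 tate_scale.
Proof.
move=> x; apply: tateP => m; rewrite [LHS](in_qpoly_scale 1 x m).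
exact: scale1r.
Qed.
Fact tate_scaleDr : right_distributive tate_scale +%R.
Proof. by move=> a x y; apply: tateP => m; apply: scalerDr. Qed.
Fact tate_scaleDl x : {morph tate_scale^~ x : a b / a + b}.
Proof. by move=> a b; apply: tateP => m; apply: scalerDl. Qed.
HB.instance Definition _ := GRing.Zmodule_isLmodule.Build (adic hp) Tp
  tate_scaleA tate_scale1 tate_scaleDr tate_scaleDl.

Variable phi : {linear M -> M}.

Fact tate_map_compat (x : Tp) : tate_compatible (fun m => phi (x m)).
Proof. by move=> m; rewrite -!linearZ tate_torsion tate_step linear0. Qed.
Definition tate_map x : Tp := Tate hp (tate_map_compat x).
Fact tate_map_is_linear : linear tate_map.
Proof. by move=> a x y; apply: tateP => m; exact: linearP. Qed.
HB.instance Definition _ := GRing.isLinear.Build (adic hp) Tp Tp _ tate_map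
  tate_map_is_linear.
End Tate.
Arguments tate_map {K p M} hp phi x.

Section Frobenius.
Variables (k : finFieldType) (F : fieldType) (j : {rmorphism k -> F}).

(* The q-power map for q = #|k|; the embedding j makes it a ring morphism. *)
Definition frob of {rmorphism k -> F} := fun x : F => x ^+ #|k|.

Lemma frobD x y : frob j (x + y) = frob j x + frob j y.
Proof.
have [p _ pk] := finPcharP k.
have pF : p \in [pchar F] by rewrite (fmorph_pchar j).
have := pprimeChar_pgroup pk; rewrite pgroupE cardsT => kp.
by rewrite /frob exprDn_pchar // (eq_pnat _ (pcharf_eq pF)).
Qed.
Lemma frobN x : frob j (- x) = - frob j x.
Proof.
have f0 : frob j 0 = 0 by rewrite /frob expr0n gtn_eqF //; apply/card_gt0P; exists 0.
by apply: (addrI (frob j x)); rewrite -frobD !subrr.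
Qed.
Fact frob_is_zmod_morphism : zmod_morphism (frob j).
Proof. by move=> x y; rewrite frobD frobN. Qed.
Fact frob_is_monoid_morphism : monoid_morphism (frob j).
Proof. by split=> [|x y]; rewrite /frob ?expr1n ?exprMn. Qed.
HB.instance Definition _ := GRing.isZmodMorphism.Build F F (frob j) frob_is_zmod_morphism.
HB.instance Definition _ := GRing.isMonoidMorphism.Build F F (frob j) frob_is_monoid_morphism.
End Frobenius.

Section FrobeniusInverse.
Variables (k : finFieldType) (F : closedFieldType) (j : {rmorphism k -> F}).

Definition frobV (j : {rmorphism k -> F}) (x : F) : F := xget 0 [set y | frob j y = x].

Lemma frobVK : cancel (frobV j) (frob j).
Proof.
move=> x; rewrite /frobV; case: xgetP => // noroot.
have q0 : (0 < #|k|)%N by apply/card_gt0P; exists 0.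
have [y] := solve_monicpoly (fun i => if i == 0%N then x else 0) q0.
case eqk: (#|k|) q0 => [|q] // _.
rewrite big_ord_recl /= expr0 mulr1 big1 ?addr0 => [ey|i _]; last by rewrite mul0r.
by case: (noroot y); rewrite /= /frob eqk.
Qed.
Lemma frobK : cancel (frob j) (frobV j).
Proof. by move=> x; apply: (fmorph_inj (frob j)); rewrite /= frobVK. Qed.
Fact frobV_is_zmod_morphism : zmod_morphism (frobV j).
Proof. by move=> x y; apply: (fmorph_inj (frob j)); rewrite /= rmorphB /= !frobVK. Qed.
Fact frobV_is_monoid_morphism : monoid_morphism (frobV j).
Proof.
split=> [|x y]; apply: (fmorph_inj (frob j)); last by rewrite /= rmorphM /= !frobVK.
by rewrite /= frobVK rmorph1.
Qed.
HB.instance Definition _ := GRing.isZmodMorphism.Build F F (frobV j) frobV_is_zmod_morphism.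
HB.instance Definition _ := GRing.isMonoidMorphism.Build F F (frobV j) frobV_is_monoid_morphism.
End FrobeniusInverse.

Section IterMorphism.
Variables (K : fieldType) (s : {rmorphism K -> K}) (i : nat).
Definition iterm : K -> K := iter i s.
Fact iterm_is_zmod_morphism : zmod_morphism iterm.
Proof. by rewrite /iterm => x y; elim: i => //= m ->; rewrite rmorphB. Qed.
Fact iterm_is_monoid_morphism : monoid_morphism iterm.
Proof.
rewrite /iterm; split=> [|x y]; first by elim: i => //= m ->; rewrite rmorph1.
by elim: i => //= m ->; rewrite rmorphM.
Qed.
HB.instance Definition _ := GRing.isZmodMorphism.Build K K iterm iterm_is_zmod_morphism.
HB.instance Definition _ := GRing.isMonoidMorphism.Build K K iterm iterm_is_monoid_morphism.
End IterMorphism.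

HB.instance Definition _ (R : finFieldType) (h : {poly R}) (hI : monic_irreducible_poly h) :=
  GRing.isZmodMorphism.Build R {poly %/ h with hI} (qfpoly_const hI)
    (@qpolyC_is_zmod_morphism R h).
HB.instance Definition _ (R : finFieldType) (h : {poly R}) (hI : monic_irreducible_poly h) :=
  GRing.isMonoidMorphism.Build R {poly %/ h with hI} (qfpoly_const hI)
    (@qpolyC_is_monoid_morphism R h).

(* kind and n fix {{Z}}; Ff = F_q[theta]/(f), Fbar is an algebraic closure of Ff
   via j. *)
Section Setting.
Variables (kind : coef_field) (n : nat) (Fq : finFieldType).
Variables (f : {poly Fq}) (hf : monic_irreducible_poly f).
Variables (Fbar : closedFieldType) (j : {rmorphism {poly %/ f with hf} -> Fbar}).

Local Notation Ff := {poly %/ f with hf}.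
Local Notation Kq := (coefF kind n Fq).
Local Notation Kf := (coefF kind n Ff).
Local Notation H := (coefF kind n Fbar).

Definition jq : {rmorphism Fq -> Fbar} := j \o qfpoly_const hf.

Definition Kq_Kf : {rmorphism Kq -> Kf} := coefF_map (kind := kind) (n := n) (qfpoly_const hf).
Definition Kf_H : {rmorphism Kf -> H} := coefF_map (kind := kind) (n := n) j.
Definition Kq_H : {rmorphism Kq -> H} := Kf_H \o Kq_Kf.

Definition tauf : {rmorphism Kf -> Kf} :=
  coefF_map (kind := kind) (n := n) (frob (qfpoly_const hf)).
Definition tau : {rmorphism H -> H} := coefF_map (kind := kind) (n := n) (frob jq).
Definition sigma : {rmorphism H -> H} := coefF_map (kind := kind) (n := n) (frobV jq).

Definition thetabar : Kf := coefF_const kind n ('qX : Ff).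

Definition degf : nat := (size f).-1.

Fact Kf_H_tau x : Kf_H (tauf x) = tau (Kf_H x).
Proof.
pose chi : {rmorphism Ff -> Fbar} := j \o frob (qfpoly_const hf).
have e1 : j \o frob (qfpoly_const hf) =1 chi by [].
have e2 : frob jq \o j =1 chi by move=> y; rewrite /chi /= /frob rmorphXn.
rewrite [LHS](coefF_map_comp (chi := chi) e1) [RHS](coefF_map_comp (chi := chi) e2).
by [].
Qed.

Fact tauK : cancel tau sigma.
Proof.
move=> x; rewrite [LHS](coefF_map_comp (chi := idfun)); last exact: frobK.
exact: coefF_map_id.
Qed.

Fact sigmaK : cancel sigma tau.
Proof.
move=> x; rewrite [LHS](coefF_map_comp (chi := idfun)); last exact: frobVK.
exact: coefF_map_id.
Qed.

Fact tau_d_Kf x : iter degf tau (Kf_H x) = Kf_H x.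
Proof.
have -> m : iter m tau (Kf_H x) = Kf_H (iter m tauf x).
  by elim: m => //= m ->; rewrite Kf_H_tau.
apply: (congr1 Kf_H).
have -> m : iter m tauf x = coefF_map (iterm (frob (qfpoly_const hf)) m) x.
  elim: m => [|m IH]; first by rewrite [RHS]coefF_map_id.
  by rewrite iterS IH; apply: coefF_map_comp.
apply: coefF_map_id => y.
have iterE m : iter m (frob (qfpoly_const hf)) y = y ^+ (#|Fq| ^ m).
  by elim: m => //= m ->; rewrite /frob -exprM expnSr.
by rewrite [LHS]iterE -(card_qfpoly hf) expf_card.
Qed.

Variable l : nat.

Section Module.
Variable E : {rmorphism {poly Kq} -> 'M[tpoly tauf]_l}.

Definition is_tmodule : Prop :=
  (forall c : Kq, E c%:P = (tpolyC tauf (Kq_Kf c))%:M) /\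
  exists N, (map_mx (fun b => tcoef b 0) (E 'X) - thetabar%:M) ^+ N = 0.

Definition base_change a : 'M[tpoly tau]_l := map_mx (tmap Kf_H_tau) (E a).

Fact base_change_is_zmod_morphism : zmod_morphism base_change.
Proof. by move=> a b; rewrite /base_change rmorphB map_mxB. Qed.
Fact base_change_is_monoid_morphism : monoid_morphism base_change.
Proof.
split=> [|a b]; first by rewrite /base_change rmorph1 map_mx1.
by rewrite /base_change rmorphM [LHS]map_mxM.
Qed.
HB.instance Definition _ := GRing.isZmodMorphism.Build {poly Kq} 'M[tpoly tau]_l
  base_change base_change_is_zmod_morphism.
HB.instance Definition _ := GRing.isMonoidMorphism.Build {poly Kq} 'M[tpoly tau]_l
  base_change base_change_is_monoid_morphism.

Definition adjoint a : 'M[tpoly sigma]_l := mx_tstar sigma (base_change a).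

Fact adjoint_is_zmod_morphism : zmod_morphism adjoint.
Proof. by move=> a b; rewrite /adjoint rmorphB; apply: mx_tstarB. Qed.
Fact adjoint_is_monoid_morphism : monoid_morphism adjoint.
Proof.
split=> [|a b]; first by rewrite /adjoint rmorph1; apply: mx_tstar1.
rewrite /adjoint mulrC rmorphM; exact: (mx_tstarM tauK (base_change b) (base_change a)).
Qed.
HB.instance Definition _ := GRing.isZmodMorphism.Build {poly Kq} 'M[tpoly sigma]_l
  adjoint adjoint_is_zmod_morphism.
HB.instance Definition _ := GRing.isMonoidMorphism.Build {poly Kq} 'M[tpoly sigma]_l
  adjoint adjoint_is_monoid_morphism.

Definition tau_d (x : points base_change) : points base_change :=
  map_mx (iter degf tau) x.

Fact tau_d_is_linear : linear tau_d.
Proof.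
move=> a x y.
rewrite /tau_d -/(iterm tau degf) [LHS]map_mxD; congr (_ + _).
apply: tact_map => [z|i k m]; first by rewrite /= /iterm -iterS iterSr.
by rewrite mxE /tcoef coef_map /= /iterm tau_d_Kf.
Qed.
HB.instance Definition _ := GRing.isLinear.Build {poly Kq} (points base_change)
  (points base_change) _ tau_d tau_d_is_linear.
End Module.

Section Lambda.
Variable lam : {poly Fq}.
Definition lamK : {poly Kq} := map_poly (@coefF_const kind n Fq) lam.

Fact lamK_nonconst : monic_irreducible_poly lam -> nonconst_monic lamK.
Proof.
move=> [[sl _] ml]; rewrite /nonconst_monic /lamK map_monic ml /=.
by rewrite size_map_poly.
Qed.
End Lambda.
End Setting.
Arguments tau_d {kind n Fq f hf Fbar} j {l} E x.

(* Main.v *)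
(* Write K = F_q{{Z}} and H = \bar F_f{{Z}}. A row vector m of twisted polynomials is
   evaluated at a column vector x, and right multiplication by tau^d on the t-motive is
   an H[t]-linear map rho, adjoint to the action of tau^d on points; let Theta be its
   matrix in an H[t]-basis.
   The points of E over F_f{{Z}} are those killed by 1 - tau^d, and evaluation
   identifies the cokernel of 1 - rho with the H-linear dual of E(F_f{{Z}}), so that the
   order of E(F_f{{Z}}) is det(1 - Theta) up to a scalar (uniqueness of Fitting ideals).
   Full dimension of E[lam^m] makes the pairing of the t-motive modulo lam^m with
   E[lam^m] perfect. Hence T_lam(E) has a finite basis, and a suitable dual of that basis
   conjugates the matrix of tau^d on T_lam(E), modulo lam^m, to Theta. So the
   characteristic polynomial at 1 is det(1 - Theta) modulo every lam^m. *)

Require Import Defs.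
From HB Require Import structures.
From mathcomp Require Import all_boot all_order all_algebra all_field.
From mathcomp Require Import fingroup perm mpoly.
From mathcomp Require Import boolp classical_sets.

Set Implicit Arguments.
Unset Strict Implicit.
Unset Printing Implicit Defensive.

Import Order.TTheory GRing.Theory.
Local Open Scope classical_set_scope.
Local Open Scope ring_scope.

(** * Presentations of modules *)

(** Torsion points form a space over K, while the t-motive modulo a polynomial is a space over the
    much larger H, and the pairing takes values in H. The bridge is descent along tau: relations
    over H that tau permutes are combinations of relations over K, so K-independent points stay
    independent as functionals. This requires the fixed field of tau to be K. A fixed fraction need
    not have fixed numerator and denominator, so a K-linear functional is applied to the
    coefficients of both. The values in H are converted to coordinates in H[t]/lam^m by the form
    that reads off the coefficient of degree deg(lam^m) - 1; this form is what makes a dual family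
    possible. The ranks of T_lam(E) and of the t-motive arise separately, so the conjugation is a
    pair of mutually inverse rectangular matrices, and the determinants are compared by Sylvester's
    identity. Finally, det(1 - Theta) has coefficients in H; agreeing with polynomials over K modulo
    arbitrarily high powers of lam, it is itself defined over K, and gamma is the inverse of its
    leading coefficient. *)

Lemma det1B_mulmxC (R : comNzRingType) m n (A : 'M[R]_(m, n)) (B : 'M_(n, m)) :
  \det (1%:M - A *m B) = \det (1%:M - B *m A).
Proof.
have e1 : block_mx 1%:M A B 1%:M
    = block_mx 1%:M 0 B 1%:M *m block_mx 1%:M A 0 (1%:M - B *m A).
  by rewrite mulmx_block ?(mul1mx, mul0mx, mulmx1, mulmx0) ?(addr0, add0r) subrKC.
have e2 : block_mx 1%:M A B 1%:M
    = block_mx 1%:M A 0 1%:M *m block_mx (1%:M - A *m B) 0 B 1%:M.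
  by rewrite mulmx_block ?(mul1mx, mul0mx, mulmx1, mulmx0) ?(addr0, add0r) subrK.
have := congr1 determinant e1; rewrite e2 !det_mulmx !det_ublock !det_lblock.
by rewrite !det1 !mul1r mulr1.
Qed.

Section LinearCombination.
Variables (R : pzRingType) (V : lmodType R) (n : nat).
Implicit Types (u v : 'rV[R]_n) (a : 'I_n -> V).

Definition lincomb u a : V := \sum_i u 0 i *: a i.

Lemma lincombD u v a : lincomb (u + v) a = lincomb u a + lincomb v a.
Proof. by rewrite -big_split; apply: eq_bigr => i _; rewrite mxE scalerDl. Qed.
Lemma lincombZ c u a : lincomb (c *: u) a = c *: lincomb u a.
Proof. by rewrite scaler_sumr; apply: eq_bigr => i _; rewrite mxE scalerA. Qed.
Lemma lincombN u a : lincomb (- u) a = - lincomb u a.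
Proof. by rewrite -[- u]scaleN1r lincombZ scaleN1r. Qed.
Lemma lincombB u v a : lincomb (u - v) a = lincomb u a - lincomb v a.
Proof. by rewrite lincombD lincombN. Qed.
Lemma lincomb0 a : lincomb 0 a = 0.
Proof. by apply: big1 => i _; rewrite mxE scale0r. Qed.
Lemma lincomb_delta i a : lincomb (delta_mx 0 i) a = a i.
Proof.
rewrite /lincomb (bigD1 i) //= mxE !eqxx scale1r big1 ?addr0 // => k ki.
by rewrite mxE (negPf ki) andbF scale0r.
Qed.
End LinearCombination.

Lemma lincomb_mul (R : pzRingType) (V : lmodType R) m n (u : 'rV[R]_m)
    (A : 'M_(m, n)) (a : 'I_n -> V) :
  lincomb (u *m A) a = lincomb u (fun i => lincomb (row i A) a).
Proof.
rewrite /lincomb; under eq_bigr do rewrite mxE scaler_suml.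
rewrite exchange_big; apply: eq_bigr => i _; rewrite scaler_sumr.
by apply: eq_bigr => k _; rewrite mxE scalerA.
Qed.

Definition submodule (R : pzRingType) (V : lmodType R) (I : V -> Prop) : Prop :=
  [/\ I 0, forall x y, I x -> I y -> I (x + y) & forall a x, I x -> I (a *: x)].

Definition presents (R : pzRingType) (V : lmodType R) (I : V -> Prop) n
    (a : 'I_n -> V) (B : 'M[R]_n) : Prop :=
  (forall v, exists u, I (v - lincomb u a)) /\
  forall u, I (lincomb u a) <-> exists w, u = w *m B.

Section Submodule.
Variables (R : pzRingType) (V : lmodType R) (I : V -> Prop).
Hypothesis subI : submodule I.

Lemma submodN x : I x -> I (- x).
Proof. by case: subI => _ _ IZ Ix; rewrite -scaleN1r; apply: IZ. Qed.
Lemma submodB x y : I x -> I y -> I (x - y).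
Proof. by case: subI => _ ID _ Ix Iy; apply: ID => //; apply: submodN. Qed.
Lemma submod_sum J (r : seq J) (P : pred J) F :
  (forall i, P i -> I (F i)) -> I (\sum_(i <- r | P i) F i).
Proof. by case: subI => I0 ID _ IF; apply: big_ind. Qed.
Lemma submod_sym x y : I (x - y) -> I (y - x).
Proof. by move/submodN; rewrite opprB. Qed.
Lemma submod_lincomb n (u : 'rV[R]_n) a b :
  (forall i, I (a i - b i)) -> I (lincomb u a - lincomb u b).
Proof.
move=> Iab; rewrite -sumrB; apply: submod_sum => i _.
by rewrite -scalerBr; case: subI => _ _; apply.
Qed.
Lemma submod_addr x y : I y -> I (x + y) <-> I x.
Proof.
move=> Iy; split=> [Ixy|Ix]; last by case: subI => _ ID _; apply: ID.
by rewrite -(addrK y x); apply: submodB.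
Qed.
End Submodule.

Lemma submodule_eq0 (R : pzRingType) (V : lmodType R) : submodule (fun v : V => v = 0).
Proof. by split=> [|x y -> ->|a x ->] //; rewrite ?addr0 ?scaler0. Qed.

Lemma rows_choice (R : pzRingType) m n (P : 'I_m -> 'rV[R]_n -> Prop) :
  (forall i, exists u, P i u) -> exists X : 'M_(m, n), forall i, P i (row i X).
Proof. by move=> /choice[F PF]; exists (\matrix_i F i) => i; rewrite rowK. Qed.

(* The families a and b together are presented by the square matrices
   [B, 0; -Y, 1] and [1, -X; 0, C], which have the same row space. *)
Lemma presents_det (R : comNzRingType) (V : lmodType R) (I : V -> Prop) m n
    (a : 'I_m -> V) (b : 'I_n -> V) (B : 'M_m) (C : 'M_n) :
  submodule I -> presents I a B -> presents I b C -> exists w, \det B = w * \det C.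
Proof.
move=> subI [genA relA] [genB relB].
have [X aX] := rows_choice (fun i => genB (a i)).
have [Y bY] := rows_choice (fun i => genA (b i)).
(* Substituting [X] times [b] for [a] turns a joint relation (u, v) into the relation u X + v among
   [b] alone, which is a combination of the rows of [C]. *)
have span u v : I (lincomb u a + lincomb v b) ->
    exists w : 'rV_(m + n), row_mx u v = w *m block_mx 1%:M (- X) 0 C.
  move=> Iuv; have [w ew] : exists w, u *m X + v = w *m C.
    apply/relB; rewrite lincombD lincomb_mul.
    rewrite -[X in X + _](subrK (lincomb u a)) -addrA; case: (subI) => _ ID _.
    by apply: ID Iuv; apply: submod_lincomb => // i; apply: submod_sym.
  exists (row_mx u w); rewrite mul_row_block mulmx1 mulmx0 addr0 mulmxN -ew.
  by rewrite addKr.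
have [W eW] : exists W, block_mx B 0 (- Y) 1%:M = W *m block_mx 1%:M (- X) 0 C.
  apply: contrapT => H; have [|W eW] := @rows_choice R (m + n) (m + n) (fun i u =>
      row i (block_mx B 0 (- Y) 1%:M) = u *m block_mx 1%:M (- X) 0 C); last first.
    by apply: H; exists W; apply/row_matrixP => i; rewrite eW row_mul.
  move=> i; case: (split_ordP i) => k ->.
    rewrite /block_mx rowKu row_row_mx; apply: span.
    by rewrite row0 lincomb0 addr0; apply/relA; exists (delta_mx 0 k); rewrite -rowE.
  rewrite /block_mx rowKd row_row_mx; apply: span.
  by rewrite row1 lincomb_delta linearN /= lincombN addrC; apply: bY.
exists (\det W); have := congr1 determinant eW.
by rewrite det_mulmx det_lblock det_ublock !det1 mulr1 mul1r.
Qed.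

(** * Diagonalization over K[t] *)

Lemma unitmx_addZdelta (R : comUnitRingType) n (i k : 'I_n) (q : R) :
  i != k -> 1%:M + q *: delta_mx i k \in unitmx.
Proof.
move=> ik; apply: (proj1 (@mulmx1_unit _ _ _ (1%:M - q *: delta_mx i k) _)).
rewrite mulmxDl mul1mx mulmxBr mulmx1 -scalemxAr -scalemxAl.
by rewrite mul_delta_mx_0 1?eq_sym // !scaler0 subr0 subrK.
Qed.

Section Diagonalize.
Variable K : fieldType.
Implicit Types n : nat.

Definition equiv_mx n (A B : 'M[{poly K}]_n) : Prop :=
  exists U V, [/\ U \in unitmx, V \in unitmx & U *m A *m V = B].

Lemma equiv_mx_refl n (A : 'M_n) : equiv_mx A A.
Proof. by exists 1%:M, 1%:M; rewrite unitmx1 mul1mx mulmx1. Qed.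

Lemma equiv_mx_trans n (A B C : 'M_n) : equiv_mx A B -> equiv_mx B C -> equiv_mx A C.
Proof.
move=> [U [V [uU uV <-]]] [U' [V' [uU' uV' <-]]]; exists (U' *m U), (V *m V').
by rewrite !unitmx_mul uU uU' uV uV'; split=> //; rewrite !mulmxA.
Qed.

Lemma equiv_mx_tr n (A B : 'M_n) : equiv_mx A B -> equiv_mx A^T B^T.
Proof.
move=> [U [V [uU uV <-]]]; exists V^T, U^T; rewrite !unitmx_tr uU uV; split=> //.
by rewrite !trmx_mul mulmxA.
Qed.

Lemma equiv_mx_perm n (A : 'M_n) s s' : equiv_mx A (row_perm s (col_perm s' A)).
Proof.
exists (perm_mx s), (perm_mx s'^-1%g); rewrite !unitmx_perm; split=> //.
by rewrite row_permE col_permE mulmxA.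
Qed.

(** One Euclidean step: a multiple of the first row is subtracted from row [i], and the remainder is
    swapped into the corner. *)
Lemma equiv_mx_modp n (B : 'M_n.+1) i :
  ~~ (B 0 0 %| B i 0)%R -> exists2 C, equiv_mx B C & C 0 0 = (B i 0 %% B 0 0)%R.
Proof.
move=> ndvd; have i0 : i != 0 by apply: contraNneq ndvd => ->; rewrite dvdpp.
pose q := B i 0 %/ B 0 0; pose U := 1%:M + (- q) *: delta_mx i 0.
exists (row_perm (tperm 0 i) (U *m B)).
  exists (perm_mx (tperm 0 i) *m U), 1%:M; rewrite unitmx1 unitmx_mul unitmx_perm.
  by rewrite unitmx_addZdelta //; split=> //; rewrite mulmx1 row_permE mulmxA.
have -> : row_perm (tperm 0 i) (U *m B) 0 0 = B i 0 - q * B 0 0.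
  rewrite mxE tpermL /U mulmxDl mul1mx -scalemxAl mxE [X in _ + X]mxE mulNr; congr (_ - _ * _).
  rewrite mxE (bigD1 0) //= mxE !eqxx mul1r big1 ?addr0 // => k k0.
  by rewrite mxE (negPf k0) andbF mul0r.
by apply/eqP; rewrite subr_eq addrC -divp_eq.
Qed.

(** The off-diagonal blocks are multiples of the pivot, so clearing them takes no inverse of [b]. *)
Lemma elim_block m n (b : 'M[{poly K}]_m) (u : 'M_(m, n)) (v : 'M_(n, m)) (D : 'M_n) :
  block_mx 1%:M 0 (- v) 1%:M *m block_mx b (b *m u) (v *m b) D *m block_mx 1%:M (- u) 0 1%:M
    = block_mx b 0 0 (D - v *m b *m u).
Proof.
rewrite !mulmx_block ?(mul1mx, mul0mx, mulmx1, mulmx0) ?(addr0, add0r).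
by rewrite mulmxN addNr !mulNmx addNr mul0mx add0r mulmxA addrC.
Qed.

Lemma equiv_mx_diag n (A : 'M[{poly K}]_n) : exists d, equiv_mx A (diag_mx d).
Proof.
elim: n A => [|n IH] A.
  by exists 0; rewrite [A]flatmx0 [diag_mx _]flatmx0; exact: equiv_mx_refl.
have [->|/matrix0Pn[i [k Aik]]] := eqVneq A 0.
  by exists 0; rewrite linear0; exact: equiv_mx_refl.
(* Among all matrices equivalent to [A], one with a nonzero corner of least degree is taken: a
   nonzero remainder in its first column or row would give a smaller corner. *)
pose P s := `[< exists2 B, equiv_mx A B & (B 0 0 != 0) && (size (B 0 0) == s) >].
have exP : exists s, P s.
  exists (size (A i k)); apply/asboolP.
  exists (row_perm (tperm 0 i) (col_perm (tperm 0 k) A)); first exact: equiv_mx_perm.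
  by rewrite !mxE !tpermL Aik eqxx.
case: (ex_minnP exP) => s /asboolP[B AB /andP[B0 /eqP Bs]] mins.
have minB C : equiv_mx B C -> C 0 0 != 0 -> (size (B 0%R 0%R) <= size (C 0%R 0%R))%N.
  move=> BC C0; rewrite Bs; apply: mins; apply/asboolP; exists C; last by rewrite C0 eqxx.
  exact: equiv_mx_trans AB BC.
have dvdc i' : (B 0 0 %| B i' 0)%R.
  apply/negPn/negP => nd; have [C BC C0] := equiv_mx_modp nd.
  by have := minB C BC; rewrite C0 leqNgt ltn_modp B0 => /(_ nd).
have dvdr k' : (B 0 0 %| B 0 k')%R.
  apply/negPn/negP => nd; have := @equiv_mx_modp _ B^T k'; rewrite !mxE.
  move=> /(_ nd)[C /equiv_mx_tr]; rewrite trmxK => BC C0.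
  by have := minB _ BC; rewrite mxE C0 leqNgt ltn_modp B0 => /(_ nd).
have [C BC] : exists C : 'M_n, equiv_mx B (block_mx (B 0 0)%:M 0 0 C : 'M_(1 + n)).
  pose v := \col_i (B (lift 0 i) 0 %/ B 0 0); pose u := \row_i (B 0 (lift 0 i) %/ B 0 0).
  pose U : 'M_(1 + n) := block_mx 1%:M 0 (- v) 1%:M.
  pose V : 'M_(1 + n) := block_mx 1%:M (- u) 0 1%:M.
  pose D : 'M_n := drsubmx (B : 'M_(1 + n)).
  have uU : U \in unitmx by rewrite unitmxE det_lblock !det1 mulr1 unitr1.
  have uV : V \in unitmx by rewrite unitmxE det_ublock !det1 mulr1 unitr1.
  exists (D - v *m (B 0 0)%:M *m u); exists U, V; split=> //.
  have eB : B = block_mx (B 0 0)%:M ((B 0 0)%:M *m u) (v *m (B 0 0)%:M) D :> 'M_(1 + n).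
    rewrite -[LHS](@submxK _ 1 n 1 n); congr block_mx.
    - by apply/matrixP => x y; rewrite !mxE !ord1 eqxx; congr (B _ _); apply: val_inj.
    - rewrite mul_scalar_mx; apply/matrixP => x y; rewrite !mxE !ord1 mulrC divpK //.
      by congr (B _ _); apply: val_inj.
    rewrite mul_mx_scalar; apply/matrixP => x y; rewrite !mxE !ord1 mulrC divpK //.
    by congr (B _ _); apply: val_inj.
  by rewrite [X in U *m X]eB; exact: (elim_block (B 0 0)%:M u v D).
have [d CD] := IH C.
exists (row_mx (B 0 0)%:M d : 'rV_(1 + n)).
apply: equiv_mx_trans (equiv_mx_trans AB BC) _.
have [U [V [uU uV UV]]] := CD.
have uU' : (block_mx 1%:M 0 0 U : 'M_(1 + n)) \in unitmx.
  by rewrite unitmxE det_ublock det1 mul1r -unitmxE.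
have uV' : (block_mx 1%:M 0 0 V : 'M_(1 + n)) \in unitmx.
  by rewrite unitmxE det_ublock det1 mul1r -unitmxE.
exists (block_mx 1%:M 0 0 U : 'M_(1 + n)), (block_mx 1%:M 0 0 V : 'M_(1 + n)); split=> //.
suff : block_mx 1%:M 0 0 U *m block_mx (B 0 0)%:M 0 0 C *m block_mx 1%:M 0 0 V
    = diag_mx (row_mx (B 0 0)%:M d) :> 'M_(1 + n) by [].
rewrite !mulmx_block ?(mul1mx, mul0mx, mulmx1, mulmx0) ?(addr0, add0r) UV.
rewrite diag_mx_row; congr block_mx; rewrite ?mul0mx //.
by apply/matrixP => x y; rewrite !mxE !ord1.
Qed.
End Diagonalize.

(** * Orders of torsion K[t]-modules *)

(** [P] only recombines the relations, while [Q] changes coordinates, so the generators change by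
    its inverse. *)
Lemma presents_equiv (R : comUnitRingType) (V : lmodType R) (I : V -> Prop) n
    (a : 'I_n -> V) (C D P Q : 'M_n) :
  P \in unitmx -> Q \in unitmx -> P *m C *m Q = D -> presents I a C ->
  presents I (fun i => lincomb (row i (invmx Q)) a) D.
Proof.
move=> uP uQ eD [gen rel]; split=> [v|u].
  by have [u uv] := gen v; exists (u *m Q); rewrite -lincomb_mul mulmxK.
rewrite -lincomb_mul; split=> [/rel[w ew]|[w ->]].
  by exists (w *m invmx P); rewrite -eD !mulmxA mulmxKV // -ew mulmxKV.
by apply/rel; exists (w *m P); rewrite -eD !mulmxA mulmxK.
Qed.

Section CharPolyPresentation.
Variables (K : fieldType) (N : nat) (T : 'M[K]_N).

(** Right division by X - T, carried out as in Horner's scheme; the divisor is monic of degree one,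
    so the remainder is constant. *)
Lemma char_poly_mx_division (u : 'rV[{poly K}]_N) :
  exists w (c : 'rV[K]_N), u = w *m char_poly_mx T + map_mx polyC c.
Proof.
have [n] : exists n, forall i, (size (u 0%R i) <= n)%N.
  by exists (\max_i size (u 0%R i))%N => i; apply: leq_bigmax.
elim: n u => [|n IH] u le.
  exists 0, 0; rewrite mul0mx map_mx0 addr0; apply/rowP => i; rewrite !mxE.
  by apply/eqP; rewrite -size_poly_leq0.
pose u1 : 'rV_N := \row_i \poly_(k < n) (u 0 i)`_k.+1.
pose c := \row_i (u 0 i)`_0.
have eu : u = 'X *: u1 + map_mx polyC c.
  apply/rowP => i; rewrite !mxE; apply/polyP => k; rewrite coefD coefXM coefC.
  case: k => [|k] /=; first by rewrite add0r.
  rewrite coef_poly addr0; case: ltnP => // lek.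
  by apply: nth_default; apply: leq_trans (le i) _.
have [|w [c1 ew]] := IH u1; first by move=> i; rewrite mxE size_poly.
(* X c1 = c1 (X - T) + c1 T: the first term joins the quotient, the second the remainder. *)
exists ('X *: w + map_mx polyC c1), (c1 *m T + c).
rewrite eu ew mulmxDl -scalemxAl scalerDr -!addrA; congr (_ + _).
rewrite mulmxBr mul_mx_scalar map_mxD map_mxM /=.
by rewrite addrA subrK.
Qed.

(** The hypotheses make [x] a K-basis of [V] modulo [I] on which t acts by [T]. Division of a
    relation by X - T leaves a constant relation, which freeness kills. *)
Lemma presents_char_poly_mx (V : lmodType {poly K}) (I : V -> Prop) (x : 'I_N -> V) :
  submodule I ->
  (forall v, exists c : 'rV[K]_N, I (v - lincomb (map_mx polyC c) x)) ->
  (forall c : 'rV[K]_N, I (lincomb (map_mx polyC c) x) -> c = 0) ->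
  (forall i, I ('X *: x i - lincomb (map_mx polyC (row i T)) x)) ->
  presents I x (char_poly_mx T).
Proof.
move=> subI gen free Tx; split=> [v|u]; first by have [c] := gen v; exists (map_mx polyC c).
have IT w : I (lincomb (w *m char_poly_mx T) x).
  rewrite mulmxBr mul_mx_scalar lincombB lincombZ lincomb_mul -lincombZ.
  rewrite [X in I (X - _)](_ : _ = lincomb w (fun i => 'X *: x i)).
    by apply: submod_lincomb => // i; rewrite -map_row.
  by apply: eq_bigr => i _; rewrite mxE mulrC scalerA.
split=> [|[w ->]]; last exact: IT.
have [w [c ->]] := char_poly_mx_division u.
rewrite lincombD addrC => /(submod_addr subI _ (IT w))/free ->.
by exists w; rewrite map_mx0 addr0.
Qed.
End CharPolyPresentation.

Section QPoly.
Variables (K : fieldType) (h : {poly K}).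
Hypothesis hmon : nonconst_monic h.

Lemma mk_monic_id : mk_monic h = h.
Proof. by have := mk_monic_exp hmon 0; rewrite expr1. Qed.

Lemma in_qpolyE a : (in_qpoly h a : {poly K}) = a %% h.
Proof.
rewrite /= mk_monic_id; case/andP: hmon => mh _.
by rewrite Pdiv.IdomainMonic.modpE.
Qed.

Lemma size_qpoly (u : {poly %/ h}) : (size (u : {poly K}) < size h)%N.
Proof.
apply: leq_ltn_trans (size_npoly u) _; rewrite mk_monic_id.
by case/andP: hmon => _; case: (size h).
Qed.

Lemma in_qpolyK (u : {poly %/ h}) : in_qpoly h (u : {poly K}) = u.
Proof. by apply: val_inj; rewrite [LHS]in_qpolyE modp_small // size_qpoly. Qed.

Lemma eq_in_qpoly a b : in_qpoly h a = in_qpoly h b <-> h %| a - b.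
Proof.
split=> [e|ab].
  have /(congr1 val) : in_qpoly h (a - b) = 0 by rewrite raddfB /= e subrr.
  by rewrite [LHS]in_qpolyE => /eqP.
apply/eqP; rewrite -subr_eq0 -raddfB /=; apply/eqP/val_inj.
by rewrite [LHS]in_qpolyE; apply/eqP.
Qed.

Lemma in_qpoly_eq0 a : in_qpoly h a = 0 <-> h %| a.
Proof. by have := eq_in_qpoly a 0; rewrite subr0 raddf0. Qed.

Lemma dvdp_sub_in_qpoly a : h %| a - (in_qpoly h a : {poly K}).
Proof. by apply/eq_in_qpoly; rewrite in_qpolyK. Qed.
End QPoly.

(** This brings an order within reach of [presents_det]: whatever decomposition defines it, it is
    the determinant of a presentation. *)
Lemma is_order_presents (K : fieldType) (V : lmodType {poly K}) (P : {poly K}) :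
  is_order V P -> P \is monic /\
  exists n (a : 'I_n -> V) (h : 'rV[{poly K}]_n),
    presents (fun v => v = 0) a (diag_mx h) /\ \det (diag_mx h) = P.
Proof.
move=> [n [h [phi [hmon bphi phiD phiZ ->]]]]; split.
  by apply: monic_prod => i _; case/andP: (hmon i).
pose psi (u : 'rV[{poly K}]_n) := phi (fun i => in_qpoly (h i) (u 0 i)).
have psiD : {morph psi : u v / u + v}.
  move=> u v; rewrite -phiD; congr phi; apply: functional_extensionality_dep => i.
  by rewrite mxE raddfD.
have psi0 : psi 0 = 0 by apply: (addrI (psi 0)); rewrite -psiD !addr0.
have psiZ c u : psi (c *: u) = c *: psi u.
  rewrite -phiZ; congr phi; apply: functional_extensionality_dep => i.
  by rewrite mxE rmorphM.
pose a i := psi (delta_mx 0 i).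
have psiE u : psi u = lincomb u a.
  rewrite {1}(row_sum_delta u) (big_morph psi psiD psi0).
  by apply: eq_bigr => i _; rewrite psiZ.
exists n, a, (\row_i h i); split; last by rewrite det_diag; apply: eq_bigr => i _; rewrite mxE.
have [g phiK gK] := bphi; split=> [v|u].
  exists (\row_i (g v i : {poly K})); rewrite -psiE -{1}[v]gK; apply/eqP.
  rewrite subr_eq0; apply/eqP; congr phi; apply: functional_extensionality_dep => i.
  by rewrite mxE in_qpolyK //; apply: hmon.
rewrite -psiE; split=> [/eqP|[w ->]].
  rewrite -psi0 (can_eq phiK) => /eqP e.
  have dvd i : h i %| u 0 i.
    rewrite -[u 0 i]subr0; apply/(eq_in_qpoly (hmon i)).
    by move: (congr1 (fun F => F i) e); rewrite !mxE.
  exists (\row_i (u 0 i %/ h i)); rewrite mul_mx_diag.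
  by apply/rowP => i; rewrite !mxE divpK.
rewrite -psi0; congr phi; apply: functional_extensionality_dep => i.
rewrite mul_mx_diag !mxE; apply/(eq_in_qpoly (hmon i)); rewrite subr0.
by rewrite dvdp_mull.
Qed.

Lemma is_order_exists (K : fieldType) (V : lmodType {poly K}) n (a : 'I_n -> V) C :
  presents (fun v => v = 0) a C -> \det C != 0 -> exists P, is_order V P.
Proof.
move=> prC detC; have [d [U [Q [uU uQ eD]]]] := equiv_mx_diag C.
have [b [gen rel]] : exists b, presents (fun v : V => v = 0) b (diag_mx d).
  by eexists; exact: presents_equiv uU uQ eD prC.
have d0 i : d 0 i != 0.
  have : \det (diag_mx d) != 0.
    rewrite -eD !det_mulmx !mulf_neq0 //.
      by move: uU; rewrite unitmxE; apply: contraTneq => ->; rewrite unitr0.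
    by move: uQ; rewrite unitmxE; apply: contraTneq => ->; rewrite unitr0.
  by rewrite det_diag => /prodf_neq0; apply.
have {}rel u : lincomb u b = 0 <-> forall i, d 0 i %| u 0 i.
  split=> [/rel[w ->] i|dvd]; first by rewrite mul_mx_diag mxE dvdp_mull.
  apply/rel; exists (\row_i (u 0 i %/ d 0 i)); rewrite mul_mx_diag.
  by apply/rowP => i; rewrite !mxE divpK.
(* [is_order] admits only nonconstant factors. A constant nonzero d_i kills its generator [b i], so
   these indices are dropped. *)
pose S := [set i | (1 < size (d 0%R i))%N]%SET.
pose s (k : 'I_#|S|) : 'I_n := enum_val k.
have s_inj : injective s by apply: enum_val_inj.
have b0 i : i \notin S -> b i = 0.
  rewrite inE -leqNgt => si; rewrite -lincomb_delta; apply/rel => k.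
  rewrite mxE /=; have [->|] := eqVneq k i; last by rewrite dvdp0.
  by rewrite /= dvdp1 eqn_leq si size_poly_gt0 d0.
(* [is_order] also asks for monic factors; rescaling does not change divisibility. *)
pose h k := (lead_coef (d 0 (s k)))^-1 *: d 0 (s k).
have hd k : h k %= d 0 (s k) by apply: eqp_scale; rewrite invr_eq0 lead_coef_eq0.
have hmon k : nonconst_monic (h k).
  rewrite /nonconst_monic (eqp_size (hd k)); have := enum_valP k; rewrite inE => ->.
  by rewrite monicE lead_coefZ mulVf ?eqxx ?lead_coef_eq0.
pose phi (u : forall k, {poly %/ h k}) : V := \sum_k (u k : {poly K}) *: b (s k).
have lin (c : 'I_#|S| -> {poly K}) :
    \sum_k c k *: b (s k) = lincomb (\sum_k c k *: delta_mx 0 (s k)) b.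
  have -> : lincomb (\sum_k c k *: delta_mx 0 (s k)) b
      = \sum_k lincomb (c k *: delta_mx 0 (s k)) b.
    by apply: (big_morph (fun u => lincomb u b)) => [u v|]; rewrite ?lincombD ?lincomb0.
  by apply: eq_bigr => k _; rewrite lincombZ lincomb_delta.
have ker (c : 'I_#|S| -> {poly K}) : \sum_k c k *: b (s k) = 0 <-> forall k, h k %| c k.
  rewrite lin rel; split=> [dvd k|dvd i].
    rewrite (eqp_dvdl _ (hd k)); have := dvd (s k); rewrite summxE (bigD1 k) //=.
    rewrite !mxE !eqxx mulr1 big1 ?addr0 // => k' kk'.
    by rewrite !mxE /= (inj_eq s_inj) eq_sym (negPf kk') mulr0.
  rewrite summxE; apply: (big_ind (fun x => d 0 i %| x)) => [|x y|k _];
    [exact: dvdp0|exact: dvdp_add|].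
  rewrite !mxE /=; case: eqP => [->|_]; last by rewrite mulr0 dvdp0.
  by rewrite mulr1 -(eqp_dvdl _ (hd k)).
exists (\prod_k h k), #|S|, h, phi; split=> // [||a0 u]; last first.
- rewrite scaler_sumr; apply/eqP; rewrite -subr_eq0 -sumrB; apply/eqP.
  under eq_bigr do rewrite scalerA -scalerBl.
  apply/ker => k; rewrite -dvdpNr opprB.
  apply/(eq_in_qpoly (hmon k)); rewrite [RHS]in_qpolyK // [LHS]rmorphM.
  by congr (_ * _); exact: in_qpolyK.
- by move=> u v; rewrite -big_split; apply: eq_bigr => k _; exact: scalerDl.
have surj v : exists u, phi u = v.
  have [u] := gen v; move/eqP; rewrite subr_eq0 => /eqP ->.
  exists (fun k => in_qpoly (h k) (u 0 (s k))).
  transitivity (\sum_k u 0 (s k) *: b (s k)).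
    apply/eqP; rewrite -subr_eq0 -sumrB; apply/eqP.
    under eq_bigr do rewrite -scalerBl.
    by apply/ker => k; rewrite -dvdpNr opprB dvdp_sub_in_qpoly.
  rewrite /lincomb (bigID (mem S)) /= [X in _ = _ + X]big1 => [|i iS]; last first.
    by rewrite b0 // scaler0.
  by rewrite addr0 [RHS]big_enum_val.
have [g gK] := choice surj; exists g => // u.
have /eqP := gK (phi u); rewrite -subr_eq0 -sumrB => /eqP.
under eq_bigr do rewrite -scalerBl.
move/ker => dvd; apply: functional_extensionality_dep => k.
by rewrite -[LHS](in_qpolyK (hmon k)) -[RHS](in_qpolyK (hmon k)); apply/eq_in_qpoly.
Qed.

(** * The pairing of the t-motive with points *)

Section TwistedDivision.
Variables (H : fieldType) (s : {rmorphism H -> H}).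
Implicit Types p q d : tpoly s.

Local Notation tsize p := (size (p : {poly H})).

Lemma iter_rmorph_eq0 i x : (iter i s x == 0) = (x == 0).
Proof. by elim: i => //= i <-; rewrite fmorph_eq0. Qed.

Lemma coef_iter_tshift i (p : {poly H}) n :
  (iter i (tshift s) p)`_n = if (n < i)%N then 0 else iter i s p`_(n - i).
Proof.
elim: i n => [|i IH] n /=; first by rewrite subn0.
rewrite coefMX; case: n => [|n] //=; rewrite coef_map /= IH ltnS subSS.
by case: ltnP => // _; rewrite rmorph0.
Qed.

Lemma tpolyXM_iter i p : tpolyX s ^+ i * p = iter i (tshift s) (p : {poly H}).
Proof. by elim: i => [|i IH]; rewrite ?expr0 ?mul1r // exprS -mulrA mul_tpolyX IH. Qed.

Lemma tpoly_divr p d : d != 0 -> exists q r, p = q * d + r /\ (tsize r < tsize d)%N.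
Proof.
move=> d0; have sd : (0 < tsize d)%N by rewrite size_poly_gt0.
have [n] := ubnP (tsize p); elim: n => // n IH in p *; rewrite ltnS => lep.
have [lt|ge] := ltnP (tsize p) (tsize d).
  by exists 0, p; rewrite mul0r add0r.
pose k := (tsize p - tsize d)%N.
(* Moving X^k past the leading coefficient of [d] applies s^k to it, hence the twist in the
   denominator, which is nonzero because [s] is injective. *)
pose c := lead_coef (p : {poly H}) / iter k s (lead_coef (d : {poly H})).
pose q := tpolyC s c * tpolyX s ^+ k.
have [|q' [r [e lt]]] := IH (p - q * d); last first.
  by exists (q + q'), r; rewrite mulrDl -addrA -e subrKC.
apply: leq_trans lep.
have sp : (0 < tsize p)%N by apply: leq_trans ge.
rewrite -[X in (_ < X)%N](prednK sp) ltnS; apply/leq_sizeP => i lei.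
have -> : (p - q * d : {poly H})`_i = (p : {poly H})`_i - (q * d : {poly H})`_i.
  exact: coefB.
rewrite /q -mulrA mul_tpolyC tpolyXM_iter coefZ coef_iter_tshift.
have [ei|ni] := eqVneq i (tsize p).-1.
  have ki : (k <= i)%N by rewrite ei /k -subn1 leq_sub2l.
  have -> : (i - k)%N = (tsize d).-1.
    by rewrite ei /k -!subn1 subnAC subKn.
  rewrite ltnNge ki /= -lead_coefE ei -lead_coefE divfK ?subrr //.
  by rewrite iter_rmorph_eq0 lead_coef_eq0.
have lti : (tsize p <= i)%N by rewrite -(prednK sp) ltn_neqAle eq_sym ni.
rewrite nth_default // sub0r; apply/eqP; rewrite oppr_eq0 mulf_eq0.
case: ltnP => [_|_]; first by rewrite eqxx orbT.
rewrite iter_rmorph_eq0; apply/orP; right; apply/eqP; apply: nth_default.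
have -> : tsize d = (tsize p - k)%N by rewrite subKn.
by rewrite leq_sub2r.
Qed.

Lemma tevalCl c p x : teval (tpolyC s c * p) x = c * teval p x.
Proof. by rewrite mul_tpolyC; exact: (sactZl (V := H^o)). Qed.
End TwistedDivision.

Section RationalRelations.
Variables (k H : fieldType) (tau sigma : {rmorphism H -> H}) (iota : {rmorphism k -> H}).
Hypotheses (tauK : cancel tau sigma) (sigmaK : cancel sigma tau).
Hypothesis tau_fix : forall x, tau x = x -> exists c, x = iota c.

(* Artin's argument: if h is normalised to have an entry 1, then h - tau h is a
   relation with smaller support. *)
Lemma rational_relations (J : finType) (S : Type) (b : S -> J -> H) (Q : (J -> H) -> Prop) :
  (forall s, exists s', forall z, tau (b s z) = b s' z) ->
  (forall x u v, Q u -> Q v -> Q (fun z => x * u z + v z)) ->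
  (forall c : J -> k, (forall s, \sum_z iota (c z) * b s z = 0) -> Q (fun z => iota (c z))) ->
  forall h, (forall s, \sum_z h z * b s z = 0) -> Q h.
Proof.
move=> shift QL Qc.
have Q0 : Q (fun=> 0).
  have -> : (fun=> 0) = (fun _ : J => iota 0) by apply/funext => z; rewrite rmorph0.
  by apply: (Qc (fun=> 0)) => s; rewrite big1 // => z _; rewrite rmorph0 mul0r.
move=> h; have [n] := ubnP #|[pred z | h z != 0]|.
elim: n => // n IH in h *; rewrite ltnS => len hrel.
case: (pickP [pred z | h z != 0]) => [z0 hz0|h0]; last first.
  by rewrite (_ : h = fun=> 0) //; apply/funext => z; apply/eqP/negbFE/h0.
pose g z := h z / h z0.
have supp (u : J -> H) z1 : h z1 != 0 -> u z1 = 0 -> (forall z, h z = 0 -> u z = 0) ->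
    (#|[pred z | u z != 0%R]| < n)%N.
  move=> hz1 uz1 hu; apply: leq_trans len; apply: proper_card; apply/properP; split.
    apply/fintype.subsetP => z; rewrite !inE; apply: contraNneq => /hu ->.
    by rewrite eqxx.
  by exists z1; rewrite !inE // uz1 eqxx.
have relL x (u v : J -> H) s : \sum_z (x * u z + v z) * b s z
    = x * (\sum_z u z * b s z) + \sum_z v z * b s z.
  by rewrite mulr_sumr -big_split; apply: eq_bigr => z _; rewrite mulrDl mulrA.
have grel s : \sum_z g z * b s z = 0.
  transitivity ((h z0)^-1 * \sum_z h z * b s z); last by rewrite hrel mulr0.
  by rewrite mulr_sumr; apply: eq_bigr => z _; rewrite /g mulrA [_^-1 * _]mulrC.
suff Qg : Q g.
  rewrite (_ : h = fun z => h z0 * g z + 0); first exact: (QL (h z0) g (fun=> 0)).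
  by apply/funext => z; rewrite addr0 /g mulrC divfK.
have gh z : h z = 0 -> g z = 0 by rewrite /g => ->; rewrite mul0r.
(* The twist [sigma] is there because [shift] goes forward only: tau of the relation for g' at [s]
   is the relation for [g] at [s'] minus tau of the relation for [g] at [s]. *)
pose g' z := sigma (g z - tau (g z)).
have g'h z : h z = 0 -> g' z = 0 by rewrite /g' => /gh ->; rewrite rmorph0 subrr rmorph0.
have g'rel s : \sum_z g' z * b s z = 0.
  apply: (can_inj tauK); rewrite rmorph0 rmorph_sum /=; have [s' bs'] := shift s.
  transitivity (\sum_z g z * b s' z - tau (\sum_z g z * b s z)); last first.
    by rewrite !grel rmorph0 subr0.
  rewrite [in RHS]rmorph_sum -sumrB; apply: eq_bigr => z _.
  by rewrite [LHS]rmorphM [in RHS]rmorphM /= /g' sigmaK bs' mulrBl.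
have g'z0 : g' z0 = 0 by rewrite /g' /g divff // rmorph1 subrr rmorph0.
case: (pickP [pred z | g' z != 0]) => [z1 g'z1|g'0].
  have hz1 : h z1 != 0 by apply: contraNneq g'z1 => /g'h ->.
  (* g' vanishes at z0 and g2 at z1, so both have smaller support than [h], and [g] is a combination
     of them. *)
  pose g2 z := - (g z1 / g' z1) * g' z + g z.
  rewrite (_ : g = fun z => g z1 / g' z1 * g' z + g2 z); last first.
    by apply/funext => z; rewrite /g2 mulNr addNKr.
  apply: QL; apply: IH => //; first exact: supp g'z0 g'h.
    apply: (supp _ z1) => //; first by rewrite /g2 mulNr divfK // addNr.
    by move=> z hz; rewrite /g2 (gh _ hz) (g'h _ hz) mulr0 addr0.
  by move=> s; rewrite relL g'rel mulr0 add0r.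
have /choice[c gc] : forall z, exists c, g z = iota c.
  move=> z; apply: tau_fix; apply/eqP; rewrite eq_sym -subr_eq0; apply/eqP.
  by rewrite -[LHS]sigmaK [sigma _](eqP (negbFE (g'0 z))) rmorph0.
rewrite (_ : g = fun z => iota (c z)); last exact/funext.
by apply: Qc => s; rewrite -[RHS](grel s); apply: eq_bigr => z _; rewrite gc.
Qed.
End RationalRelations.

Section Pairing.
Variables (k H : fieldType) (tau sigma : {rmorphism H -> H}) (iota : {rmorphism k -> H}).
Hypotheses (tauK : cancel tau sigma) (sigmaK : cancel sigma tau).
Hypothesis tau_iota : forall c, tau (iota c) = iota c.
Hypothesis tau_fix : forall x, tau x = x -> exists c, x = iota c.
Variables (l : nat) (E : {rmorphism {poly k} -> 'M[tpoly tau]_l}).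
Hypothesis EC : forall c, E c%:P = (tpolyC tau (iota c))%:M.

Local Notation M := (motive E).
Local Notation W := (points E).

Definition pair (m : M) (x : W) : H := tact (m : 'rV_l) x 0 0.

Lemma pairE m x : pair m x = \sum_i teval (m 0 i) (x i 0).
Proof. by rewrite /pair mxE. Qed.
Lemma pairDl m m' x : pair (m + m') x = pair m x + pair m' x.
Proof. by rewrite /pair tactDl mxE. Qed.
Lemma pairDr m x y : pair m (x + y) = pair m x + pair m y.
Proof. by rewrite /pair tactDr mxE. Qed.
Lemma pair0l x : pair 0 x = 0.
Proof. by apply: (addrI (pair 0 x)); rewrite -pairDl !addr0. Qed.
Lemma pair0r m : pair m 0 = 0.
Proof. by apply: (addrI (pair m 0)); rewrite -pairDr !addr0. Qed.
Lemma pairNl m x : pair (- m) x = - pair m x.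
Proof. by apply: (addrI (pair m x)); rewrite -pairDl !subrr pair0l. Qed.
Lemma pairBl m m' x : pair (m - m') x = pair m x - pair m' x.
Proof. by rewrite pairDl pairNl. Qed.
Lemma pair_suml I (r : seq I) (P : pred I) F x :
  pair (\sum_(i <- r | P i) F i) x = \sum_(i <- r | P i) pair (F i) x.
Proof. by apply: (big_morph (pair^~ x)) => [m m'|]; rewrite ?pairDl ?pair0l. Qed.
Lemma pair_sumr I (r : seq I) (P : pred I) F m :
  pair m (\sum_(i <- r | P i) F i) = \sum_(i <- r | P i) pair m (F i).
Proof. by apply: (big_morph (pair m)) => [x y|]; rewrite ?pairDr ?pair0r. Qed.
Lemma pair_mul m a x : pair (m *m E a) x = pair m (a *: x).
Proof. by rewrite /pair tactM. Qed.

Lemma motive_scaleCE c (m : M) : (c%:P *: m : M) = tpolyC tau c *: (m : 'rV_l).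
Proof. exact: motive_scaleC. Qed.

Lemma pairCl c m x : pair (c%:P *: m) x = c * pair m x.
Proof.
rewrite motive_scaleCE !pairE mulr_sumr; apply: eq_bigr => i _.
by rewrite mxE tevalCl.
Qed.
Lemma motive_scaleXE (m : M) : 'X *: m = (m *m E 'X : M).
Proof.
rewrite -[X in X *: _]mul1r [LHS]motive_scaleMX.
exact: (scale1r (m *m E 'X : M)).
Qed.
Lemma pair_scaleX m x : pair ('X *: m) x = pair m ('X *: x).
Proof. by rewrite motive_scaleXE pair_mul. Qed.
Lemma pair_scaleXn n m x : pair ('X^n *: m) x = pair m ('X^n *: x).
Proof.
elim: n m x => [|n IH] m x; first by rewrite expr0 !scale1r.
by rewrite exprS -!scalerA pair_scaleX IH scalerA -exprSr exprS -scalerA.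
Qed.
Lemma pair_scale (a : {poly H}) m x :
  pair (a *: m) x = \sum_(i < size a) a`_i * pair m ('X^i *: x).
Proof.
rewrite -{1}[a]coefK poly_def scaler_suml pair_suml; apply: eq_bigr => i _.
by rewrite -mul_polyC -scalerA pairCl pair_scaleXn.
Qed.

Lemma points_scaleC c (x : W) : (c%:P *: x : W) = iota c *: (x : 'cV_l).
Proof.
rewrite [LHS]/(tact _ _) EC; apply/colP => i; rewrite !mxE (bigD1 i) //= mxE eqxx.
rewrite big1 ?addr0 => [|i' ii']; last by rewrite mxE eq_sym (negPf ii') teval0l.
by rewrite mulr1n -[tpolyC _ _]mulr1 tevalCl teval1.
Qed.
Lemma pairCr c m x : pair m (c%:P *: x) = iota c * pair m x.
Proof.
by rewrite -pair_mul -(motive_scaleE _ _ EC tau_iota) map_polyC pairCl.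
Qed.
Lemma pair_map_scale a m x : pair (map_poly iota a *: m) x = pair m (a *: x).
Proof. by rewrite (motive_scaleE _ _ EC tau_iota) pair_mul. Qed.

Lemma tau_pair m x : tau (pair m x) = pair (tpolyX tau *: (m : 'rV_l)) x.
Proof.
rewrite !pairE rmorph_sum; apply: eq_bigr => i _; rewrite mxE tevalM.
rewrite /= [RHS](_ : _ = tau (teval (m 0 i) (x i 0))) //.
rewrite {1}/teval size_polyX !big_ord_recl big_ord0 /tcoef !coefX /=.
by rewrite mul0r mul1r add0r addr0.
Qed.

Lemma pair_delta i x : pair (delta_mx 0 i) x = x i 0.
Proof.
rewrite pairE (bigD1 i) //= mxE !eqxx teval1 big1 ?addr0 // => i' ii'.
by rewrite mxE (negPf ii') andbF teval0l.
Qed.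

(** Applying tau to a value of the pairing amounts to multiplying [m] by tau, so the system of
    relations is stable under tau and descends to k. Over k, testing against unit row vectors gives
    relations between the points themselves. *)
Lemma pair_indep N (x : 'I_N -> W) :
  (forall c : 'I_N -> k, \sum_i (c i)%:P *: x i = 0 -> forall i, c i = 0) ->
  forall h : 'I_N -> H, (forall m, \sum_i h i * pair m (x i) = 0) -> forall i, h i = 0.
Proof.
move=> free; apply: (rational_relations tauK sigmaK tau_fix) => [m|y u v u0 v0 i|c cx i].
- by exists (tpolyX tau *: (m : 'rV_l)) => i; exact: tau_pair.
- by rewrite u0 v0 mulr0 addr0.
rewrite free ?rmorph0 //; apply/colP => a; rewrite -!pair_delta pair_sumr pair0r.
by rewrite -[RHS](cx (delta_mx 0 a)); apply: eq_bigr => i' _; rewrite pairCr.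
Qed.

(** The evaluation matrix grows one row at a time: as long as its rank is below N, its columns
    satisfy a relation over H, and [pair_indep] supplies a row vector that breaks it. *)
Lemma pair_surj N (x : 'I_N -> W) :
  (forall c : 'I_N -> k, \sum_i (c i)%:P *: x i = 0 -> forall i, c i = 0) ->
  forall v : 'I_N -> H, exists m, forall i, pair m (x i) = v i.
Proof.
move=> free.
have ranks r : (r <= N)%N -> exists (n : nat) (m : 'I_n -> M),
    \rank (\matrix_(a, i) pair (m a) (x i)) = r.
  elim: r => [|r IH] ltr; first by exists 0%N, (fun=> 0); rewrite flatmx0 mxrank0.
  have [n' [m rk]] := IH (ltnW ltr); set G := \matrix_(a, i) _ in rk.
  have /rowV0Pn[h hk h0] : kermx G^T != 0.
    by rewrite -mxrank_eq0 mxrank_ker mxrank_tr rk subn_eq0 -ltnNge.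
  have [m0 hm0] : exists m0, \sum_i h 0 i * pair m0 (x i) != 0.
    apply: contrapT => nex; case/eqP: h0; apply/rowP => i; rewrite mxE.
    apply: (pair_indep free (h := fun i => h 0 i)) => m0; apply/eqP/negPn/negP => ?.
    by apply: nex; exists m0.
  pose row0 : 'rV_N := \row_i pair m0 (x i).
  have nsub : ~~ (row0 <= G)%MS.
    apply: contra hm0 => /submxP[D eD].
    have : row0 *m h^T = 0.
      rewrite eD -mulmxA [G *m _](_ : _ = 0) ?mulmx0 //; apply: trmx_inj.
      by rewrite trmx_mul trmxK trmx0; apply/sub_kermxP.
    move/matrixP/(_ 0 0); rewrite !mxE => e0.
    by apply/eqP; rewrite -[RHS]e0; apply: eq_bigr => i _; rewrite !mxE mulrC.
  exists (1 + n')%N, (fun a => if fintype.split a is inr b then m b else m0).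
  have -> : \matrix_(a, i) pair (if fintype.split a is inr b then m b else m0) (x i)
      = col_mx row0 G.
    by apply/matrixP => a i; rewrite !mxE; case: fintype.split => b; rewrite !mxE.
  apply/eqP; rewrite -addsmxE eqn_leq -{2}rk; apply/andP; split; last first.
    apply: rank_ltmx; rewrite ltmxE addsmxSr /=.
    by apply: contra nsub; apply: submx_trans; exact: addsmxSl.
  rewrite -rk; apply: leq_trans (mxrank_adds_leqif _ _).1 _.
  by rewrite -(add1n (\rank G)) leq_add2r rank_leq_row.
have [n' [m rk]] := ranks N (leqnn N) => v.
have /submxP[D eD] : (\row_i v i <= \matrix_(a, i) pair (m a) (x i))%MS.
  by apply: submx_full; rewrite /row_full rk.
exists (\sum_a (D 0 a)%:P *: m a) => i; move/rowP/(_ i): eD; rewrite !mxE => ->.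
by rewrite pair_suml; apply: eq_bigr => a _; rewrite pairCl mxE.
Qed.
End Pairing.

Section PerfectPairing.
Variables (k H : fieldType) (tau sigma : {rmorphism H -> H}) (iota : {rmorphism k -> H}).
Hypotheses (tauK : cancel tau sigma) (sigmaK : cancel sigma tau).
Hypothesis tau_iota : forall c, tau (iota c) = iota c.
Hypothesis tau_fix : forall x, tau x = x -> exists c, x = iota c.
Variables (l : nat) (E : {rmorphism {poly k} -> 'M[tpoly tau]_l}).
Hypothesis EC : forall c, E c%:P = (tpolyC tau (iota c))%:M.

Local Notation M := (motive E).
Local Notation W := (points E).

(* The quotient of row vectors by eta is spanned by as many vectors as the
   diagonal degrees predict, which turns surjectivity of the evaluation at w into
   injectivity. *)
Lemma pair_kernel (eta U V : 'M[tpoly tau]_l) (d : 'rV_l) N (w : 'I_N -> W) :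
  mx_invertible U -> mx_invertible V -> U *m eta *m V = diag_mx d ->
  (forall i, d 0 i != 0) -> N = (\sum_i (size (d 0%R i : {poly H})).-1)%N ->
  (forall i, tact eta (w i) = 0) ->
  (forall v : 'I_N -> H, exists m : M, forall i, pair m (w i) = v i) ->
  forall m : M, (forall i, pair m (w i) = 0) -> exists g : 'rV_l, m = g *m eta.
Proof.
move=> _ [V' [VV' V'V]] eD d0 eN etaw surj.
pose J := {c : 'I_l & 'I_((size (d 0%R c : {poly H})).-1)}.
have cJ : #|{: J}| = N.
  by rewrite eN card_tagged sumnE big_map big_enum; apply: eq_bigr => c _; rewrite card_ord.
pose idx (z : J) : nat := tagged z.
(* Right division of each entry of m V by d_c leaves these monomials; the inverse of [V] carries
   them back. *)
pose b (z : J) : M := (tpolyX tau ^+ idx z *: delta_mx 0 (tag z)) *m V'.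
have span (m : M) : exists g (h : J -> H),
    m = g *m eta + \sum_z tpolyC tau (h z) *: (b z : 'rV_l).
  have /choice[q /choice[r qr]] c := tpoly_divr ((m *m V) 0 c) (d0 c).
  exists ((\row_c q c) *m U), (fun z => tcoef (r (tag z)) (idx z)).
  have -> : m = m *m V *m V' by rewrite -mulmxA VV' mulmx1.
  have -> : m *m V = (\row_c q c) *m diag_mx d
      + \sum_(z : J) tpolyC tau (tcoef (r (tag z)) (idx z)) *:
          (tpolyX tau ^+ idx z *: delta_mx 0 (tag z)).
    apply/rowP => c; rewrite (qr c).1 [RHS]mxE mul_mx_diag; congr (_ + _); first by rewrite !mxE.
    rewrite summxE (eq_bigr (fun z : J => if tag z == c then
      tpolyC tau (tcoef (r (tag z)) (idx z)) * tpolyX tau ^+ idx z else 0)); last first.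
      move=> z _; rewrite !mxE eqxx /= eq_sym; case: eqP => _; last by rewrite !mulr0.
      by rewrite mulr1.
    transitivity (\sum_c' \sum_(i < (size (d 0%R c' : {poly H})).-1) if c' == c then
      tpolyC tau (tcoef (r c') i) * tpolyX tau ^+ i else 0); last by rewrite sig_big_dep.
    rewrite (bigD1 c) //= eqxx [X in _ + X]big1 ?addr0 => [|c' /negPf cc']; last first.
      by rewrite cc' big1.
    rewrite [LHS]tpoly_def; have := (qr c).2.
    have sd : (0 < size (d 0%R c : {poly H}))%N by rewrite size_poly_gt0.
    rewrite -{1}(prednK sd) ltnS => le.
    rewrite (big_ord_widen _ (fun i => tpolyC tau (tcoef (r c) i) * tpolyX tau ^+ i) le).
    rewrite big_mkcond; apply: eq_bigr => i _; case: ltnP => // lei.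
    by rewrite /tcoef nth_default // rmorph0 mul0r.
  rewrite mulmxDl -eD -!mulmxA VV' mulmx1; congr (_ + _).
  by rewrite mulmx_suml; apply: eq_bigr => z _; rewrite -scalemxAl.
pose G := \matrix_(a < #|{: J}|, i < N) pair (b (enum_val a)) (w i).
have pairG (g : 'rV_l) (h : J -> H) i :
    pair (g *m eta + \sum_z tpolyC tau (h z) *: (b z : 'rV_l) : M) (w i)
    = ((\row_a h (enum_val a)) *m G) 0 i.
  rewrite pairDl {1}/pair tactM etaw.
  have -> : tact g 0 = 0 :> 'cV_1 by apply: (addrI (tact g 0)); rewrite -tactDr !addr0.
  rewrite mxE add0r pair_suml mxE.
  rewrite (reindex (@enum_val _ {: J})) /=; last exact/onW_bij/enum_val_bij.
  by apply: eq_bigr => a _; rewrite !mxE -pairCl motive_scaleCE.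
have full : row_full G.
  rewrite -sub1mx; apply/row_subP => i; rewrite row1.
  have [m mi] := surj (fun i' => (i' == i)%:R); have [g [h em]] := span m.
  apply/submxP; exists (\row_a h (enum_val a)); apply/rowP => i'.
  by rewrite mxE eqxx /= -mi em pairG.
(* The dimension count [cJ] makes [G] square, so surjectivity gives injectivity. *)
have free : row_free G by move: full; rewrite /row_full /row_free => /eqP ->; rewrite cJ.
move=> m mw; have [g [h em]] := span m; exists g.
have : (\row_a h (enum_val a)) *m G = 0.
  by apply/rowP => i; rewrite -(pairG g) -em mw mxE.
rewrite -(mul0mx _ G) => /(row_free_inj free)/rowP h0.
rewrite em big1 ?addr0 // => z _.
by have := h0 (enum_rank z); rewrite !mxE enum_rankK => ->; rewrite rmorph0 scale0r.
Qed.

(** Perfectness of the pairing of M/aM with E[a], expressed through a family spanning E[a] over k: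
    evaluation at it maps M onto H^N with kernel aM. Surjectivity forces the family to be
    independent. *)
Definition perfect (a : {poly k}) : Prop :=
  exists N (w : 'I_N -> W), [/\ forall i, a *: w i = 0,
    forall x : W, a *: x = 0 -> exists c : 'rV[k]_N, x = lincomb (map_mx polyC c) w,
    forall v : 'I_N -> H, exists m : M, forall i, pair m (w i) = v i
  & forall m : M, (forall i, pair m (w i) = 0) -> exists g, m = map_poly iota a *: g].

Lemma full_dimension_perfect a :
  full_dimension iota (E a) [set x | tact (E a) x = 0] -> perfect a.
Proof.
move=> [U [V [d [invU invV eD d0 [w [aw wbasis]]]]]].
have gen (x : W) : a *: x = 0 -> exists c : 'rV[k]_(\sum_i (size (d 0%R i : {poly H})).-1),
    x = lincomb (map_mx polyC c) (w : _ -> W).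
  move=> /wbasis[c [-> _]]; exists c.
  by apply: eq_bigr => i _; rewrite mxE (points_scaleC EC).
have surj : forall v, exists m : M, forall i, pair m (w i : W) = v i.
  apply: (@pair_surj _ _ _ _ _ tauK sigmaK tau_iota tau_fix _ _ EC) => c c0 i.
  have [|z [_ uniq]] := wbasis 0.
    by rewrite /= -[LHS]/(a *: (0 : W)) scaler0.
  have e1 : z = \row_i c i.
    by apply: uniq; rewrite -[LHS]c0; apply: eq_bigr => i' _; rewrite mxE (points_scaleC EC).
  have e2 : z = 0.
    by apply: uniq; rewrite big1 // => i' _; rewrite mxE rmorph0 scale0r.
  by have := congr1 (fun u : 'rV_ _ => u 0 i) e1; rewrite e2 !mxE.
exists _, w; split=> // m mw.
have [g ->] := pair_kernel invU invV eD d0 (erefl _) aw surj mw.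
by exists g; rewrite (motive_scaleE _ _ EC tau_iota).
Qed.

Lemma pair_map_polyC (m : M) N (c : 'rV[k]_N) (w : 'I_N -> W) :
  pair m (lincomb (map_mx polyC c) w) = \sum_i iota (c 0 i) * pair m (w i).
Proof. by rewrite pair_sumr; apply: eq_bigr => i _; rewrite mxE (pairCr tau_iota EC). Qed.

Lemma perfect_kernel a (m : M) : perfect a ->
  (forall x, a *: x = 0 -> pair m x = 0) <-> exists g, m = map_poly iota a *: g.
Proof.
move=> [N [w [aw _ _ ker]]]; split=> [m0|[g ->] x ax].
  by apply: ker => i; apply: m0.
by rewrite (pair_map_scale tau_iota EC) ax pair0r.
Qed.

(* Dual to the injectivity of multiplication by p from M/aM to M/paM. *)
Lemma perfect_divisible p a (x : W) :
  (forall m : M, map_poly iota p *: m = 0 -> m = 0) ->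
  perfect a -> perfect (p * a) -> a *: x = 0 -> exists y, p *: y = x.
Proof.
move=> tf perfa; have kera := fun m => perfect_kernel m perfa.
move: perfa => [N [w [aw gen surj _]]].
move=> perfpa; have kerpa := fun m => perfect_kernel m perfpa.
move: perfpa => [N' [w' [paw' gen' _ _]]].
(* [G] is the matrix of multiplication by [p] from E[pa] to E[a]; the claim is its surjectivity. *)
have [i|G eG] := @rows_choice k N' N (fun i u => p *: w' i = lincomb (map_mx polyC u) w).
  by apply: gen; rewrite scalerA mulrC.
have pgen c : p *: lincomb (map_mx polyC c) w' = lincomb (map_mx polyC (c *m G)) w.
  rewrite map_mxM lincomb_mul scaler_sumr; apply: eq_bigr => i _.
  by rewrite -map_row -eG !scalerA mulrC.
have [full|nfull] := boolP (row_full G).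
  move=> /gen[c ->]; have /submxP[D ->] := submx_full c full.
  by exists (lincomb (map_mx polyC D) w'); rewrite pgen.
have : cokermx G != 0.
  apply: contra nfull; rewrite -mxrank_eq0 mxrank_coker subn_eq0 => le.
  by rewrite /row_full eqn_leq le rank_leq_col.
(* A nonzero column of the cokernel is a linear form on E[a] that vanishes on p E[pa]; [f] realises
   it in M. *)
case/matrix0Pn=> [i0 [j0 hn0]]; pose h i := cokermx G i j0.
have [f fw] := surj (fun i => iota (h i)).
have /kerpa[g] : forall y, (p * a) *: y = 0 -> pair (map_poly iota p *: f) y = 0.
  move=> y /gen'[c ->]; rewrite (pair_map_scale tau_iota EC) pgen pair_map_polyC.
  transitivity (iota ((c *m G *m cokermx G) 0 j0)).
    rewrite mxE rmorph_sum; apply: eq_bigr => i _.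
    by rewrite rmorphM fw.
  by rewrite -mulmxA mulmx_coker mulmx0 mxE rmorph0.
(* p f kills E[pa], hence equals p a g; cancelling p gives f = a g, which vanishes on E[a] although
   the form is nonzero. *)
rewrite rmorphM -scalerA => /eqP; rewrite -subr_eq0 -scalerBr => /eqP/tf/eqP.
rewrite subr_eq0 => /eqP fg.
have /kera/(_ (w i0) (aw i0)) : exists g, f = map_poly iota a *: g by exists g.
by rewrite fw => /eqP; rewrite fmorph_eq0 /h (negPf hn0).
Qed.
End PerfectPairing.

(** * Bases of the Tate module *)

Section TateBasis.
Variables (K : fieldType) (p : {poly K}) (hp : nonconst_monic p).
Variable V : lmodType {poly K}.
Hypothesis divisible : forall m (x : V), p ^+ m.+1 *: x = 0 -> exists y, p *: y = x.

Local Notation Tp := (tate V hp).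

Lemma nonconst_monic_exp m : nonconst_monic (p ^+ m.+1).
Proof.
have := hp => /andP[mp sp]; rewrite /nonconst_monic monic_exp //=.
by rewrite -mk_monic_exp //; exact: size_mk_monic_gt1.
Qed.

Lemma nonconst_monic_neq0 : p != 0.
Proof. by case/andP: hp => /monic_neq0. Qed.

Lemma tate_surj m (x : V) : p ^+ m.+1 *: x = 0 -> exists X : Tp, X m = x.
Proof.
move=> px.
(* Division by [p] becomes a total function in order to be iterated; the value 0 off the p-power
   torsion is never met. *)
have exD : forall x : V, exists y : V, (exists m, p ^+ m.+1 *: x = 0) -> p *: y = x.
  move=> y; have [[m' e]|n] := pselect (exists m, p ^+ m.+1 *: y = 0).
    by have [z <-] := divisible e; exists z.
  by exists 0 => /n.
have [D pD] := choice exD.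
have torsD i : exists m, p ^+ m.+1 *: iter i D x = 0.
  elim: i => [|i [m' IH]]; first by exists m.
  by exists m'.+1; rewrite exprSr -scalerA /= pD //; exists m'.
(* With truncated subtraction this multiplies [x] by powers of [p] below level [m] and divides it
   above. *)
pose X i := p ^+ (m - i) *: iter (i - m) D x.
have XS i : p *: X i.+1 = X i.
  rewrite /X; have [le|lt] := leqP m i.
    rewrite subSn // (_ : m - i = 0)%N; last by apply/eqP; rewrite subn_eq0.
    by rewrite (_ : m - i.+1 = 0)%N ?scale1r /= ?pD //; apply/eqP; rewrite subn_eq0 leqW.
  rewrite (_ : i.+1 - m = 0)%N; last by apply/eqP; rewrite subn_eq0.
  rewrite (_ : i - m = 0)%N; last by apply/eqP; rewrite subn_eq0 ltnW.
  by rewrite scalerA -exprS -subSn.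
have pX i : p ^+ i.+1 *: X i = 0.
  elim: i => [|i IH]; last by rewrite exprSr -scalerA XS.
  by rewrite /X sub0n subn0 scalerA -exprD add1n.
by exists (Tate hp (fun i => conj (pX i) (XS i))); rewrite /= /X subnn scale1r.
Qed.

(** The quotient is the sequence shifted by m + 1; the vanishing of [X m] is exactly what gives its
    entries the right torsion. *)
Lemma tate_shift m (X : Tp) : X m = 0 -> exists Y : Tp, forall i, X i = p ^+ m.+1 *: Y i.
Proof.
move=> Xm.
have shift (j i : nat) : p ^+ j *: X (i + j)%N = X i.
  elim: j => [|j IH]; first by rewrite scale1r addn0.
  by rewrite exprSr -scalerA addnS tate_step.
have pY i : p ^+ i.+1 *: X (i + m.+1)%N = 0 /\ p *: X (i.+1 + m.+1)%N = X (i + m.+1)%N.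
  by rewrite addSn tate_step -addSnnS addnC shift.
by exists (Tate hp pY) => i /=; rewrite shift.
Qed.

Lemma tate_sumE m n (F : 'I_n -> Tp) : (\sum_i F i : Tp) m = \sum_i F i m.
Proof. exact: (big_morph (fun X : Tp => X m)). Qed.

(** A basis of V[p^(m+1)] over K[t]/p^(m+1), with coefficients kept in K[t] and freeness expressed
    by divisibility. *)
Definition level_basis m s (v : 'I_s -> V) : Prop :=
  [/\ forall i, p ^+ m.+1 *: v i = 0,
      forall x, p ^+ m.+1 *: x = 0 -> exists a, x = lincomb a v
    & forall a, lincomb a v = 0 -> forall i, p ^+ m.+1 %| a 0 i].

(** A relation at level [m] lifts to an element vanishing there, hence to a multiple of p^(m+1) by
    [tate_shift]; uniqueness of coordinates passes the divisibility on to the coefficients. *)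
Lemma basis_level s (eps : 'I_s -> Tp) m :
  is_basis eps -> level_basis m (fun i => eps i m).
Proof.
move=> bas; split=> [i|x|a a0 i]; first exact: tate_torsion.
  move=> /tate_surj[X <-]; have [c [-> _]] := bas X.
  exists (\row_i (c 0 i m : {poly K})); rewrite tate_sumE.
  by apply: eq_bigr => i _; rewrite mxE.
pose X := \sum_i to_adic hp (a 0 i) *: eps i.
have Xm : X m = 0.
  rewrite tate_sumE -[RHS]a0; apply: eq_bigr => i' _.
  exact: in_qpoly_scale.
have [Y eY] := tate_shift Xm; have [c [ec _]] := bas Y; have [z [_ uniq]] := bas X.
have e1 : z = \row_i to_adic hp (a 0 i).
  by apply: uniq; apply: eq_bigr => i' _; rewrite mxE.
have e2 : z = \row_i (to_adic hp (p ^+ m.+1) * c 0 i).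
  apply: uniq; apply: tateP => i'; rewrite eY ec !tate_sumE scaler_sumr.
  apply: eq_bigr => k _; rewrite mxE -scalerA; symmetry.
  exact: in_qpoly_scale.
have /(congr1 (fun u : adic hp => u m)) : to_adic hp (a 0 i) = to_adic hp (p ^+ m.+1) * c 0 i.
  by have := congr1 (fun u : 'rV_s => u 0 i) e1; rewrite e2 !mxE.
have /(in_qpoly_eq0 (nonconst_monic_exp m)) z0 := dvdpp (p ^+ m.+1).
by rewrite /= z0 mul0r => /(in_qpoly_eq0 (nonconst_monic_exp m)).
Qed.

Lemma level_lift s (eps : 'I_s -> Tp) :
  level_basis 0 (fun i => eps i 0%N) -> forall m, level_basis m (fun i => eps i m).
Proof.
move=> [_ gen0 rel0].
have step a m : p *: lincomb a (fun i => eps i m.+1) = lincomb a (fun i => eps i m).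
  by rewrite scaler_sumr; apply: eq_bigr => i _; rewrite scalerA mulrC -scalerA tate_step.
have down a m : p ^+ m *: lincomb a (fun i => eps i m) = lincomb a (fun i => eps i 0%N).
  elim: m => [|m IH]; first by rewrite scale1r.
  by rewrite exprSr -scalerA step.
elim=> [|m [_ gen rel]]; split=> [i|x|a a0]; try exact: tate_torsion; try by [].
- exact: gen0.
- exact: rel0.
(* The coordinates of p x at level [m] approximate [x] up to p-torsion. The error is spanned by
   level 0, which is p^(m+1) times level m + 1. *)
- rewrite exprSr -scalerA => /gen[a]; rewrite -step => /eqP.
  rewrite -subr_eq0 -scalerBr => /eqP pxa.
  have [|b xb] := gen0 (x - lincomb a (fun i => eps i m.+1)); first by rewrite expr1.
  exists (a + p ^+ m.+1 *: b); rewrite lincombD lincombZ down -xb.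
  by rewrite subrKC.
(* Multiplying the relation by p^(m+1) brings it down to level 0; after division of [a] by [p],
   level [m] applies. *)
have pa : forall i, p %| a 0 i.
  by move=> i; rewrite -(expr1 p); apply: rel0; rewrite -(down _ m.+1) a0 scaler0.
pose b := \row_i (a 0 i %/ p).
have ab : a = p *: b by apply/rowP => i; rewrite !mxE mulrC divpK.
move=> i; rewrite ab mxE exprS dvdp_mul //; apply: rel.
by rewrite -step -lincombZ -ab.
Qed.

(** Freeness at each level makes the coordinates found level by level compatible, so they assemble
    into adic elements, and makes these unique. *)
Lemma level_is_basis s (eps : 'I_s -> Tp) :
  (forall m, level_basis m (fun i => eps i m)) -> is_basis eps.
Proof.
move=> lev X.
have exa : forall m, exists a, X m = lincomb a (fun i => eps i m).
  by move=> m; have [_ gen _] := lev m; apply: gen; apply: tate_torsion.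
have [a aX] := choice exa.
have compat i : adic_compatible (fun m => in_qpoly (p ^+ m.+1) (a m 0 i)).
  move=> m; rewrite in_qpoly_exp //; apply/(eq_in_qpoly (nonconst_monic_exp m)).
  have [_ _ rel] := lev m; have := rel (a m.+1 - a m); rewrite lincombB -aX.
  have -> : lincomb (a m.+1) (fun i => eps i m) = p *: X m.+1.
    rewrite aX scaler_sumr; apply: eq_bigr => i' _.
    by rewrite scalerA mulrC -scalerA tate_step.
  by rewrite tate_step subrr => /(_ erefl i); rewrite !mxE.
exists (\row_i Adic hp (compat i)); split.
  apply: tateP => m; rewrite tate_sumE aX; apply: eq_bigr => i _; rewrite mxE.
  by symmetry; exact: in_qpoly_scale.
move=> d ed; apply/rowP => i; rewrite mxE; apply: adicP => m /=.
have [_ _ rel] := lev m; rewrite -[RHS](in_qpolyK (nonconst_monic_exp m)).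
apply/(eq_in_qpoly (nonconst_monic_exp m)).
have := rel (a m - \row_i (d 0 i m : {poly K})); rewrite lincombB -aX.
have -> : lincomb (\row_i (d 0 i m : {poly K})) (fun i => eps i m) = X m.
  by rewrite ed tate_sumE; apply: eq_bigr => i' _; rewrite mxE.
by rewrite subrr => /(_ erefl i); rewrite !mxE.
Qed.

(* A generating family of V[p] of minimal size is free over the field K[t]/p. *)
Lemma tate_basis_exists N (w : 'I_N -> V) : irreducible_poly p ->
  (forall i, p *: w i = 0) ->
  (forall x, p *: x = 0 -> exists a, x = lincomb a w) ->
  exists s (eps : 'I_s -> Tp), is_basis eps.
Proof.
move=> irr pw gen.
pose gens s := `[< exists v : 'I_s -> V, (forall i, p *: v i = 0) /\
  forall x, p *: x = 0 -> exists a, x = lincomb a v >].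
have exg : exists s, gens s by exists N; apply/asboolP; exists w.
case: (ex_minnP exg) => s /asboolP[v [pv genv]] mins.
have rel a : lincomb a v = 0 -> forall i, p %| a 0 i.
  move=> av i; apply/negPn/negP => ndvd.
  move: v pv genv mins a av i ndvd; case: s => [|s] v pv genv mins a av i ndvd.
    by case: i ndvd.
  (* A coefficient prime to [p] is invertible on the p-torsion, so [v i] is a combination of the
     other generators and could be dropped, against minimality. *)
  have : coprimep p (a 0 i).
    by rewrite irreducible_poly_coprime.
  case/Bezout_eq1_coprimepP => -[u1 u2] /= bez.
  suff : (s.+1 <= s)%N by rewrite ltnn.
  apply: mins; apply/asboolP; exists (fun k => v (lift i k)); split=> // x px.
  have [b ->] := genv x px.
  have vi : v i = - lincomb (\row_k (u2 * a 0 (lift i k))) (fun k => v (lift i k)).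
    have {1}-> : v i = (u2 * a 0 i) *: v i.
      by rewrite -[LHS]scale1r -bez scalerDl -[X in X + _]scalerA pv scaler0 add0r.
    apply/eqP; rewrite -addr_eq0 -scalerA; apply/eqP.
    rewrite -[RHS](scaler0 _ u2) -av /lincomb (bigD1_ord i) //= scalerDr; congr (_ + _).
    by rewrite scaler_sumr; apply: eq_bigr => k _; rewrite mxE scalerA.
  exists (\row_k b 0 (lift i k) - b 0 i *: \row_k (u2 * a 0 (lift i k))).
  rewrite lincombB lincombZ -scalerN -vi addrC {1}/lincomb (bigD1_ord i) //=.
  by congr (_ + _); apply: eq_bigr => k _; rewrite mxE.
have exeps : forall i, exists X : Tp, X 0%N = v i.
  by move=> i; apply: tate_surj; rewrite expr1.
have [eps epsv] := choice exeps.
exists s, eps; apply: level_is_basis; apply: level_lift.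
have -> : (fun i => eps i 0%N) = v by apply/funext.
by split=> [i|x|a]; rewrite expr1 //; [exact: genv|exact: rel].
Qed.
End TateBasis.

(** * Comparison of determinants modulo a power of lam *)

Section TopCoefficient.
Variables (F : fieldType) (h : {poly F}).
Hypothesis hmon : nonconst_monic h.

(* The residue form of F[t]/(h); (size h).-2 is deg h - 1. *)
Definition top_coef (a : {poly F}) : F := (a %% h)`_(size h).-2.

Lemma top_coefD a b : top_coef (a + b) = top_coef a + top_coef b.
Proof. by rewrite /top_coef modpD coefD. Qed.
Lemma top_coefZ c a : top_coef (c *: a) = c * top_coef a.
Proof. by rewrite /top_coef modpZl coefZ. Qed.
Lemma top_coef0 : top_coef 0 = 0.
Proof. by rewrite /top_coef mod0p coef0. Qed.
Lemma top_coef_sum I (r : seq I) (P : pred I) G :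
  top_coef (\sum_(i <- r | P i) G i) = \sum_(i <- r | P i) top_coef (G i).
Proof. exact: (big_morph _ top_coefD top_coef0). Qed.
Lemma top_coef_dvdB a b : h %| a - b -> top_coef a = top_coef b.
Proof.
move=> ab; rewrite -[X in top_coef X = _](subrK b) top_coefD.
by rewrite {1}/top_coef (modp_eq0 ab) coef0 add0r.
Qed.

Lemma top_coef_nondeg u :
  (forall k, (k < (size h).-1)%N -> top_coef ('X^k * u) = 0) -> h %| u.
Proof.
move=> top0; apply/negPn/negP; rewrite /dvdp => r0; pose r := u %% h.
have h0 : h != 0 by case/andP: hmon => /monic_neq0.
have sr : (size r < size h)%N by rewrite ltn_modp.
have sr0 : (0 < size r)%N by rewrite size_poly_gt0.
(* This shift brings the leading term of [r] to degree deg h - 1, still below deg h, so the residue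
   form reads off the leading coefficient of [r]. *)
pose k := ((size h).-1 - size r)%N.
have sh : size h = (k + size r).+1.
  by rewrite /k subnK ?prednK ?(leq_ltn_trans _ sr) // -ltnS prednK // (leq_ltn_trans _ sr).
have er : (size h).-2 = (k + (size r).-1)%N by rewrite sh /= -!subn1 addnBA.
have lk : (k < (size h).-1)%N by rewrite sh /= -{1}[k]addn0 ltn_add2l.
have := top0 k lk; have -> : top_coef ('X^k * u) = top_coef ('X^k * r).
  apply: top_coef_dvdB; rewrite -mulrBr dvdp_mull // {1}(divp_eq u h) addrK.
  by rewrite dvdp_mull.
rewrite /top_coef modp_small; last by rewrite mulrC size_mulXn // sh.
rewrite er coefXnM ltnNge leq_addr /= addKn => /eqP.
by rewrite -lead_coefE lead_coef_eq0 (negPf r0).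
Qed.

(** The Gram matrix of the residue form on the powers of X is square and, by nondegeneracy,
    invertible: every linear form on F[t]/(h) is represented. *)
Lemma top_coef_dual (v : nat -> F) :
  exists u, forall k, (k < (size h).-1)%N -> top_coef ('X^k * u) = v k.
Proof.
pose D := (size h).-1.
pose Q : 'M[F]_D := \matrix_(a, k) top_coef ('X^k * 'X^a).
have topQ (c : 'rV_D) (k : 'I_D) : top_coef ('X^k * rVpoly c) = (c *m Q) 0 k.
  rewrite mxE {1}/rVpoly poly_def mulr_sumr top_coef_sum; apply: eq_bigr => a _.
  by rewrite -scalerAr top_coefZ mxE insubT // => lt; congr (c _ _ * _); apply: val_inj.
have Qfree : row_free Q.
  rewrite -kermx_eq0; apply/rowV0P => c /sub_kermxP cQ.
  have dvd : h %| rVpoly c.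
    by apply: top_coef_nondeg => k lk; rewrite (topQ c (Ordinal lk)) cQ mxE.
  have [c0|c0] := eqVneq (rVpoly c) 0; first by rewrite -[c]rVpolyK c0 linear0.
  have := dvdp_leq c0 dvd; rewrite leqNgt => /negP[].
  apply: leq_ltn_trans (size_poly _ _) _; case/andP: hmon => _.
  by rewrite /D; case: (size h).
have Qfull : row_full Q by rewrite row_full_unit -row_free_unit.
have /submxP[c ec] := submx_full (\row_k v k) Qfull.
exists (rVpoly c) => k lk; rewrite (topQ c (Ordinal lk)) -ec.
by rewrite mxE.
Qed.
End TopCoefficient.

Lemma is_basisP (R : nzRingType) (V : lmodType R) n (e : 'I_n -> V) :
  is_basis e -> (forall x, exists c, x = lincomb c e) /\
    forall c, lincomb c e = 0 -> c = 0.
Proof.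
move=> bas; split=> [x|c c0]; first by have [c [-> _]] := bas x; exists c.
have [z [_ uniq]] := bas 0.
have <- : z = c by apply: uniq; symmetry; exact: c0.
by apply: uniq; symmetry; exact: lincomb0.
Qed.

Section LevelDeterminant.
Variables (k H : fieldType) (tau : {rmorphism H -> H}) (iota : {rmorphism k -> H}).
Hypothesis tau_iota : forall c, tau (iota c) = iota c.
Variables (l : nat) (E : {rmorphism {poly k} -> 'M[tpoly tau]_l}).
Hypothesis EC : forall c, E c%:P = (tpolyC tau (iota c))%:M.

Local Notation M := (motive E).
Local Notation W := (points E).

Variables (Lam : {poly k}).
Hypotheses (hLam : nonconst_monic Lam) (perfL : perfect iota E Lam).
Variables (s : nat) (w : 'I_s -> W).
Hypotheses (Lw : forall i, Lam *: w i = 0)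
  (genw : forall x : W, Lam *: x = 0 -> exists a, x = lincomb a w)
  (relw : forall a, lincomb a w = 0 -> forall i, Lam %| a 0 i).

Local Notation LH := (map_poly iota Lam).

Lemma nonconst_monic_map : nonconst_monic LH.
Proof. by rewrite /nonconst_monic map_monic size_map_poly. Qed.
Let hLH := nonconst_monic_map.

Lemma torsion_lincomb a : Lam *: lincomb a w = 0.
Proof. by rewrite scaler_sumr big1 // => i _; rewrite scalerA mulrC -scalerA Lw scaler0. Qed.

(** The coordinate along [w j] is only defined in k[t]/Lam; followed by the residue form it becomes
    a functional with values in H, which perfectness realises by an element of M. *)
Lemma dual_family_exists : exists f : 'I_s -> M, forall j a,
  pair (f j) (lincomb a w) = top_coef LH (map_poly iota (a 0 j)).
Proof.
move: (perfL) => [N [b [Lb genb surj _]]].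
have /choice[P bP] := fun n => genw (Lb n).
have [f fP] := choice (fun j => surj (fun n => top_coef LH (map_poly iota (P n 0 j)))).
exists f => j a; have [c ec] := genb _ (torsion_lincomb a).
have dvd : Lam %| a 0 j - \sum_n (c 0 n)%:P * P n 0 j.
  have := relw (a := a - \row_i \sum_n (c 0 n)%:P * P n 0 i); rewrite lincombB.
  have -> : lincomb (\row_i \sum_n (c 0 n)%:P * P n 0 i) w = lincomb a w.
    rewrite ec; have -> : \row_i \sum_n (c 0 n)%:P * P n 0 i
        = map_mx polyC c *m \matrix_(n, i) P n 0 i.
      by apply/rowP => i; rewrite !mxE; apply: eq_bigr => n _; rewrite !mxE.
    rewrite lincomb_mul; apply: eq_bigr => n _; congr (_ *: _); rewrite [RHS]bP.
    by apply: eq_bigr => i _; rewrite !mxE.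
  by rewrite subrr => /(_ erefl j); rewrite !mxE.
rewrite ec (pair_map_polyC tau_iota EC).
rewrite (@top_coef_dvdB _ _ _ (map_poly iota (\sum_n (c 0 n)%:P * P n 0 j))); last first.
  by rewrite -rmorphB dvdp_map.
rewrite rmorph_sum top_coef_sum; apply: eq_bigr => n _.
by rewrite rmorphM /= map_polyC mul_polyC top_coefZ fP.
Qed.

Lemma pair_dual_scale (f : 'I_s -> M) :
  (forall j a, pair (f j) (lincomb a w) = top_coef LH (map_poly iota (a 0 j))) ->
  forall u a, pair (lincomb u f) (lincomb a w)
    = \sum_j top_coef LH (u 0 j * map_poly iota (a 0 j)).
Proof.
move=> fw u a; rewrite pair_suml; apply: eq_bigr => j _.
rewrite pair_scale -[u 0 j in RHS]coefK poly_def mulr_suml top_coef_sum.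
apply: eq_bigr => i _; rewrite -lincombZ fw mxE rmorphM /= map_polyXn.
by rewrite -scalerAl top_coefZ.
Qed.

Variables (phi : {linear W -> W}) (a : 'M[{poly k}]_s).
Hypothesis phiw : forall i, phi (w i) = lincomb (row i a) w.
Variables (rho : {linear M -> M}) (r : nat) (e : 'I_r -> M) (Th : 'M[{poly H}]_r).
Hypotheses (base : is_basis e) (rhoe : forall i, rho (e i) = lincomb (row i Th) e).
Hypothesis pair_rho : forall m x, pair (rho m) x = pair m (phi x).

Lemma level_det : in_qpoly LH (\det (1%:M - map_mx (map_poly iota) a))
  = in_qpoly LH (\det (1%:M - Th)).
Proof.
have [f fw] := dual_family_exists; have fu := pair_dual_scale fw.
have [gene free] := is_basisP base.
pose I (m : M) := exists g : M, m = LH *: g.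
have subI : submodule I.
  split=> [|x y [g ->] [g' ->]|c x [g ->]]; first by exists 0; rewrite scaler0.
    by exists (g + g'); rewrite scalerDr.
  by exists (c *: g); rewrite !scalerA mulrC.
have killI (m : M) : (forall b, pair m (lincomb b w) = 0) <-> I m.
  have ker := perfect_kernel tau_iota EC m perfL.
  split=> [m0|/ker m0 b]; first by apply/ker => x /genw[b ->].
  by apply: m0; exact: torsion_lincomb.
have Ie u : I (lincomb u e) -> forall i, LH %| u 0 i.
  move=> [g]; have [v ->] := gene g; rewrite -lincombZ => /eqP.
  rewrite -subr_eq0 -lincombB => /eqP/free/eqP; rewrite subr_eq0 => /eqP -> i.
  by rewrite mxE dvdp_mulr.
(* Testing a relation against X^n times [w i] isolates its i-th coefficient; the nondegenerate
   residue form then detects divisibility. *)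
have If u : I (lincomb u f) -> forall i, LH %| u 0 i.
  move=> /killI u0 i; apply: (top_coef_nondeg hLH) => n _.
  have := u0 ('X^n *: delta_mx 0 i); rewrite fu (bigD1 i) //= big1 => [|j ji].
    by rewrite addr0 !mxE !eqxx mulr1 map_polyXn mulrC.
  by rewrite !mxE (negPf ji) andbF mulr0 rmorph0 mulr0 top_coef0.
(* The j-th coefficient is the polynomial representing the functional that sends X^n to the pairing
   of [m] with X^n [w j]. *)
have genf (m : M) : exists u, I (m - lincomb u f).
  have [u mu] := choice (fun j => top_coef_dual hLH (fun n => pair m ('X^n *: w j))).
  exists (\row_j u j); apply/killI => b; rewrite pairBl fu; apply/eqP.
  rewrite subr_eq0; apply/eqP; rewrite pair_sumr; apply: eq_bigr => j _; rewrite mxE.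
  have -> : b 0 j *: w j = (b 0 j %% Lam) *: w j.
    by rewrite {1}(divp_eq (b 0 j) Lam) scalerDl -scalerA Lw scaler0 add0r.
  rewrite (@top_coef_dvdB _ _ _ (u j * map_poly iota (b 0 j %% Lam))); last first.
    rewrite -mulrBr -rmorphB dvdp_mull // dvdp_map {1}(divp_eq (b 0 j) Lam) addrK.
    by rewrite dvdp_mull.
  have sz : (size (b 0%R j %% Lam)%R <= (size LH).-1)%N.
    by rewrite size_map_poly -ltnS prednK ?ltn_modp ?size_poly_gt0; case/andP: hLam => /monic_neq0.
  rewrite -(pair_map_scale tau_iota EC) pair_scale mulrC.
  rewrite -[X in _ = top_coef _ (X * _)]coefK poly_def mulr_suml.
  rewrite top_coef_sum; apply: eq_bigr => i _; rewrite -scalerAl top_coefZ mu //.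
  by apply: leq_trans sz; rewrite -(size_map_poly iota).
have [X fX] := rows_choice (fun j => gene (f j)).
(* [e] and [f] are two bases of M modulo [LH]; [X] and [Y], a priori rectangular, are the transition
   matrices between them. *)
have [Y eY] := rows_choice (fun i => genf (e i)).
pose q := in_qpoly LH; pose Q := map_mx q.
have Q1 n : Q n n 1%:M = 1%:M by apply: map_mx1.
have QM m n p (A : 'M_(m, n)) (B : 'M_(n, p)) : Q _ _ (A *m B) = Q _ _ A *m Q _ _ B.
  exact: map_mxM.
have QB m n (A B : 'M_(m, n)) : Q _ _ (A - B) = Q _ _ A - Q _ _ B by apply: map_mxB.
have eqQ m n (A B : 'M_(m, n)) : (forall i j, LH %| A i j - B i j) -> Q m n A = Q m n B.
  by move=> AB; apply/matrixP => i j; rewrite !mxE; apply/(eq_in_qpoly hLH).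
have eqQrow m n (A B : 'M_(m, n)) :
    (forall i j, LH %| (row i A - row i B) 0 j) -> Q m n A = Q m n B.
  by move=> AB; apply: eqQ => i j; have := AB i j; rewrite !mxE.
have YX : Q _ _ Y *m Q _ _ X = 1%:M.
  rewrite -QM -Q1; apply: eqQrow => i; apply: Ie.
  rewrite lincombB row1 lincomb_delta row_mul lincomb_mul; apply: submod_sym => //.
  rewrite (_ : (fun j => lincomb (row j X) e) = f); last by apply/funext => j; rewrite -fX.
  exact: eY.
have XY : Q _ _ X *m Q _ _ Y = 1%:M.
  rewrite -QM -Q1; apply: eqQrow => j; apply: If.
  rewrite lincombB row1 lincomb_delta row_mul lincomb_mul fX.
  by apply: submod_lincomb => // i; apply: submod_sym.
(* As rho is adjoint to phi, its matrix on the dual family is the transpose of [a]; both sides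
   express rho [f j] in the basis [e]. *)
have XT : Q _ _ X *m Q _ _ Th = Q _ _ (map_mx (map_poly iota) a)^T *m Q _ _ X.
  rewrite -!QM; apply: eqQrow => j; apply: Ie; rewrite lincombB !row_mul !lincomb_mul.
  have -> : lincomb (row j X) (fun i => lincomb (row i Th) e) = rho (f j).
    by rewrite [in RHS]fX linear_sum; apply: eq_bigr => i _; rewrite linearZ /= rhoe.
  rewrite (_ : (fun j => lincomb (row j X) e) = f); last by apply/funext => i; rewrite -fX.
  apply/killI => b; rewrite pairBl pair_rho fu; apply/eqP; rewrite subr_eq0; apply/eqP.
  have -> : phi (lincomb b w) = lincomb (b *m a) w.
    by rewrite lincomb_mul linear_sum; apply: eq_bigr => i _; rewrite linearZ /= phiw.
  rewrite fw mxE rmorph_sum top_coef_sum; apply: eq_bigr => i _.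
  by rewrite !mxE rmorphM mulrC.
rewrite -[in LHS](trmxK (map_mx _ a)) -(trmx1 _ s) -raddfB /= det_tr.
have qdet n (A : 'M_n) : q (\det A) = \det (Q _ _ A) by rewrite det_map_mx.
rewrite -!/(q _) !qdet !QB !Q1.
have -> : Q _ _ (map_mx (map_poly iota) a)^T = Q _ _ X *m (Q _ _ Th *m Q _ _ Y).
  by rewrite mulmxA XT -mulmxA XY mulmx1.
(* Sylvester's identity moves [X] to the other side, changing the size of the determinant from [s]
   to [r]. *)
by rewrite det1B_mulmxC -mulmxA YX mulmx1.
Qed.
End LevelDeterminant.

(** * Fixed fields *)

Section LinearFunctional.
Variables (k F : fieldType) (i : {rmorphism k -> F}).

Definition functional (pi : F -> k) : Prop :=
  (forall x y, pi (x + y) = pi x + pi y) /\ forall a x, pi (i a * x) = a * pi x.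

(* The kernel is a maximal subspace avoiding c. *)
Lemma functional_exists c : c != 0 -> exists2 pi, functional pi & pi c = 1.
Proof.
move=> c0.
(* Membership of 0 is left out so that the union of the empty chain qualifies; maximality supplies
   it afterwards. *)
pose P (A : set F) := [/\ ~ A c, forall x y, A x -> A y -> A (x + y)
  & forall a x, A x -> A (i a * x)].
have [A [[Ac AD AZ] maxA]] : exists A, P A /\ forall B, (A `<` B)%classic -> ~ P B.
  apply: Zorn_bigcup => C CP tot; split=> [[X CX Xc]|x y [X CX Xx] [Y CY Yy]|a x [X CX Xx]].
  - by have [] := CP X CX.
  - have [XY|YX] := tot X Y CX CY.
      by exists Y => //; have [_ YD _] := CP Y CY; apply: YD => //; apply: XY.
    by exists X => //; have [_ XD _] := CP X CX; apply: XD => //; apply: YX.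
  - by exists X => //; have [_ _] := CP X CX; apply.
have A0 : A 0.
  apply: contrapT => nA0; apply: (maxA (A `|` [set 0])).
    by split=> [x Ax|sub]; [left|apply: nA0; apply: sub; right].
  split=> [[//|/= e]|x y [Ax|->] [Ay|->]|a x [Ax|->]].
  - by move: c0; rewrite e eqxx.
  - by left; apply: AD.
  - by rewrite addr0; left.
  - by rewrite add0r; left.
  - by rewrite addr0; right.
  - by left; apply: AZ.
  by rewrite mulr0; right.
have AN x : A x -> A (- x) by move=> Ax; rewrite -mulN1r -(rmorphN1 i); apply: AZ.
have ex y : exists a, A (y - i a * c).
  have [Ay|nAy] := pselect (A y); first by exists 0; rewrite rmorph0 mul0r subr0.
  apply: contrapT => nex.
  (* If A + k y contained c, then y would be a multiple of c modulo A; so it avoids c and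
     contradicts maximality. *)
  apply: (maxA [set x | exists a s, A a /\ x = a + i s * y]).
    split=> [x Ax|sub]; first by exists x, 0; rewrite rmorph0 mul0r addr0.
    by apply: nAy; apply: sub; exists 0, 1; rewrite rmorph1 mul1r add0r.
  split=> [[a [s [Aa ec]]]|x z [a [s [Aa ->]]] [b [u [Ab ->]]]|b x [a [s [Aa ->]]]].
  - have s0 : s != 0 by apply: contra_notN Ac => /eqP s0; rewrite ec s0 rmorph0 mul0r addr0.
    apply: nex; exists s^-1; rewrite ec mulrDr opprD mulrA -rmorphM mulVf // rmorph1 mul1r.
    by rewrite addrCA subrr addr0 -mulrN; apply: AZ; apply: AN.
  - exists (a + b), (s + u); split; first exact: AD.
    by rewrite rmorphD mulrDl addrACA.
  by exists (i b * a), (b * s); split; [apply: AZ|rewrite rmorphM mulrDr mulrA].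
have uniq y a b : A (y - i a * c) -> A (y - i b * c) -> a = b.
  move=> Aa /AN Ab; have := AD _ _ Aa Ab; rewrite opprB addrC addrA subrK -mulrBl -rmorphB => Aba.
  apply/eqP; rewrite eq_sym -subr_eq0; apply: contra_notT Ac => ba0.
  by rewrite -[c]mul1r -(rmorph1 i) -(mulVf ba0) rmorphM -mulrA; apply: AZ.
have [pi pP] := choice ex; exists pi; last first.
  by apply: (uniq c); [exact: pP|rewrite rmorph1 mul1r subrr].
split=> [x y|a x].
  apply: (uniq (x + y)); first exact: pP.
  by rewrite rmorphD mulrDl opprD addrACA; apply: AD; exact: pP.
apply: (uniq (i a * x)); first exact: pP.
by rewrite rmorphM -mulrA -mulrBr; apply: AZ; exact: pP.
Qed.

Lemma functional_sum pi (J : finType) (P : pred J) (a : J -> k) (y : J -> F) :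
  functional pi -> pi (\sum_(z | P z) i (a z) * y z) = \sum_(z | P z) a z * pi (y z).
Proof.
move=> [piD piZ]; have pi0 : pi 0 = 0 by apply: (addrI (pi 0)); rewrite -piD !addr0.
by rewrite (big_morph pi piD pi0); apply: eq_bigr => z _; rewrite piZ.
Qed.

Lemma functional0 pi : functional pi -> pi 0 = 0.
Proof. by move=> [piD _]; apply: (addrI (pi 0)); rewrite -piD !addr0. Qed.
End LinearFunctional.

Section FixedField.
Variables (k F : fieldType) (i : {rmorphism k -> F}) (phi psi : {rmorphism F -> F}).
Hypotheses (phiK : cancel phi psi) (psiK : cancel psi phi).

Hypothesis phi_fix : forall x, phi x = x -> exists a, x = i a.
Variables (n : nat).

(* A relation between the coefficients of p and q that holds after every power of
   phi is a combination of relations over k, which pi respects. *)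
Lemma functional_cross (p q : mpowser n F) pi : functional i pi ->
  (forall t, p * map_mps (iter t phi) q = q * map_mps (iter t phi) p) ->
  p * map_mps (i \o pi) q = q * map_mps (i \o pi) p.
Proof.
move=> fpi cross; apply/funext => m; apply/eqP; rewrite -subr_eq0; apply/eqP.
(* The m-th coefficients of the two products become one finite relation: the boolean tells which
   series gives the transformed coefficient [y], and [h] is the signed cofactor. *)
pose J := ('X_{1..n < (mdeg m).+1, (mdeg m).+1} * bool)%type.
pose y (z : J) := if z.2 then q z.1.2 else p z.1.2.
pose h (z : J) := if (m == (z.1.1 + z.1.2)%MM) then if z.2 then p z.1.1 else - q z.1.1 else 0.
have expand (g : F -> F) : (p * map_mps g q) m - (q * map_mps g p) m
    = \sum_z h z * g (y z).
  rewrite -(pair_bigA _ (fun u v => h (u, v) * g (y (u, v)))) /=.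
  rewrite !mpsME -sumrB big_mkcond; apply: eq_bigr => u _.
  rewrite big_bool /h /y /=; case: ifP => _; last by rewrite !mul0r addr0.
  by rewrite mulNr.
rewrite expand; pose Q (h : J -> F) := \sum_z h z * (i \o pi) (y z) = 0.
apply: (@rational_relations _ _ _ _ _ phiK psiK phi_fix _ _
  (fun t z => iter t phi (y z)) Q) => [t|x u v Qu Qv|c cy|t].
- by exists t.+1.
- rewrite /Q; transitivity (x * (\sum_z u z * (i \o pi) (y z)) + \sum_z v z * (i \o pi) (y z)).
    by rewrite mulr_sumr -big_split; apply: eq_bigr => z _; rewrite mulrDl mulrA.
  by rewrite Qu Qv mulr0 addr0.
- rewrite /Q; transitivity (i (\sum_z c z * pi (y z))).
    by rewrite rmorph_sum; apply: eq_bigr => z _; rewrite rmorphM.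
  by rewrite -(functional_sum _ _ _ fpi) (cy 0%N) (functional0 fpi) rmorph0.
by rewrite -expand cross subrr.
Qed.

Local Notation "x %:F" := (@FracField.tofrac _ x).

(** Only the fraction is fixed, not [p] and [q]; these cross relations, one for each power of [g],
    are the form that survives. *)
Lemma frac_fixed_cross (S : idomainType) (g : {rmorphism S -> S}) p q :
  injective g -> q != 0 -> frac_map g (p%:F / q%:F) = p%:F / q%:F ->
  forall t, p * iter t g q = q * iter t g p.
Proof.
move=> gi q0 fixed t; have qF : q%:F != 0 by rewrite tofrac_eq0.
have itq : iter t g q != 0 by elim: t => //= t IH; rewrite raddf_eq0.
have e : p%:F / q%:F = (iter t g p)%:F / (iter t g q)%:F.
  elim: t itq => //= t IH; rewrite raddf_eq0 // => itq.
  by rewrite -frac_mapE // -IH.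
apply/eqP; move/eqP: e; rewrite eqr_div ?tofrac_eq0 // -!tofracM tofrac_eq.
by rewrite [X in _ == X]mulrC.
Qed.

Lemma frac_map_cross (R S : idomainType) (g : {rmorphism R -> S}) p q p0 q0 :
  injective g -> q != 0 -> q0 != 0 -> p * g q0 = q * g p0 ->
  p%:F / q%:F = frac_map g (p0%:F / q0%:F).
Proof.
move=> gi nq nq0 e; rewrite frac_mapE //; have gq0 : g q0 != 0 by rewrite raddf_eq0.
by apply/eqP; rewrite eqr_div ?tofrac_eq0 // -!tofracM tofrac_eq e mulrC.
Qed.

Lemma coefF_fixed kind (x : coefF kind n F) :
  coefF_map (kind := kind) (n := n) phi x = x ->
  exists a, x = coefF_map (kind := kind) (n := n) i a.
Proof.
case: kind x => x /=; rewrite {1 2 3}(frac_numden x).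
  set p := \n_(_); set q := \d_(_) => fixed; have q0 : q != 0 by apply: denom_ratioP.
  have gi (g : {rmorphism k -> F}) : injective (@map_mpoly n k F g).
    by move=> u v e; apply/mpolyP => m; apply: (fmorph_inj g); rewrite -!mcoeff_map_mpoly e.
  have phi_inj : injective (@map_mpoly n F F phi).
    by move=> u v e; apply/mpolyP => m; apply: (fmorph_inj phi); rewrite -!mcoeff_map_mpoly e.
  have cross := frac_fixed_cross phi_inj q0 fixed.
  have coefit t (u : {mpoly F[n]}) m : (iter t (@map_mpoly n F F phi) u)@_m = iter t phi u@_m.
    by elim: t => //= t IH; rewrite mcoeff_map_mpoly IH.
  have qm0 : q@_(mlead q) != 0 by rewrite mleadc_eq0.
  (* Normalising [pi] at a nonzero coefficient of [q] keeps the new denominator nonzero. *)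
  have [pi fpi piq] := functional_exists i qm0.
  pose lift (u : {mpoly F[n]}) : {mpoly k[n]} := \sum_(m <- msupp u) pi u@_m *: 'X_[m].
  have liftE u m : (map_mpoly i (lift u))@_m = i (pi u@_m).
    rewrite mcoeff_map_mpoly; congr (i _); rewrite /lift raddf_sum /=.
    under eq_bigr do rewrite mcoeffZ mcoeffX.
    have [mu|nmu] := boolP (m \in msupp u).
      rewrite (bigD1_seq m) //= eqxx mulr1 big1 ?addr0 // => m' /negPf ->.
      by rewrite mulr0.
    rewrite (memN_msupp_eq0 nmu) (functional0 fpi) big_seq big1 // => m' m'u.
    by case: eqP => [e|_]; [move: nmu; rewrite -e m'u|rewrite mulr0].
  have cross0 : p * map_mpoly i (lift q) = q * map_mpoly i (lift p).
    (* The polynomials are read as power series through their coefficient functions. *)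
    have key := @functional_cross (fun m => p@_m) (fun m => q@_m) _ fpi.
    have {}key m h := congr1 (fun u : mpowser n F => u m) (key h).
    apply/mpolyP => m; rewrite !mcoeffM; have {}key := key m; rewrite !mpsME in key.
    under eq_bigr do rewrite liftE; under [RHS]eq_bigr do rewrite liftE.
    apply: key => t; apply/funext => m'; rewrite !mpsME.
    have /(congr1 (mcoeff m')) := cross t; rewrite !mcoeffM.
    under eq_bigr do rewrite coefit; under [X in _ = X]eq_bigr do rewrite coefit.
    by [].
  have lq0 : lift q != 0.
    apply/eqP => /(congr1 (fun u => (map_mpoly i u)@_(mlead q))).
    by rewrite liftE piq rmorph1 rmorph0 mcoeff0 => /eqP; rewrite oner_eq0.
  by exists ((lift p)%:F / (lift q)%:F); exact: (frac_map_cross (gi i) q0 lq0 cross0).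
set p := \n_(_); set q := \d_(_) => fixed; have q0 : q != 0 by apply: denom_ratioP.
have gi : injective (@map_mps n k F i).
  move=> u v e; apply/funext => m.
  exact: (fmorph_inj i (congr1 (fun h : mpowser n F => h m) e)).
have phi_inj : injective (@map_mps n F F phi).
  move=> u v e; apply/funext => m.
  exact: (fmorph_inj phi (congr1 (fun h : mpowser n F => h m) e)).
have cross := frac_fixed_cross phi_inj q0 fixed.
have coefit t (u : mpowser n F) : iter t (@map_mps n F F phi) u = map_mps (iter t phi) u.
  by elim: t => //= t ->.
have [m qm _] := mps_lead q0.
have [pi fpi piq] := functional_exists i qm.
have cross0 : p * map_mps i (map_mps pi q) = q * map_mps i (map_mps pi p).
  by apply: (functional_cross fpi) => t; rewrite -!coefit.
have lq0 : map_mps pi q != 0.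
  apply/eqP => /(congr1 (fun u : mpowser n k => u m)); rewrite /map_mps piq => /eqP.
  by rewrite oner_eq0.
by exists ((map_mps pi p)%:F / (map_mps pi q)%:F); exact: (frac_map_cross gi q0 lq0 cross0).
Qed.
End FixedField.

(** X^q - X is the product of the X - a over all a in k, so its roots in F come from k. *)
Lemma frob_fix (k : finFieldType) (F : fieldType) (i : {rmorphism k -> F}) x :
  frob i x = x -> exists a, x = i a.
Proof.
move=> fx; have /(congr1 (fun p => (map_poly i p).[x])) := finField_genPoly k.
rewrite rmorphB rmorph_prod /= map_polyXn map_polyX !hornerE.
rewrite -[x ^+ _]/(frob i x) fx subrr => /esym/eqP.
rewrite horner_prod prodf_seq_eq0 => /hasP[a _ /=].
by rewrite rmorphB /= map_polyX map_polyC !hornerE subr_eq0 => /eqP ->; exists a.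
Qed.

Lemma frob_rat (k : finFieldType) (F : fieldType) (i : {rmorphism k -> F}) a :
  frob i (i a) = i a.
Proof. by rewrite /frob -rmorphXn expf_card. Qed.

Lemma frob_iterE (k : finFieldType) (F : fieldType) (i : {rmorphism k -> F}) m x :
  iter m (frob i) x = x ^+ (#|k| ^ m).
Proof. by elim: m => //= m ->; rewrite /frob -exprM expnSr. Qed.

Lemma coefF_map_const kind n (F F' : fieldType) (phi : {rmorphism F -> F'}) c :
  coefF_map (kind := kind) (n := n) phi (coefF_const kind n c) = coefF_const kind n (phi c).
Proof.
have fracE (R S : idomainType) (g : {rmorphism R -> S}) a : injective g ->
    frac_map g (FracField.tofrac a) = FracField.tofrac (g a).
  move=> gi; rewrite -[FracField.tofrac a]divr1 -tofrac1 frac_mapE ?oner_eq0 //.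
  by rewrite rmorph1 tofrac1 divr1.
case: kind => /=.
  rewrite [LHS]fracE /= ?map_mpolyC // => u v e; apply/mpolyP => m.
  by apply: (fmorph_inj phi); rewrite -!mcoeff_map_mpoly e.
rewrite [LHS]fracE /= => [|u v e].
  congr FracField.tofrac; apply/funext => m; rewrite /map_mps /mps_const.
  by case: ifP => // _; rewrite rmorph0.
by apply/funext => m; exact: (fmorph_inj phi (congr1 (fun h : mpowser n F' => h m) e)).
Qed.

(** * Fixed field of tau, irreducibility of lam over F_q{{Z}}, and conjugates of theta *)

Section Setting.
Variables (kind : coef_field) (n : nat) (Fq : finFieldType).
Variables (f : {poly Fq}) (hf : monic_irreducible_poly f).
Variables (Fbar : closedFieldType) (j : {rmorphism {poly %/ f with hf} -> Fbar}).

Local Notation Ff := {poly %/ f with hf}.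
Local Notation Kq := (coefF kind n Fq).
Local Notation Kf := (coefF kind n Ff).
Local Notation H := (coefF kind n Fbar).
Local Notation tau := (tau kind n j).
Local Notation sigma := (sigma kind n j).
Local Notation iota := (Kq_H kind n j).
Local Notation q := #|Fq|.

Lemma Kq_HE x : iota x = coefF_map (kind := kind) (n := n) (jq j) x.
Proof. exact: coefF_map_comp. Qed.

Lemma tau_Kq c : tau (iota c) = iota c.
Proof.
rewrite !Kq_HE; apply: coefF_map_comp => y.
exact: frob_rat.
Qed.

Lemma tau_fix x : tau x = x -> exists c, x = iota c.
Proof.
move=> tx; have [c ->] := coefF_fixed (frobK (jq j)) (frobVK (jq j))
  (frob_fix (i := jq j)) tx.
by exists c; rewrite Kq_HE.
Qed.

Lemma tau_const c : tau (coefF_const kind n c) = coefF_const kind n (frob (jq j) c).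
Proof. exact: coefF_map_const. Qed.

Lemma coefF_const_inj (F : fieldType) : injective (@coefF_const kind n F).
Proof. exact: fmorph_inj. Qed.

Lemma iota_const c : iota (coefF_const kind n c) = coefF_const kind n (jq j c).
Proof. by rewrite Kq_HE coefF_map_const. Qed.

(* Over H the factors of lam are products of linear factors with constant roots;
   those defined over Kq have Frobenius-invariant, hence Fq-rational coefficients. *)
Lemma lamK_irreducible (lam : {poly Fq}) :
  monic_irreducible_poly lam -> irreducible_poly (lamK kind n lam).
Proof.
move=> [[slam irr] mlam]; split=> [|g sg gdvd]; first by rewrite size_map_poly.
have g0 : g != 0.
  apply: contraTneq gdvd => ->; rewrite dvd0p map_poly_eq0 -size_poly_eq0.
  by case: (size lam) slam.
wlog mg : g sg gdvd g0 / g \is monic.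
  move=> wl; have lg : (lead_coef g)^-1 != 0 by rewrite invr_eq0 lead_coef_eq0.
  rewrite -(eqp_ltrans (eqp_scale g lg)); apply: wl.
  - by rewrite size_scale.
  - by rewrite dvdpZl.
  - by rewrite scaler_eq0 negb_or lg.
  by rewrite monicE lead_coefZ mulVf // lead_coef_eq0.
have [rs ers] := closed_field_poly_normal (map_poly (jq j) lam).
have mapiota (h : {poly Fq}) : map_poly iota (map_poly (@coefF_const kind n Fq) h)
    = map_poly (@coefF_const kind n Fbar) (map_poly (jq j) h).
  by apply/polyP => i; rewrite !coef_map; exact: iota_const.
have [m gm] : {m | map_poly iota g %= \prod_(z <- mask m rs) ('X - (coefF_const kind n z)%:P)}.
  apply: dvdp_prod_XsubC.
  have : map_poly iota g %| map_poly iota (lamK kind n lam) by rewrite dvdp_map.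
  rewrite mapiota ers (monicP _) ?map_monic // scale1r rmorph_prod /=.
  by under eq_bigr do rewrite rmorphB /= map_polyX map_polyC.
pose gb := \prod_(z <- mask m rs) ('X - z%:P).
have egb : map_poly iota g = map_poly (@coefF_const kind n Fbar) gb.
  have -> : map_poly (@coefF_const kind n Fbar) gb
      = \prod_(z <- mask m rs) ('X - (coefF_const kind n z)%:P).
    by rewrite rmorph_prod; apply: eq_bigr => z _; rewrite rmorphB /= map_polyX map_polyC.
  apply/eqP; rewrite -eqp_monic //; first by rewrite map_monic.
  exact: monic_prod_XsubC.
have /choice[a ga] : forall i, exists a, gb`_i = jq j a.
  move=> i; apply: frob_fix; apply: coefF_const_inj; rewrite -tau_const.
  by have := congr1 (fun u : {poly H} => u`_i) egb; rewrite !coef_map /= => <-; rewrite tau_Kq.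
pose h := \poly_(i < size gb) a i.
have eh : g = lamK kind n h.
  apply: (map_inj_poly (fmorph_inj iota) (rmorph0 _)); rewrite mapiota egb; congr map_poly.
  apply/polyP => i; rewrite coef_map coef_poly /=; case: ltnP => [_|le]; first exact: ga.
  by rewrite nth_default //; symmetry; exact: (rmorph0 (jq j)).
move: sg gdvd; rewrite eh size_map_poly dvdp_map eqp_map => sh hl.
exact: irr.
Qed.

Let theta : H := Kf_H kind n j (thetabar kind n hf).

Lemma iter_tau_theta a : iter a tau theta = coefF_const kind n (j ('qX : Ff) ^+ (q ^ a)).
Proof.
have -> : theta = coefF_const kind n (j 'qX) by exact: coefF_map_const.
rewrite -(frob_iterE (jq j)).
by elim: a => //= a ->; rewrite tau_const.
Qed.

Lemma degf_gt0 : (0 < degf f)%N.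
Proof. by rewrite /degf; case: hf => -[sf _] _; case: (size f) sf => [|[]]. Qed.

(** A power of Frobenius fixing the generator fixes the whole field, whose q^d elements would then
    be roots of a polynomial of degree q^c. *)
Lemma qX_frob_neq c : (0 < c < degf f)%N -> ('qX : Ff) ^+ (q ^ c) != 'qX.
Proof.
move=> /andP[c0 cd]; apply/eqP => fixX.
pose g : {rmorphism Ff -> Ff} := iterm (frob (qfpoly_const hf)) c.
have gE y : g y = y ^+ (q ^ c) by exact: frob_iterE.
have gpoly (u : {poly Fq}) : g (in_qpoly f u : Ff) = in_qpoly f u.
  elim/poly_ind: u => [|u b IH].
    by rewrite raddf0; exact: rmorph0.
  have -> : (in_qpoly f (u * 'X + b%:P) : Ff)
      = (in_qpoly f u : Ff) * ('qX : Ff) + (in_qpoly f b%:P : Ff).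
    rewrite raddfD /=; congr (_ + _); exact: rmorphM.
  rewrite rmorphD rmorphM IH; congr (_ * _ + _); first by rewrite gE.
  rewrite gE; transitivity (in_qpoly f (b%:P ^+ (q ^ c)) : Ff); first by symmetry; exact: rmorphXn.
  rewrite -polyC_exp; congr (in_qpoly f _%:P).
  by elim: (c) => [|c' IHc]; rewrite ?expn0 ?expr1 // expnSr exprM IHc expf_card.
have gid (y : Ff) : y ^+ (q ^ c) = y.
  rewrite -gE; have mf : nonconst_monic f.
    by case: hf => -[sf _] mf; rewrite /nonconst_monic mf sf.
  by have := gpoly (y : {poly Fq}); rewrite (in_qpolyK mf).
have q1 : (1 < q ^ c)%N by rewrite -{1}(expn0 q) ltn_exp2l // finNzRing_gt1.
pose P : {poly Ff} := 'X^(q ^ c) - 'X.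
have sP : size P = (q ^ c).+1 by rewrite size_polyDl size_polyXn // size_polyN size_polyX.
have P0 : P != 0 by rewrite -size_poly_eq0 sP.
have := @max_poly_roots _ P (enum [set: Ff]%SET) P0.
rewrite enum_uniq sP -cardE cardsT (card_qfpoly hf) ltnS leqNgt ltn_exp2l ?finNzRing_gt1 // cd.
suff -> : all (root P) (enum [set: Ff]%SET) by move=> /(_ isT isT).
by apply/allP => y _; rewrite rootE !hornerE gid subrr.
Qed.

Lemma theta_conj_inj a b : (a < b < degf f)%N -> iter a tau theta != iter b tau theta.
Proof.
move=> /andP[ab bd]; rewrite !iter_tau_theta (inj_eq (@coefF_const_inj Fbar)) -!(rmorphXn j).
rewrite (inj_eq (fmorph_inj j)) -{1}(subnK (ltnW ab)) addnC expnD mulnC exprM.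
have lt : (0 < b - a < degf f)%N by rewrite subn_gt0 ab (leq_ltn_trans (leq_subr _ _)).
apply: contraNneq (qX_frob_neq lt) => e; apply/eqP/(fmorph_inj (iterm (frob (qfpoly_const hf)) a)).
rewrite /= /iterm [LHS]frob_iterE [RHS]frob_iterE. exact: esym e.
Qed.

(** Entry (i, a) is the i-th power of the a-th conjugate of theta. Its invertibility gives the basis
    of powers of theta over F_q{{Z}} and, later, the kernel of evaluation. *)
Definition conj_mx : 'M[H]_(degf f) := Vandermonde (degf f) (\row_a iter a tau theta).

Lemma conj_mx_unit : conj_mx \in unitmx.
Proof.
rewrite unitmxE det_Vandermonde unitfE; apply/prodf_neq0 => a _; apply/prodf_neq0 => b ab.
by rewrite !mxE subr_eq0 eq_sym theta_conj_inj // ab ltn_ord.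
Qed.

Lemma iter_tau_Kq a c : iter a tau (iota c) = iota c.
Proof. by elim: a => //= a ->; rewrite tau_Kq. Qed.

Lemma iter_tauM a x y : iter a tau (x * y) = iter a tau x * iter a tau y.
Proof. exact: (rmorphM (iterm tau a)). Qed.

Lemma theta_free (c : 'I_(degf f) -> Kq) :
  \sum_i iota (c i) * theta ^+ i = 0 -> forall i, c i = 0.
Proof.
move=> c0 i; pose u := \row_i iota (c i).
have : u *m conj_mx = 0.
  apply/rowP => a; transitivity (iterm tau a (\sum_i iota (c i) * theta ^+ i)); last first.
    by rewrite c0 mxE rmorph0.
  rewrite mxE rmorph_sum; apply: eq_bigr => b _; rewrite !mxE [RHS]iter_tauM iter_tau_Kq.
  by congr (_ * _); symmetry; exact: (rmorphXn (iterm tau a)).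
move/(canRL (mulmxK conj_mx_unit)); rewrite mul0mx => /rowP/(_ i).
by rewrite !mxE => /eqP; rewrite fmorph_eq0 => /eqP.
Qed.

(** The coefficients solve the linear system asserting the expansion for all conjugates at once. As
    tau^d fixes F_f{{Z}}, tau permutes the equations cyclically, so the unique solution is fixed by
    tau. *)
Lemma theta_span (y : Kf) : exists c : 'I_(degf f) -> Kq,
  y = \sum_i Kq_Kf kind n hf (c i) * thetabar kind n hf ^+ i.
Proof.
pose v := \row_(a < degf f) iter a tau (Kf_H kind n j y).
pose h := v *m invmx conj_mx.
have hv : h *m conj_mx = v by rewrite mulmxKV // conj_mx_unit.
have hE a : (a < degf f)%N ->
    \sum_i h 0 i * iter a tau theta ^+ i = iter a tau (Kf_H kind n j y).
  move=> la; have /rowP/(_ (Ordinal la)) := hv; rewrite !mxE => <-.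
  by apply: eq_bigr => i _; rewrite !mxE.
have iterd x : iter (degf f) tau (Kf_H kind n j x) = Kf_H kind n j x by exact: tau_d_Kf.
have tauh a : (a < degf f)%N ->
    \sum_i tau (h 0 i) * iter a.+1 tau theta ^+ i = iter a.+1 tau (Kf_H kind n j y).
  move=> la; rewrite [RHS]iterS -hE // rmorph_sum; apply: eq_bigr => i _.
  by rewrite rmorphM rmorphXn.
have : map_mx tau h *m conj_mx = v.
  apply/rowP => -[[|a] la]; rewrite !mxE.
    have ld : ((degf f).-1 < degf f)%N by rewrite prednK.
    have := tauh _ ld; rewrite prednK // !iterd => <-.
    by apply: eq_bigr => i _; rewrite !mxE.
  by rewrite -tauh 1?ltnW //; apply: eq_bigr => i _; rewrite !mxE.
rewrite -hv => /(can_inj (mulmxK conj_mx_unit))/rowP th.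
have /choice[c hc] : forall i, exists c, h 0 i = iota c.
  by move=> i; apply: tau_fix; have := th i; rewrite mxE.
exists c; apply: (fmorph_inj (Kf_H kind n j)).
rewrite -[LHS](hE 0%N) ?degf_gt0 // rmorph_sum; apply: eq_bigr => i _.
by rewrite rmorphM rmorphXn hc.
Qed.
End Setting.

(** * Points over the finite level *)

Section BaseChange.
Variables (kind : coef_field) (n : nat) (Fq : finFieldType).
Variables (f : {poly Fq}) (hf : monic_irreducible_poly f).
Variables (Fbar : closedFieldType) (j : {rmorphism {poly %/ f with hf} -> Fbar}).
Variables (l : nat) (E : {rmorphism {poly coefF kind n Fq} -> 'M[tpoly (tauf kind n hf)]_l}).
Hypothesis EC : forall c : coefF kind n Fq,
  E c%:P = (tpolyC (tauf kind n hf) (Kq_Kf kind n hf c))%:M.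

Local Notation Kq := (coefF kind n Fq).
Local Notation H := (coefF kind n Fbar).
Local Notation tau := (tau kind n j).
Local Notation iota := (Kq_H kind n j).
Local Notation EH := (base_change j E).
Local Notation M := (motive EH).
Local Notation W := (points EH).
Local Notation d := (degf f).
Local Notation theta := (Kf_H kind n j (thetabar kind n hf)).

Lemma base_changeC c : EH c%:P = (tpolyC tau (iota c))%:M.
Proof.
rewrite /= /base_change EC map_scalar_mx; congr (_%:M).
by rewrite /= /tmap /tpolyC map_polyC.
Qed.

Definition incl (x : points E) : W := map_mx (Kf_H kind n j) x.

Lemma tact_base_change a (x : 'cV_l) :
  tact (EH a) (map_mx (Kf_H kind n j) x) = map_mx (Kf_H kind n j) (tact (E a) x).
Proof.
apply/colP => i; rewrite mxE [RHS]mxE [in RHS]mxE rmorph_sum; apply: eq_bigr => b _.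
rewrite !mxE /teval rmorph_sum size_map_poly; apply: eq_bigr => k _.
rewrite rmorphM /tcoef coef_map; congr (_ * _).
by elim: (k : nat) => //= k' ->; rewrite Kf_H_tau.
Qed.

Lemma incl_is_linear : linear incl.
Proof.
move=> a x y; rewrite /incl [LHS]map_mxD; congr (_ + _).
by rewrite -[LHS]tact_base_change.
Qed.
HB.instance Definition _ := GRing.isLinear.Build {poly Kq} (points E) W _ incl incl_is_linear.

Lemma incl_inj : injective incl.
Proof.
move=> x y e; apply/colP => i; apply: (fmorph_inj (Kf_H kind n j)).
by have := congr1 (fun u : 'cV_l => u i 0) e; rewrite !mxE.
Qed.

Lemma tau_d_incl x : tau_d j E (incl x) = incl x.
Proof. by apply/colP => i; rewrite !mxE tau_d_Kf. Qed.

Definition rho (m : M) : M := m *m (tpolyX tau ^+ d)%:M.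

Lemma tpolyXd_comm a b c : tpolyX tau ^+ d * EH a b c = EH a b c * tpolyX tau ^+ d.
Proof.
have fixE k : iter d tau (tcoef (EH a b c) k) = tcoef (EH a b c) k.
  by rewrite mxE /tcoef coef_map; exact: tau_d_Kf.
rewrite (tpoly_def (EH a b c)) mulr_sumr mulr_suml; apply: eq_bigr => i _.
by rewrite mulrA tpolyX_expC -!mulrA -!exprD addnC fixE.
Qed.

Lemma rho_is_linear : linear rho.
Proof.
move=> a x y; rewrite /rho [LHS]mulmxDl; congr (_ + _).
rewrite [in LHS]/(_ *: _) /= /motive_scale mulmx_suml; apply: eq_bigr => i _.
rewrite -scalemxAl -!mulmxA; congr (_ *: (_ *m _)).
apply/matrixP => b c; rewrite mul_scalar_mx [RHS]mxE tpolyXd_comm [LHS]mxE (bigD1 c) //=.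
rewrite big1 ?addr0 => [|c' /negPf cc']; first by rewrite [X in _ * X]mxE eqxx mulr1n.
by rewrite [X in _ * X]mxE cc' mulr0n mulr0.
Qed.
HB.instance Definition _ := GRing.isLinear.Build {poly H} M M _ rho rho_is_linear.

Lemma teval_tpolyX a x : teval (tpolyX tau ^+ a) x = iter a tau x.
Proof.
elim: a => [|a IH]; first by rewrite expr0 teval1.
rewrite exprS tevalM IH /= {1}/teval size_polyX !big_ord_recl big_ord0 /tcoef !coefX /=.
by rewrite mul0r mul1r add0r addr0.
Qed.

Lemma pair_rho (m : M) (x : W) : pair (rho m) x = pair m (tau_d j E x).
Proof.
rewrite /pair tactM; congr (tact _ _ 0 0); apply/colP => i; rewrite !mxE.
rewrite (bigD1 i) //= mxE eqxx mulr1n teval_tpolyX big1 ?addr0 // => i' /negPf ii'.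
by rewrite mxE eq_sym ii' mulr0n teval0l.
Qed.

Definition incl_basis_size := #|{: 'I_l * 'I_d}|.
Local Notation N := incl_basis_size.

Definition incl_basis (z : 'I_N) : points E :=
  thetabar kind n hf ^+ (enum_val z).2 *: delta_mx (enum_val z).1 0.

Lemma incl_basisE (g : 'I_l -> 'I_d -> Kq) b :
  incl (lincomb (map_mx polyC (\row_z g (enum_val z).1 (enum_val z).2)) incl_basis) b 0
  = \sum_i iota (g b i) * theta ^+ i.
Proof.
transitivity (\sum_z iota (g (enum_val z).1 (enum_val z).2) *
    Kf_H kind n j ((incl_basis z : 'cV_l) b 0)).
  rewrite linear_sum summxE; apply: eq_bigr => z _.
  rewrite [X in X *: _]mxE [X in X%:P *: _]mxE (points_scaleC EC).
  by rewrite mxE [X in Kf_H _ _ _ X = _]mxE rmorphM.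
rewrite (reindex (@enum_rank {: 'I_l * 'I_d})) /=; last exact/onW_bij/enum_rank_bij.
transitivity (\sum_(z : 'I_l * 'I_d) if z.1 == b then iota (g b z.2) * theta ^+ z.2 else 0).
  apply: eq_bigr => -[a i] _; rewrite /incl_basis enum_rankK /= !mxE eqxx andbT eq_sym.
  case: eqP => [->|_]; last by rewrite mulr0 rmorph0 mulr0.
  by rewrite mulr1 rmorphXn.
rewrite -(pair_bigA _ (fun a i => if a == b then iota (g b i) * theta ^+ i else 0)) /=.
rewrite (bigD1 b) //= eqxx [X in _ + X]big1 ?addr0 // => a /negPf ab.
by rewrite ab big1.
Qed.

Lemma incl_basis_free (c : 'rV[Kq]_N) :
  lincomb (map_mx polyC c) incl_basis = 0 -> c = 0.
Proof.
move=> c0; pose g a i := c 0 (enum_rank (a, i)).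
have ec : c = \row_z g (enum_val z).1 (enum_val z).2.
  by apply/rowP => z; rewrite mxE /g -surjective_pairing enum_valK.
have g0 b : forall i, g b i = 0.
  by apply: (theta_free (j := j)); rewrite -incl_basisE -ec c0 linear0 mxE.
by apply/rowP => z; rewrite ec !mxE.
Qed.

Lemma incl_basis_span (x : points E) :
  exists c : 'rV[Kq]_N, x = lincomb (map_mx polyC c) incl_basis.
Proof.
have [g xg] := choice (fun b => theta_span j ((x : 'cV_l) b 0)).
exists (\row_z g (enum_val z).1 (enum_val z).2); apply: incl_inj; apply/colP => b.
rewrite incl_basisE mxE xg rmorph_sum; apply: eq_bigr => i _.
by rewrite rmorphM rmorphXn.
Qed.

Lemma pair_incl_surj (v : 'I_N -> H) : exists m : M, forall z, pair m (incl (incl_basis z)) = v z.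
Proof.
apply: (pair_surj (@tauK kind n Fq f hf Fbar j) (@sigmaK kind n Fq f hf Fbar j)
  (@tau_Kq kind n Fq f hf Fbar j) (@tau_fix kind n Fq f hf Fbar j) base_changeC) => c c0 z.
have /rowP/(_ z) : \row_z c z = 0; last by rewrite !mxE.
apply: incl_basis_free; apply: incl_inj; rewrite linear0 linear_sum -[RHS]c0.
by apply: eq_bigr => z' _; rewrite !mxE linearZ.
Qed.

(* Division by 1 - tau^d leaves entries of degree below d, which are determined by
   their values at the powers of theta. *)
Lemma pair_incl_kernel (m : M) :
  (forall x, pair m (incl x) = 0) <-> exists g, m = g - rho g.
Proof.
split=> [m0|[g ->] x]; last by rewrite pairBl pair_rho tau_d_incl subrr.
pose D : tpoly tau := 1 - tpolyX tau ^+ d.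
have sD : size (D : {poly H}) = d.+1.
  have -> : D = 1 - 'X^d :> {poly H} by rewrite /D tpolyX_exp.
  by rewrite addrC size_polyDl size_polyN size_polyXn // size_poly1 ltnS degf_gt0.
have D0 : D != 0 by rewrite -[D == 0]size_poly_eq0 sD.
have [q qr] := choice (fun c => tpoly_divr ((m : 'rV_l) 0 c) D0).
have {qr}[r qr] := choice qr.
have tX i : iter d tau (theta ^+ i) = theta ^+ i.
  by rewrite -rmorphXn; exact: tau_d_Kf.
have r0 c : r c = 0.
  have [ec sr] := qr c; rewrite sD ltnS in sr.
  pose u : 'rV_d := \row_a tcoef (r c) a.
  have : u *m (conj_mx kind n j)^T = 0.
    apply/rowP => i; rewrite [RHS]mxE -[RHS](m0 (thetabar kind n hf ^+ i *: delta_mx c 0)).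
    rewrite pairE (bigD1 c) //= [X in _ + X]big1 ?addr0 => [|c' /negPf cc']; last first.
      by rewrite !mxE cc' mulr0 rmorph0 teval0r.
    rewrite !mxE !eqxx mulr1 rmorphXn ec tevalDl tevalM.
    have -> : teval D (theta ^+ i) = 0.
      apply/eqP; rewrite -(inj_eq (addIr (teval (tpolyX tau ^+ d) (theta ^+ i)))) -tevalDl subrK.
      by rewrite teval1 teval_tpolyX tX add0r.
    rewrite teval0r add0r /teval.
    rewrite (big_ord_widen d (fun a => tcoef (r c) a * iter a tau (theta ^+ i))) //.
    rewrite [RHS]big_mkcond; apply: eq_bigr => a _; rewrite !mxE; case: ltnP => [_|le].
      by congr (_ * _); symmetry; exact: (rmorphXn (iterm tau a)).
    by rewrite /tcoef nth_default // mul0r.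
  have uC : (conj_mx kind n j)^T \in unitmx by rewrite unitmx_tr conj_mx_unit.
  move/(canRL (mulmxK uC)); rewrite mul0mx => /rowP u0.
  apply/polyP => a; rewrite coef0; have [la|le] := ltnP a d.
    by have := u0 (Ordinal la); rewrite !mxE.
  by apply: nth_default; apply: leq_trans le.
exists (\row_c q c); transitivity ((\row_c q c) *m D%:M); last first.
  by rewrite /D (raddfB (@scalar_mx _ l)) mulmxBr mulmx1.
apply/rowP => c; rewrite [LHS](qr c).1 r0 addr0 mxE (bigD1 c) //= !mxE eqxx mulr1n.
by rewrite big1 ?addr0 // => c' /negPf cc'; rewrite !mxE cc' mulr0n mulr0.
Qed.
End BaseChange.

Section AdicEval.
Variables (K : fieldType) (p : {poly K}) (hp : nonconst_monic p) (m : nat).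
Definition adic_eval (a : adic hp) : {poly %/ p ^+ m.+1} := a m.
Fact adic_eval_is_zmod_morphism : zmod_morphism adic_eval.
Proof. by []. Qed.
Fact adic_eval_is_monoid_morphism : monoid_morphism adic_eval.
Proof. by split=> //; exact: (rmorph1 (in_qpoly (p ^+ m.+1))). Qed.
HB.instance Definition _ := GRing.isZmodMorphism.Build (adic hp) {poly %/ p ^+ m.+1}
  adic_eval adic_eval_is_zmod_morphism.
HB.instance Definition _ := GRing.isMonoidMorphism.Build (adic hp) {poly %/ p ^+ m.+1}
  adic_eval adic_eval_is_monoid_morphism.
End AdicEval.

Lemma size_expS_gt (K : fieldType) (p : {poly K}) m :
  nonconst_monic p -> (m < size (p ^+ m.+1))%N.
Proof.
move=> /andP[mp sp]; have p0 : p ^+ m.+1 != 0 by rewrite monic_neq0 ?monic_exp.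
rewrite -(prednK (n := size _)) ?size_poly_gt0 // size_exp ltnS mulnC.
apply: leq_trans (leqnSn m) _; apply: leq_pmulr.
by case: (size p) sp => [|[]].
Qed.

Lemma to_adic_inj (K : fieldType) (p : {poly K}) (hp : nonconst_monic p) :
  injective (to_adic hp).
Proof.
move=> a b e; apply/eqP; rewrite -subr_eq0; apply/negPn/negP => ab0.
have := congr1 (adic_eval (size (a - b))) e.
move/(eq_in_qpoly (nonconst_monic_exp hp _))/(dvdp_leq ab0).
by rewrite leqNgt size_expS_gt.
Qed.

Lemma char_poly_horner1 (R : comNzRingType) s (A : 'M[R]_s) :
  (char_poly A).[1] = \det (1%:M - A).
Proof.
rewrite -[_.[1]]/(horner_eval 1 _) /char_poly -det_map_mx; congr (\det _).
apply/matrixP => i j; by rewrite !mxE /= /horner_eval hornerD hornerN hornerC hornerMn hornerX.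
Qed.

Lemma char_poly_mx_tr (R : nzRingType) s (A : 'M[R]_s) : char_poly_mx A^T = (char_poly_mx A)^T.
Proof. by apply/matrixP => i k; rewrite !mxE eq_sym. Qed.

Lemma is_basis_torsionfree (R : idomainType) (V : lmodType R) r (e : 'I_r -> V)
    (a : R) (x : V) :
  is_basis e -> a != 0 -> a *: x = 0 -> x = 0.
Proof.
move=> /is_basisP[gen free] a0; have [c ->] := gen x; rewrite -lincombZ => /free/rowP ac.
have -> : c = 0; last exact: lincomb0.
apply/rowP => i; have := ac i; rewrite !mxE => /eqP.
by rewrite mulf_eq0 (negPf a0) => /eqP.
Qed.

Section OrderDeterminant.
Variables (kind : coef_field) (n : nat) (Fq : finFieldType).
Variables (f : {poly Fq}) (hf : monic_irreducible_poly f).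
Variables (Fbar : closedFieldType) (j : {rmorphism {poly %/ f with hf} -> Fbar}).
Variables (l : nat) (E : {rmorphism {poly coefF kind n Fq} -> 'M[tpoly (tauf kind n hf)]_l}).
Hypothesis EC : forall c : coefF kind n Fq,
  E c%:P = (tpolyC (tauf kind n hf) (Kq_Kf kind n hf c))%:M.

Local Notation Kq := (coefF kind n Fq).
Local Notation iota := (Kq_H kind n j).
Local Notation M := (motive (base_change j E)).

Variables (r : nat) (e : 'I_r -> M) (Th : 'M[{poly coefF kind n Fbar}]_r).
Hypotheses (base : is_basis e) (rhoe : forall i, rho (e i) = lincomb (row i Th) e).

Lemma module_order_det :
  module_order (points E) \is monic /\
  map_poly iota (module_order (points E)) %= \det (1%:M - Th).
Proof.
have EHC := base_changeC j EC; have tau_iota := @tau_Kq kind n Fq f hf Fbar j.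
have [i|T XT] := @rows_choice Kq _ (incl_basis_size f l) (fun i u =>
    'X *: incl_basis E i = lincomb (map_mx polyC u) (incl_basis E)).
  exact: (incl_basis_span j EC).
have prT : presents (fun x : points E => x = 0) (incl_basis E) (char_poly_mx T).
  apply: presents_char_poly_mx => [|v|c c0|i].
  - exact: submodule_eq0.
  - by have [c ->] := incl_basis_span j EC v; exists c; rewrite subrr.
  - exact: (incl_basis_free j EC).
  by rewrite XT subrr.
have chi_monic : \det (char_poly_mx T) \is monic by exact: char_poly_monic.
have ord : is_order (points E) (module_order (points E)).
  have [P isP] := is_order_exists prT (monic_neq0 chi_monic).
  exact: (xgetPex 0 (P := [set P | is_order (points E) P]) (ex_intro _ P isP)).
have [mord [n' [a [h [prh detP]]]]] := is_order_presents ord; split=> //.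
have assoc (L : fieldType) (V : lmodType {poly L}) (J : V -> Prop) n1 n2 (b1 : 'I_n1 -> V)
    (b2 : 'I_n2 -> V) B1 B2 : submodule J -> presents J b1 B1 -> presents J b2 B2 ->
    \det B1 %= \det B2.
  move=> subJ pr1 pr2; apply/andP; split.
    by have [w ->] := presents_det subJ pr2 pr1; rewrite dvdp_mull.
  by have [w ->] := presents_det subJ pr1 pr2; rewrite dvdp_mull.
have Pchi : module_order (points E) %= char_poly T.
  by rewrite -detP; apply: assoc prh prT; exact: submodule_eq0.
pose I (m : M) := exists g, m = g - rho g.
have subI : submodule I.
  split=> [|x y [g ->] [g' ->]|c x [g ->]]; first by exists 0; rewrite linear0 subr0.
    by exists (g + g'); rewrite linearD opprD addrACA.
  by exists (c *: g); rewrite linearZ scalerBr.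
have [gen free] := is_basisP base.
have rhoE u : rho (lincomb u e) = lincomb (u *m Th) e.
  by rewrite lincomb_mul linear_sum; apply: eq_bigr => i _; rewrite linearZ /= rhoe.
have prTh : presents I e (1%:M - Th).
  split=> [v|u]; first by have [c ->] := gen v; exists c; rewrite subrr; case: subI.
  split=> [[g]|[w ->]]; last first.
    by exists (lincomb w e); rewrite rhoE -lincombB mulmxBr mulmx1.
  have [c ->] := gen g; rewrite rhoE -lincombB => /eqP.
  rewrite -subr_eq0 -lincombB => /eqP/free/eqP.
  by rewrite subr_eq0 => /eqP ->; exists c; rewrite mulmxBr mulmx1.
have [m mP] := choice (fun i => pair_incl_surj j EC (fun z => (z == i)%:R)).
have Iz v : (forall z, pair v (incl j (incl_basis E z)) = 0) -> I v.
  move=> v0; apply/pair_incl_kernel => x; have [c ->] := incl_basis_span j EC x.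
  rewrite linear_sum pair_sumr big1 // => z _.
  by rewrite mxE linearZ /= (pairCr tau_iota EHC) v0 mulr0.
have pairm c z : pair (lincomb (map_mx polyC c) m) (incl j (incl_basis E z)) = c 0 z.
  rewrite pair_suml (bigD1 z) //= mxE pairCl mP eqxx mulr1 big1 ?addr0 // => z' /negPf zz'.
  by rewrite mxE pairCl mP eq_sym zz' mulr0.
have prm : presents I m (char_poly_mx (map_mx iota T)^T).
  apply: presents_char_poly_mx => // [v|c /pair_incl_kernel c0|i].
  - exists (\row_z pair v (incl j (incl_basis E z))); apply: Iz => z.
    by rewrite pairBl pairm mxE subrr.
  - by apply/rowP => z; rewrite mxE -pairm c0.
  apply: Iz => z; rewrite pairBl pairm pair_scaleX -linearZ XT.
  rewrite linear_sum pair_sumr (bigD1 i) //= big1 => [|z' /negPf zz'].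
    by rewrite addr0 mxE linearZ /= (pairCr tau_iota EHC) mP eqxx mulr1 !mxE subrr.
  by rewrite mxE linearZ /= (pairCr tau_iota EHC) mP zz' mulr0.
have := assoc _ _ _ _ _ _ _ _ _ subI prm prTh; rewrite char_poly_mx_tr det_tr -/(char_poly _).
by rewrite -map_char_poly; apply: eqp_trans; rewrite eqp_map.
Qed.
End OrderDeterminant.

Lemma Char_exists (R : comNzRingType) (V : lmodType R) (phi : {linear V -> V})
    s (eps : 'I_s -> V) :
  is_basis eps -> is_char_poly phi (Char phi).
Proof.
move=> bas; have [gen _] := is_basisP bas.
have [A phiA] := rows_choice (fun i => gen (phi (eps i))).
suff ex : exists P, is_char_poly phi P by exact: (xgetPex 0 (P := [set P | is_char_poly phi P]) ex).
exists (char_poly A^T), s, eps, A^T; split=> // i.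
by rewrite phiA; apply: eq_bigr => k _; rewrite !mxE.
Qed.

Theorem theorem3p27
  (kind : coef_field) (n : nat) (Fq : finFieldType)
  (f : {poly Fq}) (hf : monic_irreducible_poly f)
  (Fbar : closedFieldType) (j : {rmorphism {poly %/ f with hf} -> Fbar})
  (hj : integralRange j)
  (l r : nat)
  (E : {rmorphism {poly coefF kind n Fq} -> 'M[tpoly (tauf kind n hf)]_l})
  (hE : is_tmodule E)
  (lam : {poly Fq}) (hlam : monic_irreducible_poly lam) (hne : lam <> f)
  (ha : free_of_rank (motive (base_change j E)) r)
  (hb : free_of_rank (motive (adjoint j E)) r)
  (hc : forall m : nat, (1 <= m)%N ->
     full_dimension (Kq_H kind n j) (base_change j E (lamK kind n lam ^+ m))
       [set x | tact (base_change j E (lamK kind n lam ^+ m)) x = 0] /\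
     full_dimension (Kq_H kind n j) (base_change j E (lamK kind n lam ^+ m))
       [set x | tact (adjoint j E (lamK kind n lam ^+ m)) x = 0]) :
  let hp := lamK_nonconst kind n hlam in
  let char_at_1 : adic hp := (Char (tate_map hp (tau_d j E))).[1] in
  exists gamma : coefF kind n Fq,
    [/\ gamma != 0,
        module_order (points E) \is monic,
        to_adic hp (module_order (points E)) = to_adic hp gamma%:P * char_at_1
      & forall g : coefF kind n Fq, g != 0 ->
          (exists2 h, h \is monic & to_adic hp h = to_adic hp g%:P * char_at_1) ->
          g = gamma].
Proof.
move=> hp char_at_1; set p := lamK kind n lam in hp char_at_1 *.
pose iota := Kq_H kind n j; have [EC _] := hE; have EHC := base_changeC j EC.
have tau_iota := @tau_Kq kind n Fq f hf Fbar j.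
have [e base] := ha.
have perf m : perfect iota (base_change j E) (p ^+ m.+1).
  have [fd _] := hc m.+1 (ltn0Sn m).
  exact: (full_dimension_perfect (@tauK kind n Fq f hf Fbar j)
    (@sigmaK kind n Fq f hf Fbar j) tau_iota (@tau_fix kind n Fq f hf Fbar j) EHC fd).
have p0 : p != 0 by apply: nonconst_monic_neq0 hp.
have div m (x : points (base_change j E)) : p ^+ m.+1 *: x = 0 -> exists y, p *: y = x.
  apply: (perfect_divisible tau_iota EHC _ (perf m)) => [v|].
    by apply: (is_basis_torsionfree base); rewrite map_poly_eq0.
  by rewrite -exprS; apply: perf.
have [s0 [eps0 bas0]] : exists s (eps : 'I_s -> tate (points (base_change j E)) hp), is_basis eps.
  have [N [w [pw gen _ _]]] := perf 0; apply: (@tate_basis_exists _ p hp _ div N w).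
  - exact: (lamK_irreducible kind n j hlam).
  - by move=> i; rewrite -(expr1 p); apply: pw.
  by move=> x px; have [|c ->] := gen x; [rewrite expr1|exists (map_mx polyC c)].
have [s [eps [A [bas phiA charE]]]] := Char_exists (tate_map hp (tau_d j E)) bas0.
have [gene free] := is_basisP base.
have [Th rhoTh] := rows_choice (fun i => gene (rho (e i))).
have [mord ordD] := module_order_det EC base rhoTh.
set P := module_order (points E) in mord ordD *.
pose D := \det (1%:M - Th).
pose a m : 'M[{poly coefF kind n Fq}]_s := \matrix_(i, k) (A k i m : {poly _}).
pose delta m := \det (1%:M - a m).
have charm m : char_at_1 m = in_qpoly (p ^+ m.+1) (delta m).
  rewrite -[LHS]/(adic_eval m char_at_1) /char_at_1 charE char_poly_horner1.
  rewrite -(det_map_mx (adic_eval m)) -(det_map_mx (in_qpoly (p ^+ m.+1))) -[RHS]det_tr.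
  congr (\det _); apply/matrixP => i k; rewrite !mxE [LHS]rmorphB [RHS]rmorphB.
  congr (_ - _); first by rewrite !rmorph_nat eq_sym.
  by rewrite [RHS]in_qpolyK //; exact: nonconst_monic_exp.
have deltaD m : map_poly iota (p ^+ m.+1) %| map_poly iota (delta m) - D.
  have [pw gen rel] := basis_level div m bas.
  have hpm := nonconst_monic_exp hp m.
  apply/(eq_in_qpoly (nonconst_monic_map iota hpm)); rewrite -det_map_mx map_mxB map_mx1.
  apply: (level_det tau_iota EHC hpm (perf m) pw gen rel (phi := tau_d j E)) base rhoTh _
    => [i|v x].
    rewrite [LHS](congr1 (fun X : tate _ hp => X m) (phiA i)) tate_sumE.
    by apply: eq_bigr => k _; rewrite !mxE.
  exact: pair_rho.
have [D0 DE] : exists D0, D = map_poly iota D0.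
  exists (delta (size D) %% p ^+ (size D).+1).
  rewrite map_modp -[map_poly _ (delta _)](subrK D) modpD (modp_eq0 (deltaD _)) add0r.
  by rewrite modp_small // size_map_poly size_expS_gt.
have charD0 : char_at_1 = to_adic hp D0.
  apply: adicP => m; rewrite charm; apply/(eq_in_qpoly (nonconst_monic_exp hp m)).
  by rewrite -(dvdp_map iota) rmorphB /= -DE; apply: deltaD.
have PD0 : P %= D0 by rewrite -(eqp_map iota) -DE.
have lD0 : lead_coef D0 != 0.
  by rewrite lead_coef_eq0; apply: contraTneq PD0 => ->; rewrite eqp0 monic_neq0.
have lD0V : (lead_coef D0)^-1 != 0 by rewrite invr_eq0.
exists (lead_coef D0)^-1; split=> // [|g g0 [h mh]].
  rewrite charD0 -rmorphM mul_polyC; congr to_adic; apply/eqP; rewrite -eqp_monic //.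
    by rewrite (eqp_trans PD0) // eqp_sym eqp_scale.
  by rewrite monicE lead_coefZ mulVf.
rewrite charD0 -rmorphM mul_polyC => /to_adic_inj eh.
by apply: (mulIf lD0); rewrite mulVf // -lead_coefZ -eh (monicP mh).
Qed.
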